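(* Let $\Omega^j$ ($j\ge1$) and $\Omega_\infty$ be domains in $\mathbb{C}^n$ such that $\Omega^j\to\Omega_\infty$ in the local Hausdorff sense. Assume: (a) $K_{\Omega_\infty}(z,z)>0$ for all $z\in\Omega_\infty$ and $b_{\Omega_\infty}$ is positive definite; (b) $\Omega^j$ and $\Omega_\infty$ are Bergman complete; (c) $K_{\Omega^j}(z,z)\to K_{\Omega_\infty}(z,z)$ for every $z\in\Omega_\infty$. Then for every $z^0\in\Omega_\infty$, $d^b_{\Omega^j}(z^0,\cdot)\to d^b_{\Omega_\infty}(z^0,\cdot)$ uniformly on compact subsets of $\Omega_\infty$.
   Context: $\Omega^j\to\Omega_\infty$ in the local Hausdorff sense means: every compact subset of $\Omega_\infty$ is contained in $\Omega^j$ for all large $j$, and every compact set contained in the interior of $\bigcap_{j\ge j_0}\Omega^j$ for some $j_0$ is contained in $\Omega_\infty$. $K_\Omega$ is the Bergman kernel; $b_\Omega(z,\xi)=(\sum_{\mu,\nu}g^\Omega_{\mu\nu}(z)\xi_\mu\bar\xi_\nu)^{1/2}$ with $g^\Omega_{\mu\nu}=\partial^2\log K_\Omega(z,z)/\partial z_\mu\partial\bar z_\nu$ is the Bergman metric, $d^b_\Omega$ the induced distance. Bergman complete: $K_\Omega(z,z)>0$ on $\Omega$, $b_\Omega$ is positive definite, and $(\Omega,d^b_\Omega)$ is a complete metric space. *)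

(* Defs.v *)
(* C = R[i] (complex numbers over an
   arbitrary realType R, from mathcomp-real-closed), C^n = 'rV[R[i]]_n. *)
From HB Require Import structures.
From mathcomp Require Import all_boot all_order all_algebra.
From mathcomp Require Import all_classical all_reals all_analysis.
From mathcomp Require Import complex.
Import Order.TTheory GRing.Theory Num.Theory ComplexField numFieldNormedType.Exports.

Set Implicit Arguments.
Unset Strict Implicit.
Unset Printing Implicit Defensive.

Local Open Scope classical_set_scope.
Local Open Scope ring_scope.
Local Open Scope complex_scope.

(* The standard (modulus) topology / normed structure of C = R[i], taken from
   its numFieldType structure, declared canonical on R[i] itself so that
   C^n = 'rV[R[i]]_n gets its product (normed) topology. *)
Set Warnings "-redundant-canonical-projection".
HB.instance Definition _ (R : realType) := NormedModule.copy R[i] (R[i]^o).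

Section Bergman.
Variable R : realType.
Local Notation C := R[i].
Variable n : nat.
Local Notation Cn := 'rV[C]_n.

(* Domains in C^n                                                     *)
Definition domain (O : set Cn) : Prop := open O /\ connected O /\ O !=set0.

(* Local Hausdorff convergence of O j to Oinf (definition from the paper) *)
Definition local_hausdorff_cvg (O : nat -> set Cn) (Oinf : set Cn) : Prop :=
  (forall Kc : set Cn, compact Kc -> Kc `<=` Oinf ->
      \forall j \near \oo, Kc `<=` O j) /\
  (forall (Kc : set Cn) (j0 : nat), compact Kc ->
      Kc `<=` interior (\bigcap_(j in [set j | (j0 <= j)%N]) O j) ->
      Kc `<=` Oinf).

(* Lebesgue integration on C^n = R^(2n)                               *)
(* A point of R^(2n) is given by its coordinate sequence v : nat -> R;
   the point of C^n it represents has j-th coordinate v(2j) + i v(2j+1). *)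
Definition cpt (v : nat -> R) : Cn := \row_j (v (2 * j)%N +i* v (2 * j).+1)%C.

(* iterated Lebesgue integral over the first k real coordinates
   (for nonnegative integrands this is the Lebesgue integral on R^k by
   Tonelli's theorem) *)
Fixpoint iint (k : nat) (F : (nat -> R) -> \bar R) : \bar R :=
  match k with
  | 0 => F (fun _ => 0)
  | k'.+1 => (\int[@lebesgue_measure R]_(x in setT)
               iint k' (fun v => F (fun i => if i == k' then x else v i)))%E
  end.

(* integral over O of a nonnegative extended-real function on C^n *)
Definition intC (O : set Cn) (h : Cn -> \bar R) : \bar R :=
  iint (2 * n) (fun v => if cpt v \in O then h (cpt v) else 0%E).

(* integral over O of a real (signed) function: positive minus negative part *)
Definition rintC (O : set Cn) (h : Cn -> R) : R :=
  fine (intC O (fun z => (Num.max (h z) 0)%:E)) -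
  fine (intC O (fun z => (Num.max (- h z) 0)%:E)).

(* L^2 inner product <f, g> = \int_O f conj(g) *)
Definition l2inner (O : set Cn) (f g : Cn -> C) : C :=
  (rintC O (fun z => complex.Re (f z * (g z)^*)) +i* rintC O (fun z => complex.Im (f z * (g z)^*)))%C.

(* holomorphic on O: complex (Frechet) differentiable at every point of O *)
Definition holomorphic (O : set Cn) (f : Cn -> C) : Prop :=
  forall z, O z -> differentiable f z.

(* Bergman space A^2(O) *)
Definition A2 (O : set Cn) (f : Cn -> C) : Prop :=
  holomorphic O f /\ (intC O (fun z => (complex.Re (f z * (f z)^*))%:E) < +oo)%E.

(* k is a (the) Bergman kernel of O: reproducing kernel of A^2(O) *)
Definition is_bergman_kernel (O : set Cn) (k : Cn -> Cn -> C) : Prop :=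
  forall w, O w -> A2 O (fun z => k z w) /\
    forall f, A2 O f -> f w = l2inner O f (fun z => k z w).

(* The Bergman kernel K_O (its values on O x O do not depend on the choice) *)
Definition bergman_kernel (O : set Cn) : Cn -> Cn -> C :=
  match pselect (exists k, is_bergman_kernel O k) with
  | left H => projT1 (cid H)
  | right _ => fun _ _ => 0
  end.

(* Bergman metric                                                     *)
(* real directional derivative of phi : C^n -> R in direction v *)
Definition rD (phi : Cn -> R) (v : Cn) : Cn -> R :=
  fun z => derive1 (fun t : R => phi (z + (t%:C)%C *: v)) 0.

Definition evec (mu : 'I_n) : Cn := delta_mx 0 mu.          (* d/dx_mu *)
Definition ivec (mu : 'I_n) : Cn := 'i%C *: delta_mx 0 mu.   (* d/dy_mu *)

Definition logK (O : set Cn) : Cn -> R :=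
  fun z => ln (complex.Re (bergman_kernel O z z)).

(* g_{mu nu} = d^2 log K(z,z) / dz_mu d(conj z_nu), via Wirtinger derivatives:
   d_{z_mu} d_{zbar_nu} = 1/4 [ (dx_mu dx_nu + dy_mu dy_nu)
                              + i (dx_mu dy_nu - dy_mu dx_nu) ] *)
Definition bergman_g (O : set Cn) (mu nu : 'I_n) (z : Cn) : C :=
  let phi := logK O in
  (4%:R)^-1 *
  ((rD (rD phi (evec nu)) (evec mu) z + rD (rD phi (ivec nu)) (ivec mu) z)%:C%C
   + 'i%C * (rD (rD phi (ivec nu)) (evec mu) z
             - rD (rD phi (evec nu)) (ivec mu) z)%:C%C).

(* sum_{mu,nu} g_{mu nu}(z) xi_mu conj(xi_nu) *)
Definition bergman_form (O : set Cn) (z xi : Cn) : C :=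
  \sum_(mu < n) \sum_(nu < n) bergman_g O mu nu z * xi 0 mu * (xi 0 nu)^*.

(* b_O(z, xi) *)
Definition bergman_metric (O : set Cn) (z xi : Cn) : R :=
  Num.sqrt (complex.Re (bergman_form O z xi)).

(* b_O positive definite (at every point of O) *)
Definition bergman_posdef (O : set Cn) : Prop :=
  forall z, O z -> forall xi : Cn, xi != 0 -> 0 < bergman_form O z xi.

(* Bergman distance                                                   *)
(* real and imaginary parts of the coordinates of a curve *)
Definition ccoord (g : R -> Cn) (j : 'I_n) (b : bool) : R -> R :=
  fun t => if b then complex.Re (g t 0 j) else complex.Im (g t 0 j).

(* velocity of a curve *)
Definition cvel (g : R -> Cn) (t : R) : Cn :=
  \row_j (derive1 (ccoord g j true) t +i* derive1 (ccoord g j false) t)%C.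

(* u is C^1 on [a, b] *)
Definition C1_on (u : R -> R) (a b : R) : Prop :=
  exists du : R -> R, {within `[a, b], continuous du} /\
    forall t, a < t < b -> derivable u t 1 /\ derive1 u t = du t.

(* piecewise C^1 curves in O from z to w, parametrized by [0, 1] *)
Definition pw_C1_curve (O : set Cn) (z w : Cn) (g : R -> Cn) : Prop :=
  g 0 = z /\ g 1 = w /\ (forall t, 0 <= t <= 1 -> O (g t)) /\
  {within `[0, 1], continuous g} /\
  exists (k : nat) (p : nat -> R), p 0%N = 0 /\ p k = 1 /\
    (forall i, (i < k)%N -> p i < p i.+1) /\
    (forall i, (i < k)%N -> forall j b, C1_on (ccoord g j b) (p i) (p i.+1)).

(* b_O-length of a curve *)
Definition bergman_length (O : set Cn) (g : R -> Cn) : \bar R :=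
  (\int[@lebesgue_measure R]_(t in `[0%R, 1%R]) (bergman_metric O (g t) (cvel g t))%:E)%E.

(* d^b_O(z, w) = inf of lengths of piecewise C^1 curves in O joining z to w *)
Definition bergman_dist (O : set Cn) (z w : Cn) : R :=
  fine (ereal_inf [set bergman_length O g | g in pw_C1_curve O z w]).

(* Bergman completeness *)
Definition bergman_complete (O : set Cn) : Prop :=
  (forall z, O z -> 0 < bergman_kernel O z z) /\
  bergman_posdef O /\
  (forall u : nat -> Cn, (forall k, O (u k)) ->
     (forall e : R, 0 < e -> exists N, forall m k, (N <= m)%N -> (N <= k)%N ->
        bergman_dist O (u m) (u k) < e) ->
     exists2 p, O p & (fun k => bergman_dist O (u k) p) @ \oo --> (0 : R)).

End Bergman.

(* Main.v *)
Require Import Defs.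
From HB Require Import structures.
From mathcomp Require Import all_boot all_order all_algebra.
From mathcomp Require Import all_classical all_reals all_analysis measurable_realfun.
From mathcomp Require Import complex ring lra.
Import Order.TTheory GRing.Theory Num.Theory ComplexField Normc numFieldNormedType.Exports.
Set Implicit Arguments.
Unset Strict Implicit.
Unset Printing Implicit Defensive.
Local Open Scope classical_set_scope.
Local Open Scope ring_scope.

(* The kernels are sesquiholomorphic and, by the L^2 sub-mean value inequality,
   bounded on compact subsets uniformly in j. Cauchy estimates then bound the
   directional derivatives of K_j(z, z) up to order three, so pointwise
   convergence on the diagonal already forces locally uniform convergence of the
   second derivatives of log K_j(z, z): on compact sets the metrics b_j and b are
   comparable with constants 1 - eps and 1 + eps. By Hopf-Rinow the balls of the
   limit are precompact, so its nearly shortest curves run in a fixed compact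
   set, while a curve of Om j either stays in such a set or has to cross its
   outer shell and is too long to compete. *)

(** The integral of the definitions is iterated over real coordinates, and its integrands are
    handled without measurability: the only size estimate used is monotonicity, which bounds the
    integral of a nonnegative function below by a constant on a box. The sub-mean value inequality
    is therefore proved at a point where [f] is almost maximal for a weight vanishing at the
    boundary of the ball; there the Cauchy estimate keeps the modulus of [f] above half its value on
    a box of fixed relative size. The Cauchy estimate itself rests on Goursat's bisection and on a
    mere lower bound for the sum of [1 / z] around [0]. Lipschitz and Taylor bounds and holomorphy
    of limits follow from it along complex lines. The kernels are differentiated as functions of two
    separate variables, holomorphic in one and antiholomorphic in the other, so that the estimate
    applies again to each derivative; restriction to the diagonal comes last. The third order is
    there because the metric contains second derivatives, and their common Lipschitz bound makes
    their convergence locally uniform. *)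

(** * The modulus of a complex number as an element of [R] *)

Section Modulus.
Variable R : realType.
Local Notation C := R[i].
Implicit Types (z w : C) (x : R).

(** The norm of [R[i]] takes its values in [R[i]] itself; estimates over [R] need a real-valued
    version. *)
Definition cmod z : R := normc z.
Arguments cmod : simpl never.

Lemma normcmod z : `|z| = (cmod z)%:C%C. Proof. by case: z. Qed.
Lemma cmod0 : cmod 0 = 0. Proof. exact: normc0. Qed.
Lemma cmod1 : cmod 1 = 1. Proof. exact: normc1. Qed.
Lemma cmodM z w : cmod (z * w) = cmod z * cmod w. Proof. exact: normcM. Qed.
Lemma cmodV z : cmod z^-1 = (cmod z)^-1. Proof. exact: normcV. Qed.
Lemma cmodN z : cmod (- z) = cmod z. Proof. exact: normcN. Qed.
Lemma cmodD z w : cmod (z + w) <= cmod z + cmod w. Proof. exact: le_normcD. Qed.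
Lemma cmod_ge0 z : 0 <= cmod z. Proof. by case: z => a b; exact: sqrtr_ge0. Qed.
Lemma cmod_eq0 z : (cmod z == 0) = (z == 0).
Proof. by apply/eqP/eqP => [/eq0_normc//|->]; exact: cmod0. Qed.
Lemma cmod_gt0 z : (0 < cmod z) = (z != 0).
Proof. by rewrite lt_def cmod_eq0 cmod_ge0 andbT. Qed.
Lemma cmodB z w : cmod (z - w) = cmod (w - z).
Proof. by rewrite -cmodN opprB. Qed.
Lemma cmodX z n : cmod (z ^+ n) = cmod z ^+ n.
Proof. by elim: n => [|n IH]; rewrite ?expr0 ?cmod1// !exprS cmodM IH. Qed.
Lemma cmod_real x : cmod x%:C%C = `|x|.
Proof. by rewrite /cmod /= expr0n addr0 sqrtr_sqr. Qed.
Lemma cmodi : cmod 'i%C = 1.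
Proof. by rewrite /cmod /= expr0n expr1n add0r sqrtr1. Qed.
Lemma cmodJ z : cmod z^*%C = cmod z.
Proof. by case: z => a b; rewrite /cmod /= sqrrN. Qed.
Lemma cmod_sqr z : cmod z ^+ 2 = complex.Re z ^+ 2 + complex.Im z ^+ 2.
Proof. by case: z => a b; rewrite /cmod /= sqr_sqrtr ?addr_ge0 ?sqr_ge0. Qed.
Lemma Re_le_cmod z : `|complex.Re z| <= cmod z.
Proof.
rewrite -(@ler_pXn2r _ 2) ?nnegrE ?normr_ge0 ?cmod_ge0// cmod_sqr.
by rewrite real_normK ?num_real// lerDl sqr_ge0.
Qed.
Lemma Im_le_cmod z : `|complex.Im z| <= cmod z.
Proof.
rewrite -(@ler_pXn2r _ 2) ?nnegrE ?normr_ge0 ?cmod_ge0// cmod_sqr.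
by rewrite real_normK ?num_real// lerDr sqr_ge0.
Qed.
Lemma cmod_le_ReIm z : cmod z <= `|complex.Re z| + `|complex.Im z|.
Proof.
rewrite -(@ler_pXn2r _ 2) ?nnegrE ?addr_ge0 ?normr_ge0 ?cmod_ge0// cmod_sqr.
rewrite sqrrD !real_normK ?num_real// addrAC lerDl mulrn_wge0//.
Qed.
Lemma cmodBD z w : cmod z <= cmod w + cmod (z - w).
Proof. by rewrite -{1}(subrK w z) addrC cmodD. Qed.
Lemma cmod_sum (I : Type) (r : seq I) (P : pred I) (F : I -> C) :
  cmod (\sum_(i <- r | P i) F i) <= \sum_(i <- r | P i) cmod (F i).
Proof.
elim/big_ind2 : _ => //; first by rewrite cmod0.
move=> x1 x2 y1 y2 h1 h2; exact: (le_trans (cmodD _ _) (lerD h1 h2)).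
Qed.
Lemma Re_mulJ z : complex.Re (z * z^*%C) = cmod z ^+ 2.
Proof. by case: z => a b; rewrite cmod_sqr /=; ring. Qed.
Lemma Im_mulJ z : complex.Im (z * z^*%C) = 0.
Proof. by case: z => a b /=; ring. Qed.
Lemma ReD z w : complex.Re (z + w) = complex.Re z + complex.Re w.
Proof. by case: z w => a b [c d]. Qed.
Lemma ImD z w : complex.Im (z + w) = complex.Im z + complex.Im w.
Proof. by case: z w => a b [c d]. Qed.
Lemma ReB z w : complex.Re (z - w) = complex.Re z - complex.Re w.
Proof. by case: z w => a b [c d]. Qed.
Lemma ImB z w : complex.Im (z - w) = complex.Im z - complex.Im w.
Proof. by case: z w => a b [c d]. Qed.
Lemma Re_Zr x z : complex.Re (x%:C%C * z) = x * complex.Re z.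
Proof. by case: z => a b /=; ring. Qed.
Lemma Im_Zr x z : complex.Im (x%:C%C * z) = x * complex.Im z.
Proof. by case: z => a b /=; ring. Qed.
Lemma conjcB z w : conjc (z - w) = conjc z - conjc w.
Proof. by rewrite rmorphB. Qed.
Lemma conjcM z w : conjc (z * w) = conjc z * conjc w.
Proof. by rewrite rmorphM. Qed.

End Modulus.
Arguments cmod : simpl never.

(** * Complex derivatives in one variable *)

Section DirDeriv.
Variable R : realType.
Local Notation C := R[i].
Implicit Types (f g : C -> C) (z l : C).

(** Free of division by [h]: error terms add up directly and [h = 0] is no special case. [cderP]
    gives the link to the library derivative and its calculus. *)
Definition cder f z l := forall e : R, 0 < e -> exists2 d : R, 0 < d &
  forall h, cmod h < d -> cmod (f (z + h) - f z - l * h) <= e * cmod h.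

Lemma cgt0_real (e : C) : 0 < e -> e = (complex.Re e)%:C%C /\ 0 < complex.Re e.
Proof. by case: e => a b; rewrite ltcE /= => /andP[/eqP -> ?]. Qed.

Lemma cderP f z l : cder f z l <-> is_derive (z : C) (1 : C) f l.
Proof.
have key h : h != 0 -> cmod (l - h^-1 *: (f (h *: (1:C) + z) - f z)) * cmod h =
   cmod (f (z + h) - f z - l * h).
  move=> h0; rewrite -cmodM -[RHS]cmodN; congr cmod.
  rewrite /GRing.scale /= mulr1 (addrC h z); by field.
split.
- move=> H.
  have K : (fun h : C => h^-1 *: (f (h *: (1:C) + z) - f z)) @ 0^' --> l.
    apply/cvgrPdist_le => e /cgt0_real[-> e0].
    have [d d0 Hd] := H _ e0.
    near=> h.
    have h0 : h != 0 by near: h; exact: nbhs_dnbhs_neq.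
    have hd : cmod h < d.
      by rewrite -ltcR -normcmod; near: h; apply: dnbhs0_lt; rewrite ltcR.
    rewrite normcmod lecR -(@ler_pM2r _ (cmod h)) ?cmod_gt0//.
    by rewrite key//; exact: Hd.
  split; last exact: cvg_lim K.
  by apply/cvg_ex; exists l.
- move=> [] /= D E e e0.
  have K : (fun h : C => h^-1 *: (f (h *: (1:C) + z) - f z)) @ 0^' --> l.
    by rewrite -E; exact: D.
  move/cvgrPdist_le : K => /(_ e%:C%C); rewrite ltcR => /(_ e0).
  rewrite /prop_near1 /dnbhs /within /= ?near_withinE.
  move=> /nbhs_normP[d /cgt0_real[-> d0] Hd].
  exists (complex.Re d) => // h hd.
  have [->|h0] := eqVneq h 0.
    by rewrite addr0 subrr sub0r mulr0 cmodN !cmod0 mulr0.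
  have := Hd h; rewrite /= sub0r normrN normcmod ltcR => /(_ hd h0).
  by rewrite normcmod lecR -(@ler_pM2r _ (cmod h)) ?cmod_gt0// key.
Unshelve. all: by end_near.
Qed.

End DirDeriv.

Section CderRules.
Variable R : realType.
Local Notation C := R[i].
Implicit Types (f g : C -> C) (z l k : C).
Lemma cder_cst c z : cder (fun=> c) z (0 : C).
Proof. by apply/cderP; exact: is_derive_cst. Qed.
Lemma cderD f g z l k : cder f z l -> cder g z k -> cder (fun w => f w + g w) z (l + k).
Proof. by move=> /cderP H1 /cderP H2; apply/cderP; exact: is_deriveD. Qed.
Lemma cderB f g z l k : cder f z l -> cder g z k -> cder (fun w => f w - g w) z (l - k).
Proof. by move=> /cderP H1 /cderP H2; apply/cderP; exact: is_deriveB. Qed.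
Lemma cderM f g z l k : cder f z l -> cder g z k ->
  cder (fun w => f w * g w) z (f z * k + g z * l).
Proof. by move=> /cderP H1 /cderP H2; apply/cderP; exact: is_deriveM. Qed.
Lemma cderV f z l : f z != 0 -> cder f z l ->
  cder (fun w => (f w)^-1) z (- (f z) ^- 2 * l).
Proof. move=> f0 /cderP[d <-]; apply/cderP; split; [exact: derivableV|exact: deriveV]. Qed.
End CderRules.

(** * Goursat's theorem for midpoint sums over squares *)

Section Goursat.
Variable R : realType.
Local Notation C := R[i].
Implicit Types (f g : C -> C) (z l a u p q : C) (x y s t : R).

(* Midpoint sums along dyadic subdivisions replace line integrals: they are
   exact on affine functions and additive, which is all Goursat's bisection
   argument uses. *)
Fixpoint avg f m p q : C :=
  if m is m'.+1 then (avg f m' p ((p + q) / 2) + avg f m' ((p + q) / 2) q) / 2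
  else f ((p + q) / 2).

Definition edge f m p q := (q - p) * avg f m p q.

(** Stands for the integral over the positively oriented boundary of the square with corner [a] and
    side vector [u]. *)
Definition bd f m a u := edge f m a (a + u) + edge f m (a + u) (a + u + 'i%C * u)
  + edge f m (a + u + 'i%C * u) (a + 'i%C * u) + edge f m (a + 'i%C * u) a.

Lemma avg_sym f m p q : avg f m q p = avg f m p q.
Proof.
elim: m p q => [|m IH] p q /=; first by rewrite addrC.
by rewrite (addrC q p) (IH ((p + q) / 2) q) (IH p) [avg _ _ _ _ + _]addrC.
Qed.

Lemma edge_sym f m p q : edge f m q p = - edge f m p q.
Proof. by rewrite /edge avg_sym -mulNr opprB. Qed.

Lemma edgeS f m p q :
  edge f m.+1 p q = edge f m p ((p + q) / 2) + edge f m ((p + q) / 2) q.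
Proof. by rewrite /edge /=; field. Qed.

(** Each inner edge is run twice in opposite directions and cancels by [edge_sym]; along the outer
    edges [edgeS] glues two half edges at the price of one level of [m]. *)
Lemma bdS f m a u : bd f m.+1 a u = bd f m a (u / 2) + bd f m (a + u / 2) (u / 2)
  + bd f m (a + u / 2 + 'i%C * (u / 2)) (u / 2) + bd f m (a + 'i%C * (u / 2)) (u / 2).
Proof.
rewrite /bd !edgeS.
have -> : (a + (a + u)) / 2 = a + u / 2 by field.
have -> : (a + u + (a + u + 'i%C * u)) / 2 = a + u + 'i%C * (u / 2) by field.
have -> : (a + u + 'i%C * u + (a + 'i%C * u)) / 2 = a + u / 2 + 'i%C * u by field.
have -> : (a + 'i%C * u + a) / 2 = a + 'i%C * (u / 2) by field.
have -> : a + 'i%C * (u / 2) + u / 2 = a + u / 2 + 'i%C * (u / 2) by field.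
have -> : a + u / 2 + u / 2 = a + u by field.
have -> : a + u / 2 + 'i%C * (u / 2) + u / 2 = a + u + 'i%C * (u / 2) by field.
have -> : a + u / 2 + 'i%C * (u / 2) + 'i%C * (u / 2) = a + u / 2 + 'i%C * u by field.
have -> : a + u + 'i%C * (u / 2) + 'i%C * (u / 2) = a + u + 'i%C * u by field.
have -> : a + 'i%C * (u / 2) + 'i%C * (u / 2) = a + 'i%C * u by field.
rewrite (edge_sym f m (a + u / 2) (a + u / 2 + 'i%C * (u / 2))).
rewrite (edge_sym f m (a + u / 2 + 'i%C * (u / 2)) (a + u + 'i%C * (u / 2))).
rewrite (edge_sym f m (a + 'i%C * (u / 2)) (a + u / 2 + 'i%C * (u / 2))).
rewrite (edge_sym f m (a + u / 2 + 'i%C * (u / 2)) (a + u / 2 + 'i%C * u)).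
by ring.
Qed.

(** An average by midpoints stays in every midpoint-convex set that contains the values on the
    segment. The same induction yields equalities, upper bounds on the modulus and lower bounds on
    an imaginary part. *)
Lemma avg_ind (P : C -> Prop) f m p q :
  (forall z w, P z -> P w -> P ((z + w) / 2)) ->
  (forall t, 0 <= t <= 1 -> P (f (p + t%:C%C * (q - p)))) -> P (avg f m p q).
Proof.
move=> Pmid; elim: m p q => [|m IH] p q H /=.
  have -> : (p + q) / 2 = p + (2^-1)%:C%C * (q - p) by rewrite fmorphV rmorph_nat; field.
  by apply: H; lra.
apply: Pmid; apply: IH => t t01.
- have -> : p + t%:C%C * ((p + q) / 2 - p) = p + (t / 2)%:C%C * (q - p).
    by rewrite rmorphM fmorphV rmorph_nat; field.
  by apply: H; lra.
- have -> : (p + q) / 2 + t%:C%C * (q - (p + q) / 2) = p + ((t + 1) / 2)%:C%C * (q - p).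
    by rewrite rmorphM rmorphD rmorph1 fmorphV rmorph_nat; field.
  by apply: H; lra.
Qed.

Lemma eq_avg f g m p q : (forall t, 0 <= t <= 1 ->
    f (p + t%:C%C * (q - p)) = g (p + t%:C%C * (q - p))) -> avg f m p q = avg g m p q.
Proof.
move=> H.
have : avg (fun z => f z - g z) m p q = 0.
  apply: (@avg_ind (fun z => z = 0)) => [z w -> ->|t t01]; first by rewrite addr0 mul0r.
  by rewrite H// subrr.
suff -> : avg (fun z => f z - g z) m p q = avg f m p q - avg g m p q.
  by move/eqP; rewrite subr_eq0 => /eqP.
by elim: m p q {H} => [|m IH] p q //=; rewrite !IH; field.
Qed.

Lemma avgB f g m p q : avg (fun z => f z - g z) m p q = avg f m p q - avg g m p q.
Proof. by elim: m p q => [|m IH] p q //=; rewrite !IH; field. Qed.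

Lemma avgZ l f m p q : avg (fun z => l * f z) m p q = l * avg f m p q.
Proof. by elim: m p q => [|m IH] p q //=; rewrite !IH; field. Qed.

Lemma avg_affine z l m p q : avg (fun w => z + l * w) m p q = z + l * ((p + q) / 2).
Proof. by elim: m p q => [|m IH] p q //=; rewrite !IH; field. Qed.

Lemma avg_comp f a u m p q :
  avg (fun z => f (a + u * z)) m p q = avg f m (a + u * p) (a + u * q).
Proof.
elim: m p q => [|m IH] p q /=.
  by congr f; field.
by rewrite !IH; congr ((avg _ _ _ _ + avg _ _ _ _) / 2); field.
Qed.

Lemma cmod_avg f m p q (b : R) :
  (forall t, 0 <= t <= 1 -> cmod (f (p + t%:C%C * (q - p))) <= b) ->
  cmod (avg f m p q) <= b.
Proof.
move=> H; apply: (@avg_ind (fun z => cmod z <= b)) => // z w zb wb.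
rewrite cmodM cmodV -(rmorph_nat (real_complex R)) cmod_real ger0_norm//.
by rewrite ler_pdivrMr// mulr_natr mulr2n (le_trans (cmodD _ _))// lerD.
Qed.

Lemma bdB f g m a u : bd (fun z => f z - g z) m a u = bd f m a u - bd g m a u.
Proof. by rewrite /bd /edge !avgB; ring. Qed.

Lemma bdZ l f m a u : bd (fun z => l * f z) m a u = l * bd f m a u.
Proof. by rewrite /bd /edge !avgZ; ring. Qed.

Lemma bd_affine z l m a u : bd (fun w => z + l * w) m a u = 0.
Proof. by rewrite /bd /edge !avg_affine; field. Qed.

Lemma bd_comp f a u m z w :
  u * bd (fun z => f (a + u * z)) m z w = bd f m (a + u * z) (u * w).
Proof.
rewrite /bd /edge !avg_comp.
have -> : a + u * (z + w) = a + u * z + u * w by ring.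
have -> : a + u * (z + w + 'i%C * w) = a + u * z + u * w + 'i%C * (u * w) by ring.
have -> : a + u * (z + 'i%C * w) = a + u * z + 'i%C * (u * w) by ring.
ring.
Qed.

Definition sqpt a u x y : C := a + u * (x +i* y)%C.

Lemma complex_rect x y : (x +i* y)%C = x%:C%C + 'i%C * y%:C%C.
Proof. by rewrite [LHS]complexE. Qed.

Lemma cmodD4 (z1 z2 z3 z4 : C) (b1 b2 b3 b4 : R) : cmod z1 <= b1 -> cmod z2 <= b2 ->
  cmod z3 <= b3 -> cmod z4 <= b4 -> cmod (z1 + z2 + z3 + z4) <= b1 + b2 + b3 + b4.
Proof.
move=> h1 h2 h3 h4; have := cmodD (z1 + z2 + z3) z4; have := cmodD (z1 + z2) z3.
have := cmodD z1 z2; lra.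
Qed.

Lemma cmod_bd f m a u (b : R) :
  (forall x y, 0 <= x <= 1 -> 0 <= y <= 1 -> cmod (f (sqpt a u x y)) <= b) ->
  cmod (bd f m a u) <= 4 * (cmod u * b).
Proof.
move=> H.
have e1 p q : cmod (q - p) = cmod u -> (forall t, 0 <= t <= 1 ->
    cmod (f (p + t%:C%C * (q - p))) <= b) -> cmod (edge f m p q) <= cmod u * b.
  by move=> E K; rewrite cmodM E ler_wpM2l ?cmod_ge0//; exact: cmod_avg.
have -> : 4 * (cmod u * b) = cmod u * b + cmod u * b + cmod u * b + cmod u * b by ring.
have i2 := sqr_i R.
apply: cmodD4; apply: e1.
- by congr cmod; ring.
- move=> t t01; suff -> : a + t%:C%C * (a + u - a) = sqpt a u t 0 by apply: H => //; lra.
  by rewrite /sqpt complex_rect rmorph0; ring.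
- by rewrite addrAC subrr add0r cmodM cmodi mul1r.
- move=> t t01; suff -> : a + u + t%:C%C * (a + u + 'i%C * u - (a + u)) = sqpt a u 1 t.
    by apply: H => //; lra.
  by rewrite /sqpt complex_rect rmorph1; ring.
- by rewrite cmodB; congr cmod; ring.
- move=> t t01.
  suff -> : a + u + 'i%C * u + t%:C%C * (a + 'i%C * u - (a + u + 'i%C * u)) = sqpt a u (1 - t) 1.
    by apply: H => //; lra.
  by rewrite /sqpt complex_rect rmorphB rmorph1; ring.
- by rewrite cmodB addrAC subrr add0r cmodM cmodi mul1r.
- move=> t t01; suff -> : a + 'i%C * u + t%:C%C * (a - (a + 'i%C * u)) = sqpt a u 0 (1 - t).
    by apply: H => //; lra.
  by rewrite /sqpt complex_rect rmorphB rmorph1 rmorph0; ring.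
Qed.

Lemma nested_intervals (X s : nat -> R) :
  (forall k, X k <= X k.+1) -> (forall k, X k.+1 + s k.+1 <= X k + s k) ->
  (forall k, 0 <= s k) -> exists x, forall k, X k <= x <= X k + s k.
Proof.
move=> Xm Sm s0.
have mX k j : X k <= X (k + j)%N.
  by elim: j => [|j IH]; rewrite ?addn0// addnS (le_trans IH).
have mS k j : X (k + j)%N + s (k + j)%N <= X k + s k.
  by elim: j => [|j IH]; rewrite ?addn0// addnS (le_trans _ IH).
have XS k j : X k <= X j + s j.
  have /orP[/subnKC <-|/subnKC <-] := leq_total k j.
    by rewrite (le_trans (mX k (j - k)%N))// lerDl.
  by rewrite (le_trans _ (mS j (k - j)%N))// lerDl.
have ne : (range X) !=set0 by exists (X 0%N), 0%N.
exists (sup (range X)) => k; apply/andP; split.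
  apply: ub_le_sup; last by exists k.
  by exists (X 0%N + s 0%N) => _ [j _ <-].
by apply: ge_sup => // _ [j _ <-].
Qed.

Lemma exists_pow2_lt (e : R) : 0 < e -> exists k, (2^-1) ^+ k < e.
Proof.
move=> e0; have [k Hk] : exists k, e^-1 < k%:R.
  exists (Num.bound e^-1); apply: archi_boundP; rewrite invr_ge0; exact: ltW.
exists k; rewrite exprVn -[e]invrK ltf_pV2 ?posrE ?invr_gt0 ?exprn_gt0//.
apply: (lt_trans Hk); rewrite -natrX ltr_nat; exact: ltn_expl.
Qed.

Section Bisection.
Variables (f : C -> C) (e : R).
Hypothesis e0 : 0 < e.

(** Goursat's bound, [e] times the area, is required only for large [m]: each bisection consumes one
    level, so no fixed [m] would survive all of them. *)
Let ok (k : nat) (c : R * R) := exists N, forall m, (N <= m)%N ->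
  cmod (bd f m (c.1 +i* c.2)%C ((2^-1) ^+ k)%:C%C) <= e * ((2^-1) ^+ k) ^+ 2.

(** The areas of the four quarters add up to that of the square, so the bound on all quarters would
    give the bound on the whole. *)
Lemma bisect_step k c : ~ ok k c -> exists b1 b2 : bool,
  ~ ok k.+1 (c.1 + (2^-1) ^+ k.+1 * b1%:R, c.2 + (2^-1) ^+ k.+1 * b2%:R).
Proof.
move=> nok; apply: contrapT => H; apply: nok.
have K (b1 b2 : bool) : ok k.+1 (c.1 + (2^-1) ^+ k.+1 * b1%:R, c.2 + (2^-1) ^+ k.+1 * b2%:R).
  by apply: contrapT => nk; apply: H; exists b1, b2.
have [N1 H1] := K false false; have [N2 H2] := K true false.
have [N3 H3] := K true true; have [N4 H4] := K false true.
(* The successor pays for the level that [bdS] consumes. *)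
exists (maxn (maxn N1 N2) (maxn N3 N4)).+1 => -[//|m].
rewrite ltnS !geq_max => /andP[/andP[h1 h2] /andP[h3 h4]].
rewrite bdS.
set s : R := (2^-1) ^+ k; set a := (c.1 +i* c.2)%C.
have sE : (2^-1) ^+ k.+1 = s / 2 :> R by rewrite exprSr.
have hE : s%:C%C / 2 = ((2^-1) ^+ k.+1)%:C%C :> C by rewrite sE rmorphM fmorphV rmorph_nat.
set t := (2^-1) ^+ k.+1 in sE hE *; rewrite hE.
have -> : e * s ^+ 2 = e * t ^+ 2 + e * t ^+ 2 + e * t ^+ 2 + e * t ^+ 2.
  by rewrite sE; field.
pose P (b1 b2 : bool) : C := ((c.1 + t * b1%:R) +i* (c.2 + t * b2%:R))%C.
have PE b1 b2 : P b1 b2 = a + t%:C%C * (b1%:R : R)%:C%C + 'i%C * t%:C%C * (b2%:R : R)%:C%C.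
  by rewrite /P /a (complex_rect c.1) (complex_rect (_ + _)) !rmorphD !rmorphM; ring.
have Q b1 b2 N w (HN : forall m, (N <= m)%N -> cmod (bd f m (P b1 b2) t%:C%C) <= e * t ^+ 2) :
    P b1 b2 = w -> (N <= m)%N -> cmod (bd f m w t%:C%C) <= e * t ^+ 2.
  by move=> <- /HN.
apply: cmodD4.
- by apply: (Q _ _ _ _ H1 _ h1); rewrite PE rmorph0; ring.
- by apply: (Q _ _ _ _ H2 _ h2); rewrite PE rmorph0 rmorph1; ring.
- by apply: (Q _ _ _ _ H3 _ h3); rewrite PE rmorph1; ring.
- by apply: (Q _ _ _ _ H4 _ h4); rewrite PE rmorph0 rmorph1; ring.
Qed.

(** Bad squares nest down to a point [z]. Near [z] the function is affine up to a small multiple of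
    the distance, and affine functions have boundary sum exactly [0], so a small enough square is
    not bad. *)
Lemma goursat_unit :
  (forall x y, 0 <= x <= 1 -> 0 <= y <= 1 -> exists l, cder f (x +i* y)%C l) ->
  ok 0 (0, 0).
Proof.
move=> hol; apply: contrapT => nok.
pose st k (c : R * R) (b : bool * bool) :=
  (c.1 + (2^-1) ^+ k.+1 * b.1%:R, c.2 + (2^-1) ^+ k.+1 * b.2%:R).
have /choice[F HF] : forall kc : nat * (R * R), exists b : bool * bool,
    ~ ok kc.1 kc.2 -> ~ ok kc.1.+1 (st kc.1 kc.2 b).
  move=> [k c]; have [h|h] := pselect (ok k c); first by exists (true, true).
  by have [b1 [b2 hb]] := bisect_step h; exists (b1, b2).
pose S := fix S k := if k is k'.+1 then st k' (S k') (F (k', S k')) else (0, 0).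
have Sok k : ~ ok k (S k).
  by elim: k => [//|k IH]; exact: (HF (k, S k)).
pose s k : R := (2^-1) ^+ k.
have s0 k : 0 <= s k by rewrite exprn_ge0// invr_ge0.
have sS k : s k = 2 * s k.+1 by rewrite /s exprS; field.
have b01 (b : bool) : 0 <= (b%:R : R) /\ (b%:R : R) <= 1.
  by case: b; rewrite ?ler01 ?lexx.
have [x Hx] : exists x, forall k, (S k).1 <= x <= (S k).1 + s k.
  apply: nested_intervals => // k /=; rewrite -/(s k.+1).
    by rewrite lerDl mulr_ge0//; have := b01 (F (k, S k)).1; lra.
  rewrite [s k]sS; have := b01 (F (k, S k)).1; have := s0 k.+1; nra.
have [y Hy] : exists y, forall k, (S k).2 <= y <= (S k).2 + s k.
  apply: nested_intervals => // k /=; rewrite -/(s k.+1).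
    by rewrite lerDl mulr_ge0//; have := b01 (F (k, S k)).2; lra.
  rewrite [s k]sS; have := b01 (F (k, S k)).2; have := s0 k.+1; nra.
have [l Hl] : exists l, cder f (x +i* y)%C l.
  by apply: hol; [move: (Hx 0%N)|move: (Hy 0%N)]; rewrite /s /= expr0 add0r.
(* The factor 8 is made of four edges and the bound [2 * s k] on the distance from [z] within the
   square. *)
have [d d0 Hd] := Hl (e / 8) (divr_gt0 e0 (ltr0n _ 8)).
have [k Hk] := exists_pow2_lt (divr_gt0 d0 (ltr0n _ 2)).
apply: (Sok k); exists 0%N => m _.
set a := (_ +i* _)%C; set u := (_%:C)%C; set z := (x +i* y)%C in Hl Hd.
have -> : bd f m a u = bd (fun w => f w - ((f z - l * z) + l * w)) m a u.
  by rewrite bdB bd_affine subr0.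
have cu : cmod u = s k by rewrite cmod_real ger0_norm// s0.
have -> : e * ((2^-1) ^+ k) ^+ 2 = 4 * (cmod u * (e / 4 * s k)).
  by rewrite cu /s; field.
apply: cmod_bd => x' y' x01 y01.
set w := sqpt _ _ _ _.
have wz : cmod (w - z) <= 2 * s k.
  apply: (le_trans (cmod_le_ReIm _)).
  rewrite /w /sqpt /z ReB ImB ReD ImD Re_Zr Im_Zr /= -/(s k).
  have := Hx k; have := Hy k; have := s0 k.
  move=> ? ? ?; have -> : 2 * s k = s k + s k by ring.
  by apply: lerD; rewrite ler_norml; nra.
have := Hd (w - z); rewrite [z + _]addrC subrK.
have -> : f w - f z - l * (w - z) = f w - (f z - l * z + l * w) by ring.
move=> /(_ (le_lt_trans wz _)) => H; apply: (le_trans (H _)).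
  by rewrite /s; lra.
have -> : e / 4 * s k = e / 8 * (2 * s k) by field.
by rewrite ler_wpM2l// divr_ge0// ltW.
Qed.

End Bisection.

(** The unit square carries over by [bd_comp]; dividing [e] by [cmod u + 1] also covers the
    degenerate square [u = 0]. *)
Lemma goursat f a u : (forall x y, 0 <= x <= 1 -> 0 <= y <= 1 ->
    exists l, cder f (sqpt a u x y) l) ->
  forall e : R, 0 < e -> exists N, forall m, (N <= m)%N -> cmod (bd f m a u) <= e.
Proof.
move=> hol e e0.
have e' : 0 < e / (cmod u + 1) by rewrite divr_gt0// ltr_wpDl ?cmod_ge0.
have [|N HN] := @goursat_unit (fun z => f (a + u * z)) _ e'.
  move=> x y x01 y01; have [l Hl] := hol x y x01 y01.
  have [u0|u0] := eqVneq u 0.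
    exists 0 => e1 e10; exists 1 => // h _.
    by rewrite u0 !mul0r subrr subr0 cmod0 mulr_ge0 ?cmod_ge0// ltW.
  exists (l * u) => e1 e10.
  have cu0 : 0 < cmod u by rewrite cmod_gt0.
  have [d d0 Hd] := Hl (e1 / cmod u) (divr_gt0 e10 cu0).
  exists (d / cmod u); first exact: divr_gt0.
  move=> h; rewrite ltr_pdivlMr// mulrC -cmodM => /Hd.
  have -> : sqpt a u x y + u * h = a + u * ((x +i* y)%C + h) by rewrite /sqpt; ring.
  have -> : l * (u * h) = l * u * h by ring.
  move=> H; apply: (le_trans H); rewrite cmodM.
  by rewrite le_eqVlt; apply/orP; left; apply/eqP; field; rewrite gt_eqF.
exists N => m /HN; rewrite /= expr0 expr1n mulr1 => H.
have := bd_comp f a u m 0 1; rewrite mulr0 addr0 mulr1 => <-.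
rewrite cmodM; move: H; rewrite ler_pdivlMr ?ltr_wpDl ?cmod_ge0// => H.
apply: le_trans H; rewrite mulrC ler_wpM2l ?cmod_ge0//.
by lra.
Qed.

End Goursat.

(** * The Cauchy estimate for the first derivative *)

Section CauchyEstimate.
Variable R : realType.
Local Notation C := R[i].
Implicit Types (f g : C -> C) (z l a u p q : C) (x y s t r : R).

(** The boundary sum of the square with centre [0] and half-side [r], cut into its four quadrants.
    Their common edges cancel in [cen_outer], which leaves for each quadrant the two edges away from
    [0]. *)
Definition cen f m r : C := bd f m 0 r%:C%C + bd f m 0 ('i%C * r%:C%C)
  + bd f m 0 (- r%:C%C) + bd f m 0 (- ('i%C * r%:C%C)).

Definition outer f m u : C :=
  edge f m u (u + 'i%C * u) + edge f m (u + 'i%C * u) ('i%C * u).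

Lemma mulii z : 'i%C * ('i%C * z) = - z.
Proof. by rewrite mulrA -expr2 sqr_i mulN1r. Qed.

Lemma cen_outer f m r : cen f m r = outer f m r%:C%C + outer f m ('i%C * r%:C%C)
  + outer f m (- r%:C%C) + outer f m (- ('i%C * r%:C%C)).
Proof.
rewrite /cen /bd /outer !add0r !mulrN !mulii !opprK.
rewrite (edge_sym f m 0 ('i%C * r%:C%C)) (edge_sym f m 0 (- r%:C%C)).
rewrite (edge_sym f m 0 (- ('i%C * r%:C%C))) (edge_sym f m 0 r%:C%C).
by ring.
Qed.

Lemma one_it_bounds t : 0 <= t <= 1 -> 1 <= cmod (1 +i* t)%C <= 2.
Proof.
move=> t01; rewrite (le_trans _ (Re_le_cmod _)) /= ?normr1//.
by rewrite (le_trans (cmod_le_ReIm _)) //= normr1 ger0_norm; lra.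
Qed.

Lemma cmod_outer f m u b :
  (forall z, cmod u <= cmod z <= 2 * cmod u -> cmod (f z) <= b) ->
  cmod (outer f m u) <= 2 * (cmod u * b).
Proof.
move=> H.
have cu := cmod_ge0 u.
have bnd t : 0 <= t <= 1 -> cmod u <= cmod (u * (1 +i* t)%C) <= 2 * cmod u.
  by move=> /one_it_bounds; rewrite cmodM; nra.
have -> : 2 * (cmod u * b) = cmod u * b + cmod u * b by ring.
apply: (le_trans (cmodD _ _)); apply: lerD; rewrite /edge cmodM.
- have -> : u + 'i%C * u - u = 'i%C * u by ring.
  rewrite cmodM cmodi mul1r ler_wpM2l//; apply: cmod_avg => t t01; apply: H.
  have -> : u + t%:C%C * (u + 'i%C * u - u) = u * (1 +i* t)%C.
    by rewrite (complex_rect 1) rmorph1; ring.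
  exact: bnd.
- have -> : 'i%C * u - (u + 'i%C * u) = - u by ring.
  rewrite cmodN ler_wpM2l//; apply: cmod_avg => t t01; apply: H.
  have -> : u + 'i%C * u + t%:C%C * ('i%C * u - (u + 'i%C * u)) = 'i%C * (u * (1 +i* - (1 - t))%C).
    rewrite (complex_rect 1) rmorph1 rmorphN rmorphB rmorph1.
    have -> : 'i%C * (u * (1 + 'i%C * - (1 - t%:C%C))) =
      'i%C * u + - ('i%C * ('i%C * (u * (1 - t%:C%C)))) by ring.
    by rewrite mulii; ring.
  rewrite cmodM cmodi mul1r cmodM -[cmod (1 +i* _)%C]cmodJ /= opprK -cmodM.
  by apply: bnd; lra.
Qed.

Lemma cmod_cen f m r b : 0 <= r ->
  (forall z, r <= cmod z <= 2 * r -> cmod (f z) <= b) -> cmod (cen f m r) <= 8 * (r * b).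
Proof.
move=> r0 H; rewrite cen_outer.
have -> : 8 * (r * b) = 2 * (r * b) + 2 * (r * b) + 2 * (r * b) + 2 * (r * b) by ring.
have O u : cmod u = r -> cmod (outer f m u) <= 2 * (r * b).
  by move=> E; rewrite -E; apply: cmod_outer; rewrite E.
have cr : cmod (r%:C%C : C) = r by rewrite cmod_real ger0_norm.
by apply: cmodD4; apply: O; rewrite ?cmodN ?cmodM ?cmodi ?mul1r cr.
Qed.

(** The form dz / z is invariant under rotation and scaling, and so are its midpoint sums. All
    quadrants and all radii thus contribute the same amount. *)
Lemma outer_inv m u : u != 0 -> outer GRing.inv m u = outer GRing.inv m 1.
Proof.
move=> u0.
have E p q : edge GRing.inv m (u * p) (u * q) = edge GRing.inv m p q.
  rewrite /edge.
  have -> : avg GRing.inv m (u * p) (u * q) = u^-1 * avg GRing.inv m p q.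
    rewrite -avgZ -[u * p]add0r -[u * q]add0r -avg_comp.
    by apply: eq_avg => t _; rewrite add0r invfM.
  by field.
rewrite /outer -(E 1) -(E _ ('i%C * 1)) !mulr1.
by congr (edge _ _ _ _ + edge _ _ _ _); ring.
Qed.

Lemma inv_rect x y :
  ((x +i* y)%C)^-1 = (x / (x ^+ 2 + y ^+ 2) -i* (y / (x ^+ 2 + y ^+ 2)))%C.
Proof. by []. Qed.

(** A substitute for the exact value [pi / 2] of the integral over a quadrant: each of its two edges
    gives at least [1 / 2], since [1 / (1 + t ^+ 2)] does on the unit interval. *)
Lemma Im_outer_inv m : 1 <= complex.Im (outer GRing.inv m 1).
Proof.
have mid v (z w : C) : 2^-1 <= complex.Im (v * z) -> 2^-1 <= complex.Im (v * w) ->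
    2^-1 <= complex.Im (v * ((z + w) / 2)).
  have -> : v * ((z + w) / 2) = (2^-1)%:C%C * (v * z + v * w).
    by rewrite fmorphV rmorph_nat; field.
  by rewrite Im_Zr ImD; lra.
have sq t : 0 <= t <= 1 -> 2^-1 <= (1 + t ^+ 2)^-1.
  by move=> t01; rewrite lef_pV2 ?posrE; nra.
have -> : (1 : R) = 2^-1 + 2^-1 by field.
rewrite /outer ImD !mulr1; apply: lerD; rewrite /edge.
- apply: (@avg_ind _ (fun z => 2^-1 <= complex.Im ((1 + 'i%C - 1) * z))) => [|t t01]; first exact: mid.
  have -> : 1 + t%:C%C * (1 + 'i%C - 1) = (1 +i* t)%C by rewrite (complex_rect 1) rmorph1; ring.
  have -> : 1 + 'i%C - 1 = 'i%C :> C by ring.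
  rewrite inv_rect /= expr1n; have := sq t t01; lra.
- apply: (@avg_ind _ (fun z => 2^-1 <= complex.Im (('i%C - (1 + 'i%C)) * z))) => [|t t01]; first exact: mid.
  have -> : 1 + 'i%C + t%:C%C * ('i%C - (1 + 'i%C)) = ((1 - t) +i* 1)%C.
    by rewrite (complex_rect (1 - t)) rmorph1 rmorphB rmorph1; ring.
  have -> : 'i%C - (1 + 'i%C) = - 1 :> C by ring.
  rewrite mulN1r inv_rect /= expr1n; have t1 : 0 <= 1 - t <= 1 by lra.
  by have := sq _ t1; rewrite (addrC 1 ((1 - t) ^+ 2)); lra.
Qed.

Lemma cmod_cen_inv m r : 0 < r -> 4 <= cmod (cen GRing.inv m r).
Proof.
move=> r0; have rn0 : r%:C%C != 0 :> C by rewrite -cmod_eq0 cmod_real normr_eq0 gt_eqF.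
have in0 : 'i%C * r%:C%C != 0 by rewrite -cmod_eq0 cmodM cmodi mul1r cmod_eq0.
rewrite cen_outer !outer_inv ?oppr_eq0//.
apply: le_trans (Im_le_cmod _); apply: le_trans (ler_norm _).
by have := Im_outer_inv m; move: (outer _ m 1) => o; rewrite !ImD; lra.
Qed.

Section Shrink.
Variables (f : C -> C) (r0 : R).
Hypothesis hol : forall z, z != 0 -> cmod z <= 2 * r0 -> exists l, cder f z l.

(** Of the four half-size squares in a quadrant only one touches the singularity [0]; Goursat makes
    the sums over the other three small. *)
Lemma quadrant_shrink u : u != 0 -> cmod u <= r0 -> forall e : R, 0 < e ->
  exists N, forall m, (N <= m)%N -> cmod (bd f m.+1 0 u - bd f m 0 (u / 2)) <= e.
Proof.
move=> un0 ur e e0.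
(* Here [c] is the point measured in units of [u / 2]: the lower bound keeps it off [0], the upper
   one within [2 * r0]. *)
have G a : (forall x y, 0 <= x <= 1 -> 0 <= y <= 1 -> exists c : C,
      a + (u / 2) * (x +i* y)%C = u / 2 * c /\
      1 <= `|complex.Re c| + `|complex.Im c| /\ cmod c <= 4) ->
    exists N, forall m, (N <= m)%N -> cmod (bd f m a (u / 2)) <= e / 3.
  move=> H; apply: goursat; last lra.
  move=> x y x01 y01; have [c [E [c1 c4]]] := H x y x01 y01; rewrite /sqpt E.
  have cn0 : c != 0.
    by apply/eqP => c0; move: c1; rewrite c0 /= normr0; lra.
  apply: hol; first by rewrite !mulf_neq0 ?invr_eq0// pnatr_eq0.
  rewrite !cmodM cmodV -(rmorph_nat (real_complex R)) cmod_real ger0_norm//.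
  have := cmod_ge0 u; have := cmod_ge0 c; nra.
have cb (c : C) : 0 <= complex.Re c <= 2 -> 0 <= complex.Im c <= 2 ->
    cmod c <= 4.
  move=> h1 h2; apply: le_trans (cmod_le_ReIm _) _.
  by rewrite !ger0_norm; lra.
have i2 := sqr_i R.
have [|N1 H1] := G (u / 2).
  move=> x y x01 y01; exists ((1 + x) +i* y)%C; split.
    by rewrite (complex_rect x) (complex_rect (1 + x)) rmorphD rmorph1; ring.
  by split => /=; [rewrite !ger0_norm; lra|apply: cb => /=; lra].
have [|N2 H2] := G (u / 2 + 'i%C * (u / 2)).
  move=> x y x01 y01; exists ((1 + x) +i* (1 + y))%C; split.
    by rewrite (complex_rect x) (complex_rect (1 + x)) !rmorphD !rmorph1; ring.
  by split => /=; [rewrite !ger0_norm; lra|apply: cb => /=; lra].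
have [|N3 H3] := G ('i%C * (u / 2)).
  move=> x y x01 y01; exists (x +i* (1 + y))%C; split.
    by rewrite !(complex_rect x) !rmorphD !rmorph1; ring.
  by split => /=; [rewrite !ger0_norm; lra|apply: cb => /=; lra].
exists (maxn N1 (maxn N2 N3)) => m; rewrite !geq_max => /and3P[h1 h2 h3].
rewrite bdS !add0r.
set b0 := bd f m 0 _; set b1 := bd f m _ _; set b2 := bd f m _ _; set b3 := bd f m _ _.
have -> : b0 + b1 + b2 + b3 - b0 = b1 + b2 + b3 + 0 by ring.
have -> : e = e / 3 + e / 3 + e / 3 + 0 by field.
by apply: cmodD4; [exact: H1|exact: H2|exact: H3|rewrite cmod0].
Qed.

Lemma cen_shrink r : 0 < r <= r0 -> forall e : R, 0 < e ->
  exists N, forall m, (N <= m)%N -> cmod (cen f m.+1 r - cen f m (r / 2)) <= e.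
Proof.
move=> /andP[rp rr] e e0.
have rn0 : r%:C%C != 0 :> C by rewrite -cmod_eq0 cmod_real normr_eq0 gt_eqF.
have cr : cmod (r%:C%C : C) = r by rewrite cmod_real gtr0_norm.
have in0 : 'i%C * r%:C%C != 0 by rewrite -cmod_eq0 cmodM cmodi mul1r cmod_eq0.
have e4 : 0 < e / 4 by lra.
have [|N1 H1] := quadrant_shrink rn0 _ e4; first by rewrite cr.
have [|N2 H2] := quadrant_shrink in0 _ e4; first by rewrite cmodM cmodi mul1r cr.
have [||N3 H3] := @quadrant_shrink (- r%:C%C) _ _ _ e4; rewrite ?oppr_eq0 ?cmodN ?cr//.
have [||N4 H4] := @quadrant_shrink (- ('i%C * r%:C%C)) _ _ _ e4;
  rewrite ?oppr_eq0 ?cmodN ?cmodM ?cmodi ?mul1r ?cr//.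
exists (maxn (maxn N1 N2) (maxn N3 N4)) => m; rewrite !geq_max => /andP[/andP[h1 h2] /andP[h3 h4]].
rewrite /cen.
have -> : (r / 2)%:C%C = r%:C%C / 2 by rewrite rmorphM fmorphV rmorph_nat.
rewrite mulrA -(mulNr r%:C%C) -(mulNr ('i%C * r%:C%C)).
have -> : e = e / 4 + e / 4 + e / 4 + e / 4 by field.
move: (H1 _ h1) (H2 _ h2) (H3 _ h3) (H4 _ h4).
set b1 := bd f m.+1 0 _; set b2 := bd f m.+1 0 _; set b3 := bd f m.+1 0 _.
set b4 := bd f m.+1 0 _ => k1 k2 k3 k4.
set c1 := bd f m 0 _; set c2 := bd f m 0 _; set c3 := bd f m 0 _; set c4 := bd f m 0 _.
have -> : b1 + b2 + b3 + b4 - (c1 + c2 + c3 + c4) =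
  (b1 - c1) + (b2 - c2) + (b3 - c3) + (b4 - c4) by ring.
exact: cmodD4.
Qed.

Lemma cen_shrinkn r k : 0 < r <= r0 -> forall e : R, 0 < e ->
  exists N, forall m, (N <= m)%N -> cmod (cen f (m + k) r - cen f m (r * 2^-1 ^+ k)) <= e.
Proof.
move=> rr; elim: k => [|k IH] e e0.
  by exists 0%N => m _; rewrite addn0 expr0 mulr1 subrr cmod0 ltW.
have e2 : 0 < e / 2 by lra.
have [N1 H1] := IH _ e2.
have h0 : 0 < (2^-1 : R) ^+ k by rewrite exprn_gt0.
have h1 : (2^-1 : R) ^+ k <= 1 by rewrite exprn_ile1//; lra.
have [|N2 H2] := @cen_shrink (r * 2^-1 ^+ k) _ _ e2; first by nra.
exists (maxn N1 N2) => m; rewrite geq_max => /andP[k1 k2].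
rewrite addnS -addSn exprSr mulrA.
have := H1 m.+1 (leq_trans k1 (leqnSn _)); have := H2 _ k2.
set A := cen f m.+1 _; set B := cen f m _; set D := cen f _ r => a1 a2.
have -> : D - B = (D - A) + (A - B) by ring.
by apply: le_trans (cmodD _ _) _; lra.
Qed.

(** A removable singularity: shrinking the square does not change the sum in the limit, and on a
    square of half-side [s] the sum is at most [8 * s] times a bound that is [o(1 / s)]. *)
Lemma cen_to0 r : 0 < r <= r0 ->
  (forall e : R, 0 < e -> exists2 d : R, 0 < d &
     forall z, z != 0 -> cmod z < d -> cmod (f z) * cmod z <= e) ->
  forall e : R, 0 < e -> exists m, cmod (cen f m r) <= e.
Proof.
move=> /andP[rp rr] H e e0.
have [d d0 Hd] := H (e / 16) ltac:(lra).
have [k Hk] := @exists_pow2_lt R (d / (2 * r)) ltac:(by rewrite divr_gt0//; lra).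
have [N HN] := @cen_shrinkn r k ltac:(by rewrite rp) (e / 2) ltac:(lra).
exists (N + k)%N.
have := HN N (leqnn _); set s := r * _ => h1.
have s0 : 0 < s by rewrite mulr_gt0// exprn_gt0.
have : cmod (cen f N s) <= e / 2.
  have -> : e / 2 = 8 * (s * (e / 16 / s)) by field; rewrite gt_eqF.
  apply: cmod_cen; first exact: ltW.
  move=> z /andP[z1 z2]; rewrite ler_pdivlMr//.
  have zn0 : z != 0 by rewrite -cmod_gt0; lra.
  apply: le_trans (Hd z zn0 _); first by rewrite ler_wpM2l ?cmod_ge0.
  apply: le_lt_trans z2 _; rewrite /s mulrA -ltr_pdivlMl; last lra.
  by rewrite mulrC.
have := cmodBD (cen f (N + k) r) (cen f N s); lra.
Qed.

End Shrink.

Lemma cder_id z : cder id z 1.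
Proof.
move=> e e0; exists 1 => // h _.
by rewrite /= (_ : z + h - z - 1 * h = 0) ?cmod0 ?mulr_ge0 ?cmod_ge0 ?ltW//; ring.
Qed.

(** Cauchy's formula for the derivative as an inequality. The difference [h] of
    [(f z - f 0) / z ^+ 2] and [l / z] is [o(1 / cmod z)] at [0], so its sum vanishes in the limit.
    Hence [l] times the sum of [1 / z], of modulus at least 4, is bounded by the sum of the first
    term. *)
Lemma cauchy_estimate0 f (rho M : R) l : 0 < rho ->
  (forall z, cmod z < rho -> exists l, cder f z l) ->
  (forall z, cmod z < rho -> cmod (f z) <= M) ->
  cder f 0 l -> cmod l <= 16 * M / rho.
Proof.
move=> rho0 hol bnd Hl.
(* All points of the square of half-side [r] have modulus at most [2 * r], inside the disc. Then
   [4 * cmod l <= 16 * M / r] gives the constant 16. *)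
pose r := rho / 4; have rp : 0 < r by rewrite /r; lra.
pose g z : C := (f z - f 0) * (z * z)^-1.
pose h z : C := g z - l * z^-1.
have hholo z : z != 0 -> cmod z <= 2 * r -> exists k, cder h z k.
  move=> z0 zr; have [|k fk] := hol z; first by rewrite /r in zr; lra.
  have z2 : z * z != 0 by rewrite mulf_neq0.
  have D1 := cderM (cderB fk (cder_cst (f 0) z)) (@cderV R (fun w => w * w) z _ z2 (cderM (cder_id z) (cder_id z))).
  have D2 := cderM (cder_cst l z) (@cderV R id z _ z0 (cder_id z)).
  by eexists; exact: cderB D1 D2.
have small (e : R) : 0 < e -> exists2 d : R, 0 < d &
     forall z, z != 0 -> cmod z < d -> cmod (h z) * cmod z <= e.
  move=> e0; have [d d0 Hd] := Hl _ e0; exists d => // z z0 /Hd.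
  rewrite add0r => H; rewrite -cmodM.
  have -> : h z * z = (f z - f 0 - l * z) * z^-1 by rewrite /h /g; field.
  by rewrite cmodM cmodV ler_pdivrMr ?cmod_gt0.
have M0 : 0 <= M by apply: le_trans (bnd 0 _); rewrite ?cmod_ge0// cmod0.
apply/ler_addgt0Pr => e e0.
have [m Hm] := @cen_to0 h r hholo r ltac:(by rewrite rp lexx) small (4 * e) ltac:(lra).
have Eh : l * cen GRing.inv m r = cen g m r - cen h m r.
  have hE a u : bd h m a u = bd g m a u - l * bd GRing.inv m a u.
    by rewrite bdB bdZ.
  by rewrite /cen !hE; ring.
have gb : cmod (cen g m r) <= 8 * (r * (2 * M / r ^+ 2)).
  apply: cmod_cen; first exact: ltW.
  move=> z /andP[z1 z2]; rewrite /g cmodM cmodV -expr2 cmodX ler_pM ?invr_ge0 ?exprn_ge0 ?cmod_ge0//.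
    apply: le_trans (cmodD _ _) _; rewrite cmodN mulr2n mulrDl mul1r lerD//; apply: bnd.
      by rewrite /r in z2; lra.
    by rewrite cmod0.
  by rewrite lef_pV2 ?posrE ?exprn_gt0// ?ler_pXn2r ?nnegrE ?cmod_ge0// ?ltW//; lra.
have := congr1 (@cmod R) Eh; rewrite cmodM => E.
have c4 := cmod_cen_inv m rp.
have : cmod l * 4 <= 8 * (r * (2 * M / r ^+ 2)) + 4 * e.
  apply: le_trans (lerD gb Hm).
  apply: (le_trans (ler_wpM2l (cmod_ge0 l) c4)); rewrite E.
  by apply: le_trans (cmodD _ _) _; rewrite cmodN.
have -> : 8 * (r * (2 * M / r ^+ 2)) = 4 * (16 * M / rho).
  by rewrite /r; field; rewrite gt_eqF.
lra.
Qed.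

End CauchyEstimate.

(** * Real derivatives and Cauchy sequences *)

Section RealDeriv.
Variable R : realType.
Implicit Types (f g : R -> R) (x t l B : R).

Definition rder f x l := forall e : R, 0 < e -> exists2 d : R, 0 < d &
  forall h, `|h| < d -> `|f (x + h) - f x - l * h| <= e * `|h|.

Lemma rderP f x l : rder f x l <-> is_derive (x : R) (1 : R) f l.
Proof.
have key h : h != 0 -> `|l - h^-1 *: (f (h *: (1:R) + x) - f x)| * `|h| =
   `|f (x + h) - f x - l * h|.
  move=> h0; rewrite -normrM -[RHS]normrN; congr `| _ |.
  rewrite /GRing.scale /= mulr1 (addrC h x); by field.
split.
- move=> H.
  have K : (fun h : R => h^-1 *: (f (h *: (1:R) + x) - f x)) @ 0^' --> l.
    apply/cvgrPdist_le => e e0.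
    have [d d0 Hd] := H _ e0.
    near=> h.
    have h0 : h != 0 by near: h; exact: nbhs_dnbhs_neq.
    have hd : `|h| < d by near: h; exact: dnbhs0_lt.
    by rewrite -(@ler_pM2r _ `|h|) ?normr_gt0// key//; exact: Hd.
  split; last exact: cvg_lim K.
  by apply/cvg_ex; exists l.
- move=> [] /= D E e e0.
  have K : (fun h : R => h^-1 *: (f (h *: (1:R) + x) - f x)) @ 0^' --> l.
    by rewrite -E; exact: D.
  move/cvgrPdist_le : K => /(_ e e0).
  rewrite /prop_near1 /dnbhs /within /= ?near_withinE.
  move=> /nbhs_normP[d d0 Hd].
  exists d => // h hd.
  have [->|h0] := eqVneq h 0.
    by rewrite addr0 subrr sub0r mulr0 oppr0 normr0 mulr0.
  have := Hd h; rewrite /= sub0r normrN => /(_ hd h0).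
  by rewrite -(@ler_pM2r _ `|h|) ?normr_gt0// key.
Unshelve. all: by end_near.
Qed.

Lemma rder_of_quadratic f x l (d A : R) : 0 < d ->
  (forall h, `|h| < d -> `|f (x + h) - f x - l * h| <= A * `|h| ^+ 2) -> rder f x l.
Proof.
move=> d0 H e e0; have A1 : 0 < `|A| + 1 by rewrite ltr_wpDl.
exists (Num.min d (e / (`|A| + 1))); first by rewrite lt_min d0 divr_gt0.
move=> h; rewrite lt_min => /andP[/H K]; rewrite ltr_pdivlMr// => he.
apply: (le_trans K); rewrite expr2 mulrA ler_wpM2r//.
have := ler_norm A; have := normr_ge0 h; nra.
Qed.

Lemma mean_value_bound f (a b B : R) : a <= b ->
  (forall t, a <= t <= b -> exists2 l, rder f t l & `|l| <= B) ->
  `|f b - f a| <= B * (b - a).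
Proof.
move=> ab H; have /choice[df Hdf] : forall t, exists l, a <= t <= b -> rder f t l /\ `|l| <= B.
  move=> t; have [h|h] := boolP (a <= t <= b).
    by have [l h1 h2] := H t h; exists l.
  by exists 0.
have D t : a <= t <= b -> is_derive t 1 f (df t) by move=> /Hdf[/rderP].
have [||c cab ->] := @MVT_segment _ f df a b ab.
- by move=> t; rewrite in_itv /= => /andP[/ltW ? /ltW ?]; apply: D; lra.
- apply: derivable_within_continuous => t; rewrite in_itv /= => tab.
  by have [] := D t tab.
- rewrite normrM (ger0_norm (x := b - a)) ?subr_ge0// ler_wpM2r ?subr_ge0//.
  by have [] := Hdf c; rewrite -?in_itv.
Qed.

Lemma real_cauchy_cvg (u : nat -> R) :
  (forall e : R, 0 < e -> exists N, forall m k, (N <= m)%N -> (N <= k)%N -> `|u m - u k| <= e) ->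
  exists l, forall e : R, 0 < e -> exists N, forall m, (N <= m)%N -> `|u m - l| <= e.
Proof.
(* The limit is found as the lower limit, the supremum of the eventual lower bounds. *)
move=> H; pose S := [set x | exists N, forall m, (N <= m)%N -> x <= u m].
have ubS (e : R) N : (forall m k, (N <= m)%N -> (N <= k)%N -> `|u m - u k| <= e) ->
    ubound S (u N + e).
  move=> HN x [N' HN']; apply: (le_trans (HN' (maxn N N') (leq_maxr _ _))).
  by have := HN _ _ (leq_maxl N N') (leqnn N); rewrite ler_norml; lra.
have inS (e : R) N : (forall m k, (N <= m)%N -> (N <= k)%N -> `|u m - u k| <= e) ->
    S (u N - e).
  move=> HN; exists N => m Nm.
  by have := HN _ _ Nm (leqnn N); rewrite ler_norml; lra.
exists (sup S) => e e0; have [N HN] := H (e / 2) ltac:(lra); exists N => m Nm.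
have h1 : u N - e / 2 <= sup S.
  apply: ub_le_sup; last exact: inS HN.
  by exists (u N + e / 2); exact: ubS.
have h2 : sup S <= u N + e / 2.
  by apply: ge_sup; [exists (u N - e / 2); exact: inS|exact: ubS].
by have := HN _ _ Nm (leqnn N); rewrite !ler_norml; lra.
Qed.

End RealDeriv.

(** * Lipschitz and Taylor bounds on discs; limits of holomorphic functions *)

Section ComplexMeanValue.
Variable R : realType.
Local Notation C := R[i].
Implicit Types (f g : C -> C) (z w l v : C) (B M : R).

Lemma cder_comp_affine f z a v l : cder f (z + a * v) l ->
  cder (fun b => f (z + b * v)) a (l * v).
Proof.
have [->|v0] := eqVneq v 0.
  move=> _ e e0; exists 1 => // h _.
  by rewrite !mulr0 subrr mul0r subr0 cmod0 mulr_ge0 ?cmod_ge0// ltW.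
have cv : 0 < cmod v by rewrite cmod_gt0.
move=> H e e0; have [d d0 Hd] := H _ (divr_gt0 e0 cv).
exists (d / cmod v); first exact: divr_gt0.
move=> h; rewrite ltr_pdivlMr// -cmodM => /Hd.
have -> : z + a * v + h * v = z + (a + h) * v by ring.
have -> : l * (h * v) = l * v * h by ring.
move=> K; apply: (le_trans K); rewrite cmodM.
by rewrite le_eqVlt; apply/orP; left; apply/eqP; field; rewrite gt_eqF.
Qed.

Lemma cder_shift f z a l : cder f (z + a) l <-> cder (fun b => f (z + b)) a l.
Proof.
split=> H e e0; have [d d0 Hd] := H e e0; exists d => // h /Hd; first by rewrite addrA.
by rewrite addrA.
Qed.

Lemma cder_conjM f (c : C) z l (t : R) v : cder f (z + t%:C%C * v) l ->
  rder (fun s => complex.Re (c * f (z + s%:C%C * v))) t (complex.Re (c * (l * v))).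
Proof.
move=> /cder_comp_affine H e e0.
have c1 : 0 < cmod c + 1 by rewrite ltr_wpDl ?cmod_ge0.
have [d d0 Hd] := H _ (divr_gt0 e0 c1).
exists d => // h hd; have := Hd h%:C%C; rewrite cmod_real => /(_ hd).
rewrite rmorphD; set A := f (z + (_ + _) * v); set B := f _ => K.
have -> : complex.Re (c * A) - complex.Re (c * B) - complex.Re (c * (l * v)) * h =
  complex.Re (c * (A - B - l * v * h%:C%C)).
  have -> : complex.Re (c * (l * v)) * h = complex.Re (c * (l * v * h%:C%C)).
    have -> : c * (l * v * h%:C%C) = h%:C%C * (c * (l * v)) by ring.
    by rewrite Re_Zr mulrC.
  by rewrite -!ReB; congr complex.Re; ring.
apply: (le_trans (Re_le_cmod _)); rewrite cmodM.
apply: (le_trans (ler_wpM2l (cmod_ge0 c) K)).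
have -> : cmod c * (e / (cmod c + 1) * `|h|) = (cmod c / (cmod c + 1)) * (e * `|h|).
  by ring.
rewrite -[leRHS]mul1r ler_wpM2r ?mulr_ge0 ?normr_ge0 ?ltW//.
by rewrite ltr_pdivrMr// mul1r ltrDl.
Qed.

(** The real mean value bound is applied to the real part of [f] times the conjugate of the
    increment [c]; its own increment is [cmod c ^+ 2]. *)
Lemma cmean_value_bound f z v B :
  (forall t : R, 0 <= t <= 1 -> exists2 l, cder f (z + t%:C%C * v) l & cmod l <= B) ->
  cmod (f (z + v) - f z) <= B * cmod v.
Proof.
move=> H; pose c := f (z + v) - f z.
have [c0|c0] := eqVneq c 0.
  have [l _ lB] := H 0 ltac:(by rewrite lexx ler01).
  by rewrite -/c c0 cmod0 mulr_ge0 ?cmod_ge0// (le_trans (cmod_ge0 l)).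
have cc : 0 < cmod c by rewrite cmod_gt0.
have := @mean_value_bound R (fun s => complex.Re ((c^*)%C * f (z + s%:C%C * v))) 0 1
  (cmod c * (B * cmod v)) ler01.
rewrite subr0 mulr1 rmorph0 rmorph1 mul0r mul1r addr0 => K.
have : `|complex.Re ((c^*)%C * f (z + v)) - complex.Re ((c^*)%C * f z)| <= cmod c * (B * cmod v).
  apply: K => t t01; have [l Hl lB] := H t t01.
  exists (complex.Re ((c^*)%C * (l * v))); first exact: cder_conjM.
  apply: (le_trans (Re_le_cmod _)); rewrite cmodM cmodJ cmodM.
  by rewrite ler_wpM2l ?cmod_ge0// ler_wpM2r ?cmod_ge0.
rewrite -ReB -mulrBr -/c mulrC Re_mulJ ger0_norm ?exprn_ge0 ?cmod_ge0// expr2.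
by rewrite ler_pM2l.
Qed.

Lemma cder_of_quadratic f z l (d A : R) : 0 < d ->
  (forall h, cmod h < d -> cmod (f (z + h) - f z - l * h) <= A * cmod h ^+ 2) -> cder f z l.
Proof.
move=> d0 H e e0; have A1 : 0 < `|A| + 1 by rewrite ltr_wpDl.
exists (Num.min d (e / (`|A| + 1))); first by rewrite lt_min d0 divr_gt0.
move=> h; rewrite lt_min => /andP[/H K]; rewrite ltr_pdivlMr// => he.
apply: (le_trans K); rewrite expr2 mulrA ler_wpM2r ?cmod_ge0//.
have := ler_norm A; have := cmod_ge0 h; nra.
Qed.

Definition hol_disc f z0 (r : R) := forall z, cmod (z - z0) < r -> exists l, cder f z l.

Lemma cauchy_estimate f z0 (r M : R) l : 0 < r -> hol_disc f z0 r ->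
  (forall z, cmod (z - z0) < r -> cmod (f z) <= M) -> cder f z0 l -> cmod l <= 16 * M / r.
Proof.
move=> r0 hol bnd Hl.
apply: (@cauchy_estimate0 R (fun b => f (z0 + b))) => //.
- move=> z zr; have [|k Hk] := hol (z0 + z); first by rewrite addrC addKr.
  by exists k; apply/cder_shift.
- by move=> z zr; apply: bnd; rewrite addrC addKr.
- by apply/cder_shift; rewrite addr0.
Qed.

Lemma hol_disc_sub f z0 z1 (r s : R) : hol_disc f z0 r -> cmod (z1 - z0) + s <= r ->
  hol_disc f z1 s.
Proof.
move=> hol h z zs; apply: hol; apply: lt_le_trans h.
by have -> : z - z0 = (z1 - z0) + (z - z1) by [ring]; apply: le_lt_trans (cmodD _ _) _; rewrite ltrD2l.
Qed.

Lemma disc_tri z0 z1 (r s : R) z : cmod (z1 - z0) + s <= r -> cmod (z - z1) < s -> cmod (z - z0) < r.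
Proof.
move=> h zs; apply: lt_le_trans h.
by have -> : z - z0 = (z1 - z0) + (z - z1) by [ring]; apply: le_lt_trans (cmodD _ _) _; rewrite ltrD2l.
Qed.

Lemma lipschitz_disc f z0 (r M : R) z v : 0 < r -> hol_disc f z0 r ->
  (forall z, cmod (z - z0) < r -> cmod (f z) <= M) ->
  cmod (z - z0) + cmod v < r / 2 -> cmod (f (z + v) - f z) <= 32 * M / r * cmod v.
Proof.
move=> r0 hol bnd h; apply: cmean_value_bound => t t01.
have zt : cmod (z + t%:C%C * v - z0) + r / 2 <= r.
  have -> : z + t%:C%C * v - z0 = (z - z0) + t%:C%C * v by ring.
  have := cmodD (z - z0) (t%:C%C * v); rewrite cmodM cmod_real ger0_norm; last lra.
  by have := cmod_ge0 v; nra.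
have [|l Hl] := hol (z + t%:C%C * v); first by lra.
exists l => //; have -> : 32 * M / r = 16 * M / (r / 2) by field; rewrite gt_eqF.
apply: (@cauchy_estimate f (z + t%:C%C * v)) => //; first lra.
- exact: hol_disc_sub zt.
- by move=> z1 h1; apply: bnd; exact: disc_tri zt h1.
Qed.

(** No second derivative is needed. The increment [k - l] of the derivative is the derivative at
    [z0] of the difference of [f] and its translate by [h], which [lipschitz_disc] bounds by
    [32 * M / r * cmod v] on a disc of radius [r / 4]; the Cauchy estimate there gives 2048. *)
Lemma taylor_disc f z0 (r M : R) l v : 0 < r -> hol_disc f z0 r ->
  (forall z, cmod (z - z0) < r -> cmod (f z) <= M) -> cder f z0 l ->
  cmod v < r / 4 -> cmod (f (z0 + v) - f z0 - l * v) <= 2048 * M / r ^+ 2 * cmod v ^+ 2.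
Proof.
move=> r0 hol bnd Hl vr.
pose g w := f w - l * w.
have -> : f (z0 + v) - f z0 - l * v = g (z0 + v) - g z0 by rewrite /g; ring.
rewrite expr2 mulrA; apply: cmean_value_bound => t t01.
pose h := t%:C%C * v.
have hv : cmod h <= cmod v.
  by rewrite cmodM cmod_real ger0_norm; [have := cmod_ge0 v; nra|lra].
have [|k Hk] := hol (z0 + h); first by rewrite addrC addKr; lra.
have M0 : 0 <= M by apply: le_trans (bnd z0 _); rewrite ?cmod_ge0// subrr cmod0.
exists (k - l).
  have D := cderB Hk (cderM (cder_cst l (z0 + h)) (cder_id (z0 + h))).
  by rewrite mulr1 mulr0 addr0 in D.
have -> : 2048 * M / r ^+ 2 * cmod v = 16 * (32 * M / r * cmod v) / (r / 4).
  by field; rewrite gt_eqF.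
have D := cderB ((cder_shift f h z0 k).1 ltac:(by rewrite addrC)) Hl.
apply: (cauchy_estimate _ _ _ D); first lra.
- move=> z zr.
  have [|k1 H1] := hol (h + z).
    have -> : h + z - z0 = h + (z - z0) by ring.
    by apply: (le_lt_trans (cmodD _ _)); lra.
  have [|k2 H2] := hol z; first lra.
  by exists (k1 - k2); apply: cderB => //; apply/cder_shift.
- move=> z zr; rewrite addrC [h + z]addrC [- _ + _]addrC.
  apply: (le_trans (@lipschitz_disc f z0 r M z h r0 hol bnd _)); first by lra.
  by rewrite ler_wpM2l// divr_ge0 ?mulr_ge0// ltW.
Qed.

Lemma complex_cauchy_cvg (u : nat -> C) :
  (forall e : R, 0 < e -> exists N, forall m k, (N <= m)%N -> (N <= k)%N -> cmod (u m - u k) <= e) ->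
  exists l, forall e : R, 0 < e -> exists N, forall m, (N <= m)%N -> cmod (u m - l) <= e.
Proof.
move=> H.
have [x Hx] := @real_cauchy_cvg R (fun k => complex.Re (u k)) ltac:(
  by move=> e /H[N HN]; exists N => m k Nm Nk; rewrite -ReB (le_trans (Re_le_cmod _))// HN).
have [y Hy] := @real_cauchy_cvg R (fun k => complex.Im (u k)) ltac:(
  by move=> e /H[N HN]; exists N => m k Nm Nk; rewrite -ImB (le_trans (Im_le_cmod _))// HN).
exists (x +i* y)%C => e e0.
have [N1 H1] := Hx (e / 2) ltac:(lra); have [N2 H2] := Hy (e / 2) ltac:(lra).
exists (maxn N1 N2) => m; rewrite geq_max => /andP[/H1 h1 /H2 h2].
by apply: (le_trans (cmod_le_ReIm _)); rewrite ReB ImB /=; lra.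
Qed.

(* [F h] stands for a difference quotient with complex step [h]. *)
Lemma cder_uniform_limit (F : C -> C -> C) f (r M eta K : R) :
  0 < r -> 0 < eta ->
  (forall h, 0 < cmod h < eta -> hol_disc (F h) 0 r) ->
  (forall h z, 0 < cmod h < eta -> cmod z < r -> cmod (F h z) <= M) ->
  (forall h z, 0 < cmod h < eta -> cmod z < r -> cmod (F h z - f z) <= K * cmod h) ->
  exists l, cder f 0 l.
Proof.
move=> r0 eta0 hol bnd unif.
pose h k : C := (eta / 2 * 2^-1 ^+ k)%:C%C.
have hE k : cmod (h k) = eta / 2 * 2^-1 ^+ k.
  by rewrite cmod_real ger0_norm// mulr_ge0 ?exprn_ge0//; lra.
have Hh k : 0 < cmod (h k) < eta.
  have p0 : 0 < (2^-1 : R) ^+ k by rewrite exprn_gt0.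
  have p1 : (2^-1 : R) ^+ k <= 1 by rewrite exprn_ile1//; lra.
  by rewrite hE; nra.
have h0 (e : R) : 0 < e -> exists N, forall m, (N <= m)%N -> K * cmod (h m) <= e.
  move=> e0; have K1 : 0 < `|K| + 1 by rewrite ltr_wpDl.
  have [N HN] := exists_pow2_lt (divr_gt0 e0 (mulr_gt0 eta0 K1)).
  exists N => m Nm; rewrite hE.
  have p0 : 0 < (2^-1 : R) ^+ m by rewrite exprn_gt0.
  have : (2^-1 : R) ^+ m <= 2^-1 ^+ N by rewrite ler_wiXn2l//; lra.
  move: HN; rewrite ltr_pdivlMr ?mulr_gt0// => HN pm.
  pose q := eta * 2^-1 ^+ m.
  have q0 : 0 < q by rewrite mulr_gt0.
  have qe : q * (`|K| + 1) < e.
    apply: le_lt_trans HN; rewrite mulrA [_ * eta]mulrC ler_wpM2r ?(ltW K1)//.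
    by rewrite /q ler_pM2l.
  have -> : K * (eta / 2 * 2^-1 ^+ m) = K * q / 2 by rewrite /q; field.
  by have := ler_norm K; have := normr_ge0 K; nra.
have /choice[l Hl] : forall k, exists l, cder (F (h k)) 0 l.
  by move=> k; apply: (hol (h k) (Hh k) 0); rewrite subrr cmod0.
(* Two members of the family are uniformly close on the disc, so the Cauchy estimate for their
   difference makes the derivatives at [0] a Cauchy sequence. *)
have [L HL] : exists L, forall e : R, 0 < e -> exists N, forall m, (N <= m)%N -> cmod (l m - L) <= e.
  apply: complex_cauchy_cvg => e e0.
  have [N HN] := h0 (e * r / 32) ltac:(by rewrite divr_gt0// mulr_gt0).
  exists N => m k Nm Nk.
  have -> : e = 16 * (e * r / 32 + e * r / 32) / r by field; rewrite gt_eqF.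
  apply: (cauchy_estimate r0 _ _ (cderB (Hl m) (Hl k))).
  - move=> z zr; have [l1 H1] := hol _ (Hh m) z zr; have [l2 H2] := hol _ (Hh k) z zr.
    by exists (l1 - l2); exact: cderB.
  - move=> z; rewrite subr0 => zr.
    have := unif _ z (Hh m) zr; have := unif _ z (Hh k) zr; have := HN _ Nm; have := HN _ Nk.
    have -> : F (h m) z - F (h k) z = (F (h m) z - f z) - (F (h k) z - f z) by ring.
    by have := cmodD (F (h m) z - f z) (- (F (h k) z - f z)); rewrite cmodN; lra.
(* The Taylor constant depends only on [M] and [r], so the quadratic estimate survives the limit. *)
exists L; apply: (@cder_of_quadratic f 0 L (r / 4) (2048 * M / r ^+ 2)); first lra.
move=> z zr; apply/ler_addgt0Pr => e e0.
have [N1 H1] := h0 (e / 4) ltac:(lra).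
have z1 : 0 < cmod z + 1 by rewrite ltr_wpDl ?cmod_ge0.
have [N2 H2] := HL (e / 2 / (cmod z + 1)) ltac:(by rewrite !divr_gt0).
pose k := maxn N1 N2.
have := H2 k (leq_maxr _ _); rewrite ler_pdivlMr// => a2.
have a1 := H1 k (leq_maxl _ _).
have T := @taylor_disc (F (h k)) 0 r M (l k) z r0 (hol _ (Hh k))
   ltac:(by move=> w; rewrite subr0; apply: bnd) (Hl k) zr.
have zr' : cmod z < r by apply: lt_trans zr _; rewrite ltr_pdivrMr// ltr_pMr// ltr1n.
have b1 := unif (h k) z (Hh k) zr'.
have b2 := unif (h k) 0 (Hh k) ltac:(by rewrite cmod0).
rewrite add0r in T *.
have -> : f z - f 0 - L * z = (F (h k) z - F (h k) 0 - l k * z) + - (F (h k) z - f z)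
  + (F (h k) 0 - f 0) + (l k - L) * z by ring.
have c : cmod ((l k - L) * z) <= e / 2.
  by rewrite cmodM; have := cmod_ge0 (l k - L); have := cmod_ge0 z; nra.
have -> : 2048 * M / r ^+ 2 * cmod z ^+ 2 + e =
  2048 * M / r ^+ 2 * cmod z ^+ 2 + e / 4 + e / 4 + e / 2 by field; rewrite gt_eqF.
by apply: cmodD4; rewrite ?cmodN//; lra.
Qed.

End ComplexMeanValue.

(** * The sup norm of [C^n] with real values *)

Section RowNorm.
Variables (R : realType) (n : nat).
Local Notation C := R[i].
Local Notation Cn := 'rV[C]_n.
Implicit Types (v w z : Cn) (a : C).

Definition nv v : R := complex.Re `|v|.

Lemma normr_nv v : `|v| = (nv v)%:C%C.
Proof. by rewrite /nv RRe_real// realE normr_ge0. Qed.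

Lemma nv_ge0 v : 0 <= nv v.
Proof. by rewrite -ler0c -normr_nv normr_ge0. Qed.

Lemma nv0 : nv 0 = 0. Proof. by rewrite /nv normr0. Qed.

Lemma nvN v : nv (- v) = nv v. Proof. by rewrite /nv normrN. Qed.

Lemma nvB v w : nv (v - w) = nv (w - v). Proof. by rewrite -nvN opprB. Qed.

Lemma nvD v w : nv (v + w) <= nv v + nv w.
Proof. by rewrite -lecR rmorphD/= -!normr_nv ler_normD. Qed.

Lemma nvZ a v : nv (a *: v) = cmod a * nv v.
Proof. by apply: (@complexI R); rewrite rmorphM/= -!normr_nv normrZ normcmod. Qed.

Lemma nv_eq0 v : (nv v == 0) = (v == 0).
Proof. by rewrite -(inj_eq (@complexI R)) -normr_nv normr_eq0. Qed.

Lemma nv_coord v j : cmod (v 0 j) <= nv v.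
Proof.
rewrite -lecR -normr_nv -normcmod (_ : `|v| = mx_norm v)// mx_normE.
by rewrite -[leLHS]nngE num_le; apply: (le_bigmax _ _ (0, j)).
Qed.

Lemma nv_attained v : 0 < nv v -> exists j, nv v = cmod (v 0 j).
Proof.
move=> v0; have : mx_norm v != 0.
  have -> : mx_norm v = `|v| by [].
  by rewrite normr_eq0 -nv_eq0 gt_eqF.
move=> /mx_norm_neq0[[i j]] /= E; exists j; apply: (@complexI R).
by rewrite -normr_nv -normcmod [LHS]E; rewrite (ord1 i).
Qed.

Lemma nv_le v (b : R) : 0 <= b -> (forall j, cmod (v 0 j) <= b) -> nv v <= b.
Proof.
move=> b0 H; have [/nv_attained[j ->//]|] := ltP 0 (nv v).
by move=> h; exact: le_trans b0.
Qed.

Lemma nv_tri v w z : nv (v - z) <= nv (v - w) + nv (w - z).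
Proof. by apply: le_trans (nvD _ _); rewrite addrA subrK. Qed.

Lemma nbhs_nvP z (A : set Cn) :
  nbhs z A <-> exists2 r : R, 0 < r & forall w, nv (w - z) < r -> A w.
Proof.
have P := @nbhs_ballP R[i] Cn z A.
split=> [/(P.1)[d /= /cgt0_real[-> d0] Hd]|[r r0 H]].
  by exists (complex.Re d) => // w wr; apply: Hd; rewrite -ball_normE /= normr_nv ltcR nvB.
apply/(P.2); exists r%:C%C; first by rewrite /= ltcR.
by move=> w; rewrite -ball_normE /= normr_nv ltcR nvB; exact: H.
Qed.

Lemma open_nv (A : set Cn) z : open A -> A z ->
  exists2 r : R, 0 < r & forall w, nv (w - z) < r -> A w.
Proof. by move=> oA Az; apply/nbhs_nvP; rewrite nbhsE /=; exists A. Qed.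

Definition pball z (r : R) : set Cn := [set w | nv (w - z) < r].

Lemma pball_center z r : 0 < r -> pball z r z.
Proof. by rewrite /pball /= subrr nv0. Qed.

Lemma pball_sub z r s : r <= s -> pball z r `<=` pball z s.
Proof. by move=> rs w /lt_le_trans; apply. Qed.

Lemma pball_tri z z1 r s : nv (z1 - z) + s <= r -> pball z1 s `<=` pball z r.
Proof.
move=> h w; rewrite /pball /= => ws; apply: le_lt_trans (nv_tri w z1 z) _.
by apply: lt_le_trans h; rewrite addrC ltrD2l.
Qed.

Lemma open_pball z r : open (pball z r).
Proof.
rewrite openE => w wr; apply/nbhs_nvP; exists (r - nv (w - z)); first by rewrite subr_gt0.
by apply: pball_tri; rewrite addrC subrK.
Qed.

End RowNorm.

(** * Holomorphy along complex lines *)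

Section Gateaux.
Variables (R : realType) (n : nat).
Local Notation C := R[i].
Local Notation Cn := 'rV[C]_n.
Implicit Types (v w z u : Cn) (a l : C) (f : Cn -> C) (A : set Cn) (r s M : R).

Definition gder f z v l := cder (fun a => f (z + a *: v)) 0 l.

Definition ghol A f := forall z, A z -> forall v, exists l, gder f z v l.

(** Chosen with default value [0]; it is a derivative only where [dirDP] applies. *)
Definition dirD f v z : C := xget 0 [set l | gder f z v l].

Lemma ghol_sub A B f : A `<=` B -> ghol B f -> ghol A f.
Proof. by move=> AB H z /AB; exact: H. Qed.

Lemma dirDP A f z v : ghol A f -> A z -> gder f z v (dirD f v z).
Proof. by move=> H Az; have [l Hl] := H z Az v; exact: (xgetPex 0 (ex_intro _ l Hl)). Qed.

Lemma gder_line f z a v l : gder f (z + a *: v) v l <-> cder (fun b => f (z + b *: v)) a l.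
Proof.
have E b : z + a *: v + b *: v = z + (a + b) *: v by rewrite scalerDl addrA.
rewrite -[a in X in _ <-> X]addr0 cder_shift /gder.
by rewrite (_ : (fun b => f (z + a *: v + b *: v)) = (fun b => f (z + (a + b) *: v)))//;
  apply/funext => b; rewrite E.
Qed.

Lemma pball_line z r v a : nv v <= 1 -> cmod a < r -> pball z r (z + a *: v).
Proof.
move=> v1 ar; rewrite /pball /= addrC addKr nvZ; apply: le_lt_trans ar.
by rewrite -[leRHS]mulr1 ler_wpM2l ?cmod_ge0.
Qed.

Lemma hol_disc_line z r f v : ghol (pball z r) f -> nv v <= 1 ->
  hol_disc (fun a => f (z + a *: v)) 0 r.
Proof.
move=> H v1 a; rewrite subr0 => ar.
have [l Hl] := H _ (@pball_line z r v a v1 ar) v.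
by exists l; apply/gder_line.
Qed.

Lemma dirD_bound z r f v M : 0 < r -> ghol (pball z r) f -> nv v <= 1 ->
  (forall w, pball z r w -> cmod (f w) <= M) -> cmod (dirD f v z) <= 16 * M / r.
Proof.
move=> r0 H v1 bnd; apply: (cauchy_estimate r0 (hol_disc_line H v1)).
  by move=> a; rewrite subr0 => ar; apply: bnd; exact: pball_line.
exact: dirDP H (pball_center _ r0).
Qed.

Lemma dirD_taylor z r f v a M : 0 < r -> ghol (pball z r) f -> nv v <= 1 ->
  (forall w, pball z r w -> cmod (f w) <= M) -> cmod a < r / 4 ->
  cmod (f (z + a *: v) - f z - dirD f v z * a) <= 2048 * M / r ^+ 2 * cmod a ^+ 2.
Proof.
move=> r0 H v1 bnd ar.
have := taylor_disc r0 (hol_disc_line H v1) _ (dirDP v H (pball_center _ r0)) ar.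
rewrite add0r scale0r addr0; apply.
by move=> b; rewrite subr0 => br; apply: bnd; exact: pball_line.
Qed.

Lemma dirD_lipschitz z r f v a M : 0 < r -> ghol (pball z r) f -> nv v <= 1 ->
  (forall w, pball z r w -> cmod (f w) <= M) -> cmod a < r / 2 ->
  cmod (f (z + a *: v) - f z) <= 32 * M / r * cmod a.
Proof.
move=> r0 H v1 bnd ar.
have := @lipschitz_disc _ _ 0 r M 0 a r0 (hol_disc_line H v1).
rewrite (add0r a) scale0r addr0; apply.
  by move=> b; rewrite subr0 => br; apply: bnd; exact: pball_line.
by rewrite subrr cmod0 add0r.
Qed.

Definition cj (b : bool) a : C := if b then (a^*)%C else a.

Lemma cjB b a a' : cj b (a - a') = cj b a - cj b a'.
Proof. by case: b => //=; rewrite rmorphB. Qed.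
Lemma cjM b a a' : cj b (a * a') = cj b a * cj b a'.
Proof. by case: b => //=; rewrite rmorphM. Qed.
Lemma cmod_cj b a : cmod (cj b a) = cmod a.
Proof. by case: b => //=; rewrite cmodJ. Qed.
(* The boolean lets one proof cover holomorphic and antiholomorphic
   dependence on the parameter. *)
Lemma dirD_param_hol (b : bool) (phi : C -> Cn -> C) z v (s rho M : R) :
  0 < s -> 0 < rho -> nv v <= 1 ->
  (forall a, cmod a < rho -> ghol (pball z s) (phi a)) ->
  (forall a w, cmod a < rho -> pball z s w -> cmod (phi a w) <= M) ->
  (forall w, pball z s w -> hol_disc (fun a => cj b (phi a w)) 0 rho) ->
  exists l, cder (fun a => cj b (dirD (phi a) v z)) 0 l.
Proof.
move=> s0 rho0 v1 hz bnd ha.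
pose K := 2048 * M / s ^+ 2.
(* With the step conjugated as well, conjugating the quotient leaves division by the constant [h],
   so [F h] is holomorphic in [a] for both values of [b]. *)
pose F h a := cj b ((phi a (z + cj b h *: v) - phi a z) * (cj b h)^-1).
have close h a : 0 < cmod h < s / 4 -> cmod a < rho ->
    cmod (F h a - cj b (dirD (phi a) v z)) <= K * cmod h.
  move=> /andP[h0 hs] ar; rewrite /F -cjB cmod_cj.
  set k := cj b h; have kh : cmod k = cmod h by rewrite cmod_cj.
  have k0 : k != 0 by rewrite -cmod_gt0 kh.
  have := @dirD_taylor z s (phi a) v k M s0 (hz a ar) v1 (fun w => bnd a w ar).
  rewrite kh => /(_ hs) T.
  rewrite -(@ler_pM2r _ (cmod h))// -[in leLHS]kh -cmodM.
  have -> : ((phi a (z + k *: v) - phi a z) / k - dirD (phi a) v z) * k =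
    phi a (z + k *: v) - phi a z - dirD (phi a) v z * k by field.
  by rewrite -mulrA -expr2.
apply: (@cder_uniform_limit _ F _ rho (16 * M / s + `|K| * s) (s / 4) K) => //; first lra.
- move=> h /andP[h0 hs] a; rewrite subr0 => ar.
  have zb : pball z s (z + cj b h *: v) by apply: pball_line => //; rewrite cmod_cj; lra.
  have [l1 H1] := ha _ zb a ltac:(by rewrite subr0).
  have [l2 H2] := ha _ (pball_center z s0) a ltac:(by rewrite subr0).
  have := cderM (cderB H1 H2) (cder_cst (h^-1) a).
  set l := (X in cder _ _ X) => D; exists l.
  suff -> : F h = fun a => (cj b (phi a (z + cj b h *: v)) - cj b (phi a z)) * h^-1 by [].
  apply/funext => a'; rewrite /F cjM cjB; congr (_ * _).
  by case: (b) => //=; rewrite conjc_inv conjcK.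
- move=> h a hh ar.
  have B1 := dirD_bound s0 (hz a ar) v1 (fun w => bnd a w ar).
  have := close h a hh ar; have := cmodBD (F h a) (cj b (dirD (phi a) v z)).
  rewrite cmod_cj; case/andP: hh => h0 hs.
  have : K * cmod h <= `|K| * s.
    by have := ler_norm K; have := normr_ge0 K; nra.
  lra.
Qed.

End Gateaux.

(** * Sesquiholomorphic functions and their derivatives on the diagonal *)

Section SesquiHolomorphic.
Variables (R : realType) (n : nat).
Local Notation C := R[i].
Local Notation Cn := 'rV[C]_n.
Implicit Types (v w z u : Cn) (a l : C) (F : Cn -> Cn -> C) (A : set Cn) (r s M : R).

Definition sesqui A M F := [/\ forall z w, A z -> A w -> cmod (F z w) <= M,
  forall w, A w -> ghol A (fun z => F z w) &
  forall z, A z -> ghol A (fun w => (F z w)^*%C)].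

(** The Hermitian transpose: conjugating by it turns the derivative in the first variable into the
    one in the second. *)
Definition swapF F : Cn -> Cn -> C := fun z w => (F w z)^*%C.

Lemma sesqui_swap A M F : sesqui A M F -> sesqui A M (swapF F).
Proof.
move=> [h1 h2 h3]; split => [z w Az Aw|w Aw|z Az].
- by rewrite /swapF cmodJ; exact: h1.
- exact: h3.
- rewrite (_ : (fun w => _) = (fun w => F w z)); first exact: h2.
  by apply/funext => w; rewrite /swapF conjcK.
Qed.

Definition DF v F : Cn -> Cn -> C := fun z w => dirD (fun z' => F z' w) v z.

Lemma ghol_add A (f g : Cn -> C) : ghol A f -> ghol A g -> ghol A (fun z => f z + g z).
Proof.
move=> hf hg z Az v; have [l Hl] := hf z Az v; have [k Hk] := hg z Az v.
by exists (l + k); exact: cderD.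
Qed.

Lemma sesqui_sub A B M F : A `<=` B -> sesqui B M F -> sesqui A M F.
Proof.
move=> AB [h1 h2 h3]; split => [z w /AB Az /AB Aw|w /AB Aw|z /AB Az].
- exact: h1.
- exact: ghol_sub AB (h2 w Aw).
- exact: ghol_sub AB (h3 z Az).
Qed.

Lemma small_step r u : 0 < r -> exists2 rho : R, 0 < rho & forall a, cmod a < rho -> nv (a *: u) < r.
Proof.
move=> r0; have u1 : 0 < nv u + 1 by rewrite ltr_wpDl ?nv_ge0.
exists (r / (nv u + 1)); first exact: divr_gt0.
move=> a; rewrite ltr_pdivlMr// nvZ => h; apply: le_lt_trans h.
by rewrite ler_wpM2l ?cmod_ge0// lerDl.
Qed.

(** The bound is the Cauchy estimate on balls of radius [s]. Holomorphy in either variable is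
    [dirD_param_hol], with the plain parameter for the first and the conjugated one for the
    second. *)
Lemma sesqui_DF z0 r s M v F : 0 < s -> nv v <= 1 ->
  sesqui (pball z0 (r + s)) M F -> sesqui (pball z0 r) (16 * M / s) (DF v F).
Proof.
move=> s0 v1 [bF hF cF].
have sub1 : pball z0 r `<=` pball z0 (r + s) by apply: pball_sub; rewrite lerDl ltW.
have sub2 z : pball z0 r z -> pball z s `<=` pball z0 (r + s).
  by move=> zr; apply: pball_tri; rewrite lerD2r ltW.
split=> [z w zr wr|w wr z zr u|z zr w wr u].
- apply: (@dirD_bound _ _ z s) => //.
  + exact: ghol_sub (sub2 _ zr) (hF _ (sub1 _ wr)).
  + by move=> z' /(sub2 _ zr) h; apply: bF => //; exact: sub1.
- have d0 : 0 < r - nv (z - z0) by rewrite subr_gt0.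
  have [rho rho0 Hrho] := small_step u d0.
  have inb a z' : cmod a < rho -> pball z s z' -> pball z0 (r + s) (z' + a *: u).
    move=> /Hrho ar; rewrite /pball /= => z's.
    have -> : z' + a *: u - z0 = (z' - z) + (a *: u + (z - z0)).
      by rewrite addrCA (addrA (z' - z)) subrK [z' + _]addrC -addrA.
    have := nvD (z' - z) (a *: u + (z - z0)); have := nvD (a *: u) (z - z0); lra.
  rewrite /gder.
  have [|||l Hl] := @dirD_param_hol _ n false (fun a z' => F (z' + a *: u) w) z v s rho M s0 rho0 v1.
  + move=> a ar z' z's x; have [l Hl] := hF w (sub1 _ wr) _ (inb _ _ ar z's) x.
    exists l; rewrite /gder (_ : (fun b => _) = (fun b => F (z' + a *: u + b *: x) w))//.
    by apply/funext => b; rewrite addrAC.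
  + by move=> a z' ar z's; apply: bF; [exact: inb|exact: sub1].
  + move=> z' z's a; rewrite subr0 => ar.
    have [l Hl] := hF w (sub1 _ wr) _ (inb _ _ ar z's) u.
    by exists l; move: Hl => /gder_line.
  exists l; move: Hl; rewrite (_ : (fun a => cj false _) = (fun a => DF v F (z + a *: u) w))//.
  apply/funext => a; rewrite /= /DF /dirD; congr (xget _ _).
  apply/funext => l'; rewrite /mkset /gder; congr (cder _ _ _).
  by apply/funext => b; rewrite addrAC.
- have d0 : 0 < r - nv (w - z0) by rewrite subr_gt0.
  have [rho rho0 Hrho] := small_step u d0.
  have inb a : cmod a < rho -> pball z0 (r + s) (w + a *: u).
    move=> /Hrho ar; apply: sub1; rewrite /pball /=.
    by have := nvD (a *: u) (w - z0); rewrite addrA [_ + w]addrC; lra.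
  have [|||l Hl] := @dirD_param_hol _ n true (fun a z' => F z' (w + a *: u)) z v s rho M s0 rho0 v1.
  + by move=> a ar; exact: ghol_sub (sub2 _ zr) (hF _ (inb a ar)).
  + by move=> a z' ar z's; apply: bF; [exact: sub2 z's|exact: inb].
  + move=> z' z's a; rewrite subr0 => ar.
    have [l Hl] := cF z' (sub2 _ zr _ z's) _ (inb a ar) u.
    by exists l; move: Hl => /gder_line.
  by exists l.
Qed.

(** On the diagonal this is the derivative of [F z z] along the real direction [v]. It is kept as a
    function of two variables so that it can be differentiated again. *)
Definition TF v F : Cn -> Cn -> C := fun z w => DF v F z w + swapF (DF v (swapF F)) z w.

Lemma sesqui_TF z0 r s M v F : 0 < s -> nv v <= 1 ->
  sesqui (pball z0 (r + s)) M F -> sesqui (pball z0 r) (32 * M / s) (TF v F).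
Proof.
move=> s0 v1 H.
have [b1 h1 c1] := sesqui_DF s0 v1 H.
have [b2 h2 c2] := sesqui_swap (sesqui_DF s0 v1 (sesqui_swap H)).
split=> [z w zr wr|w wr|z zr].
- have -> : 32 * M / s = 16 * M / s + 16 * M / s by field; rewrite gt_eqF.
  by apply: le_trans (cmodD _ _) _; apply: lerD; [exact: b1|exact: b2].
- by apply: ghol_add; [exact: h1|exact: h2].
- rewrite (_ : (fun w => _) = (fun w => (DF v F z w)^*%C + (swapF (DF v (swapF F)) z w)^*%C)).
    by apply: ghol_add; [exact: c1|exact: c2].
  by apply/funext => w; rewrite /TF rmorphD.
Qed.

Lemma rder_diag z0 r M v F z : nv v <= 1 -> sesqui (pball z0 r) M F -> pball z0 r z ->
  rder (fun t : R => complex.Re (F (z + t%:C%C *: v) (z + t%:C%C *: v))) 0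
    (complex.Re (TF v F z z)).
Proof.
move=> v1 H zr.
have d0 : 0 < r - nv (z - z0) by rewrite subr_gt0.
pose s := (r - nv (z - z0)) / 4; have s0 : 0 < s by rewrite divr_gt0.
have r4 : r = (nv (z - z0) + 4 * s) by rewrite /s; field.
have sub2 z' : pball z s z' -> pball z' s `<=` pball z0 r.
  rewrite /pball /= => z's; apply: pball_tri.
  by have := nv_tri z' z z0; lra.
have sub1 z' : pball z s z' -> pball z0 r z' by move=> z's; apply: (sub2 _ z's); exact: pball_center.
have subz : pball z s `<=` pball z0 r by [].
have [bF hF cF] := H; have [bS hS cS] := sesqui_swap H.
have zz : pball z s z by exact: pball_center.
pose K := 2048 * M / s ^+ 2; pose L := 32 * (16 * M / s) / s.
have H2 : sesqui (pball z s) (16 * M / s) (DF v F).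
  apply: sesqui_DF => //; apply: sesqui_sub H.
  by apply: pball_tri; lra.
apply: (@rder_of_quadratic _ _ 0 _ (s / 4) (K + L + K)); first lra.
move=> t ts; rewrite add0r rmorph0 scale0r addr0.
set a := t%:C%C; have ca : cmod a = `|t| by rewrite cmod_real.
set z1 := z + a *: v.
have z1s : pball z s z1 by apply: pball_line => //; rewrite ca; lra.
have -> : complex.Re (F z1 z1) - complex.Re (F z z) - complex.Re (TF v F z z) * t =
  complex.Re (F z1 z1 - F z z - TF v F z z * a).
  by rewrite !ReB [TF v F z z * a]mulrC Re_Zr [t * _]mulrC.
apply: (le_trans (Re_le_cmod _)).
have T1 := @dirD_taylor _ n z s (fun z' => F z' z1) v a M s0
  (ghol_sub (sub2 z zz) (hF z1 (sub1 _ z1s))) v1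
  (fun w wb => bF w z1 (sub2 z zz w wb) (sub1 _ z1s)) ltac:(by rewrite ca).
have T3 := @dirD_taylor _ n z s (fun z' => swapF F z' z) v a M s0
  (ghol_sub (sub2 z zz) (hS z (sub1 _ zz))) v1
  (fun w wb => bS w z (sub2 z zz w wb) (sub1 _ zz)) ltac:(by rewrite ca).
have [b2 h2 c2] := H2.
have T2 := @dirD_lipschitz _ n z s (fun w => (DF v F z w)^*%C) v a (16 * M / s) s0
  (c2 z zz) v1 (fun w wb => ltac:(by rewrite cmodJ; exact: b2)) ltac:(rewrite ca; lra).
rewrite -/z1 in T1 T2 T3.
(* In order: the first variable moves while the second is [z1]; the derivative at [z1] is replaced
   by the one at [z]; the second variable moves. *)
have -> : F z1 z1 - F z z - TF v F z z * a =
    (F z1 z1 - F z z1 - DF v F z z1 * a) + ((DF v F z z1 - DF v F z z) * a) +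
    conjc (swapF F z1 z - swapF F z z - DF v (swapF F) z z * a) + 0.
  have aJ : (a^*)%C = a by rewrite conjc_real.
  by rewrite /TF /swapF !conjcB conjcM aJ !conjcK; ring.
rewrite !(mulrDl _ _ (`|t| ^+ 2)) -ca -[leRHS]addr0; apply: cmodD4.
- exact: T1.
- rewrite cmodM expr2 mulrA ler_wpM2r ?cmod_ge0//.
  by move: T2; rewrite -rmorphB cmodJ.
- by rewrite cmodJ; exact: T3.
- by rewrite cmod0.
Qed.

End SesquiHolomorphic.

(** * Compactness arguments in [C^n] *)

Section CompactUniform.
Variables (R : realType) (n : nat).
Local Notation C := R[i].
Local Notation Cn := 'rV[C]_n.

(** Besides uniformity in [j] this also yields bounds of single functions on [K]: there the index
    itself serves as the bound, as in [P j w := cmod (f w) <= j%:R]. *)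
Lemma compact_uniform (K : set Cn) (P : nat -> Cn -> Prop) : compact K ->
  (forall z, K z -> exists2 r : R, 0 < r & exists N, forall w j, pball z r w -> (N <= j)%N -> P j w) ->
  exists N, forall j, (N <= j)%N -> forall w, K w -> P j w.
Proof.
move=> /compact_near_coveringP cK H.
have [|N _ HN] := cK nat \oo%classic (fun j w => P j w) _.
  move=> z Kz; have [r r0 [N HN]] := H z Kz.
  exists (pball z r, [set j | (N <= j)%N]) => /=.
    split; first by apply/nbhs_nvP; exists r.
    by exists N.
  by move=> [w j] /= [wr Nj]; exact: HN.
by exists N => j /HN.
Qed.

Lemma continuous_real_complex : continuous (fun x : R => x%:C%C : C).
Proof.
move=> x; apply/cvgrPdist_lt => e /cgt0_real[-> e0].
near=> y; rewrite -rmorphB normcmod cmod_real ltcR; near: y.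
by apply: (@cvgr_dist_lt _ _ _ (nbhs x) _ id) => //; exact: cvg_id.
Unshelve. all: by end_near. Qed.

Lemma compact_disc (c : C) (r : R) : compact [set a : C | cmod (a - c) <= r].
Proof.
pose f (p : R * R) : C := p.1%:C%C + 'i%C * p.2%:C%C.
have fc : continuous f.
  move=> p; apply: cvgD.
    by apply: (cvg_comp _ _ cvg_fst); exact: continuous_real_complex.
  apply: cvgMr; by apply: (cvg_comp _ _ cvg_snd); exact: continuous_real_complex.
have Kc : compact (f @` (`[complex.Re c - r, complex.Re c + r]%classic
    `*` `[complex.Im c - r, complex.Im c + r]%classic)).
  apply: continuous_compact; first exact: continuous_subspaceT.
  by apply: compact_setX; exact: segment_compact.
apply: subclosed_compact Kc _; last first.
  move=> a /= ar; exists (complex.Re a, complex.Im a); last by rewrite /f -complexE.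
  have := le_trans (Re_le_cmod _) ar; have := le_trans (Im_le_cmod _) ar.
  by rewrite ReB ImB !ler_norml /= !in_itv /=; split; rewrite /=; lra.
rewrite -openC openE => a /= /negP; rewrite -ltNge => ar.
apply/(@nbhs_ballP C C a); exists (cmod (a - c) - r)%:C%C; first by rewrite /= ltcR subr_gt0.
move=> b; rewrite -ball_normE /= normcmod ltcR => ab; apply/negP; rewrite -ltNge.
have : cmod (a - c) <= cmod (a - b) + cmod (b - c).
  by apply: le_trans (cmodD _ _); rewrite addrA subrK.
lra.
Qed.

Definition cball (z : Cn) (r : R) : set Cn := [set w | nv (w - z) <= r].

Lemma compact_cball z r : 0 <= r -> compact (cball z r).
Proof.
move=> r0.
have -> : cball z r = [set v : Cn | forall i, [set a : C | cmod (a - z 0 i) <= r] (v ord0 i)].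
  apply/seteqP; split=> [w wr i|w wr] /=.
    by apply: le_trans wr; have := nv_coord (w - z) i; rewrite !mxE.
  by apply: nv_le => // j; rewrite !mxE; exact: wr.
by apply: (@rV_compact _ n (fun i => [set a : C | cmod (a - z 0 i) <= r])) => i; exact: compact_disc.
Qed.

Lemma differentiable_gder (f : Cn -> C) z v : differentiable f z -> exists l, gder f z v l.
Proof.
move=> /(@diff_derivable _ _ _ _ _ v)/derivable1P D.
exists ('D_1 (fun h : C => f (h *: v + z)) 0).
rewrite /gder (_ : (fun a => _) = (fun h : C => f (h *: v + z))).
  by apply/cderP; split.
by apply/funext => a; rewrite addrC.
Qed.

Lemma differentiable_locally_bounded (f : Cn -> C) z : differentiable f z ->
  exists2 r : R, 0 < r & forall w, pball z r w -> cmod (f w) <= cmod (f z) + 1.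
Proof.
move=> /differentiable_continuous cf.
have [r r0 H] : exists2 r : R, 0 < r & forall w, nv (w - z) < r -> `|f z - f w| < 1.
  by apply/nbhs_nvP; apply: (@cvgr_dist_lt _ _ _ (nbhs z) _ f) => //; rewrite ltr01.
exists r => // w /H; rewrite normcmod (_ : 1 = 1%:C%C) // ltcR => h.
by have := cmodBD (f w) (f z); rewrite cmodB; lra.
Qed.

End CompactUniform.

(** * Lower bounds for iterated integrals *)

Section IteratedIntegral.
Variable R : realType.

(** The integral of a nonnegative function is a supremum over the simple functions below it, and
    this set grows with the function, measurable or not. *)
Lemma ge0_le_integral_nonmeasurable d (T : measurableType d)
    (mu : {measure set T -> \bar R}) (D : set T) (f g : T -> \bar R) :
  (forall x, D x -> 0 <= f x)%E -> (forall x, D x -> f x <= g x)%E ->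
  (\int[mu]_(x in D) f x <= \int[mu]_(x in D) g x)%E.
Proof.
move=> f0 fg.
have g0 x : D x -> (0 <= g x)%E by move=> Dx; exact: le_trans (f0 x Dx) (fg x Dx).
rewrite !ge0_integralE//; apply: ereal_sup_le => _ [h hf <-].
exists h => // x; apply: (le_trans (hf x)).
rewrite /patch; case: ifPn => // xD; apply: fg; exact: set_mem.
Qed.

Local Notation upd k x v := (fun i : nat => if i == k then x else v i).

Lemma iint_ge0 k (F : (nat -> R) -> \bar R) : (forall v, 0 <= F v)%E -> (0 <= iint k F)%E.
Proof.
by elim: k F => [|k IH] F F0 //=; apply: integral_ge0 => x _; exact: IH.
Qed.

(** Induction on the outermost coordinate, whose partial integral dominates a constant on an
    interval of length [2 * rho]. *)
Lemma iint_box (k : nat) (F : (nat -> R) -> \bar R) (a : nat -> R) (rho c : R) :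
  0 <= c -> 0 <= rho -> (forall v, 0 <= F v)%E ->
  (forall v, (forall i, (i < k)%N -> `|v i - a i| <= rho) -> (c%:E <= F v)%E) ->
  ((c * (2 * rho) ^+ k)%:E <= iint k F)%E.
Proof.
move=> c0 rho0; elim: k F => [|k IH] F F0 H.
  by rewrite expr0 mulr1 /=; exact: H.
have p0 : 0 <= c * (2 * rho) ^+ k by rewrite mulr_ge0// exprn_ge0// mulr_ge0.
pose I : set (measurableTypeR R) := `[a k - rho, a k + rho]%classic.
have mI : measurable I by exact: measurable_itv.
apply: (@le_trans _ _ (\int[@lebesgue_measure R]_x ((fun=> (c * (2 * rho) ^+ k)%:E) \_ I) x)%E).
  rewrite -integral_mkcond.
  have -> : (\int[@lebesgue_measure R]_(x in I) (c * (2 * rho) ^+ k)%:E =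
      (c * (2 * rho) ^+ k)%:E * @lebesgue_measure R I)%E := integral_cst _ mI _.
  rewrite /I lebesgue_measure_itv /=.
  rewrite lte_fin; case: ifPn => [_|h].
    by rewrite -EFinB -EFinM lee_fin exprSr (_ : a k + rho - (a k - rho) = 2 * rho) ?mulrA//; ring.
  have -> : rho = 0 by apply/eqP; rewrite eq_le rho0 andbT; move: h; rewrite -leNgt; lra.
  by rewrite mule0 mulr0 exprS mul0r mulr0.
apply: ge0_le_integral_nonmeasurable => x _.
  by rewrite /patch; case: ifP.
rewrite /patch; case: ifPn => [xI|_]; last by apply: iint_ge0.
apply: IH => // v hv; apply: H => i; rewrite ltnS leq_eqVlt => /predU1P[->|ik].
  rewrite eqxx; move/set_mem: xI; rewrite /I /= in_itv /= ler_norml; lra.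
by rewrite ltn_eqF//; exact: hv.
Qed.

End IteratedIntegral.

(** * The sub-mean value inequality for square-integrable holomorphic functions *)

Section SubMeanValue.
Variables (R : realType) (n : nat).
Local Notation C := R[i].
Local Notation Cn := 'rV[C]_n.

(** The base is the relative side [kap] of the box in [l2_sub_mean_value]. The 16 is the square of
    4: one factor 2 from halving the modulus on the box, one from the near maximum. *)
Definition l2const : R := (1 / (128 * 2 ^+ n.+1)) ^+ (2 * n) / 16.

Lemma l2const_gt0 : 0 < l2const.
Proof. by rewrite divr_gt0// exprn_gt0// divr_gt0// mulr_gt0// exprn_gt0. Qed.

Lemma lipschitz_ball (f : Cn -> C) z (s M : R) w : 0 < s -> ghol (pball z s) f ->
  (forall w, pball z s w -> cmod (f w) <= M) -> nv w < s / 2 ->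
  cmod (f (z + w) - f z) <= 32 * M / s * nv w.
Proof.
move=> s0 hf bnd ws.
have [w0|wn0] := eqVneq w 0.
  by rewrite w0 addr0 subrr cmod0 nv0 mulr0.
have nw : 0 < nv w by rewrite lt_def nv_eq0 wn0 nv_ge0.
pose v : Cn := (nv w)^-1%:C%C *: w.
have v1 : nv v = 1 by rewrite nvZ cmod_real ger0_norm ?invr_ge0 ?nv_ge0// mulVf// gt_eqF.
have -> : w = (nv w)%:C%C *: v by rewrite scalerA -rmorphM divff ?gt_eqF// rmorph1 scale1r.
rewrite [nv (_ *: _)]nvZ v1 mulr1; apply: (@dirD_lipschitz _ _ z s f v) => //; rewrite ?v1//.
by rewrite cmod_real ger0_norm ?nv_ge0.
Qed.

(** The weight vanishes at the boundary, so that halfway from [w] to the boundary [cmod f] is at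
    most [2 ^+ n.+1] times its value at [w]. The exponent [n] makes the squared weight scale like
    the volume of a box in real dimension [2 * n]. *)
Lemma near_maximum (f : Cn -> C) z (r B : R) : 0 < r -> f z != 0 ->
  (forall w, pball z r w -> cmod (f w) <= B) ->
  exists2 w, pball z r w & 0 < cmod (f w) /\ forall w', pball z r w' ->
    cmod (f w') * (r - nv (w' - z)) ^+ n <= 2 * (cmod (f w) * (r - nv (w - z)) ^+ n).
Proof.
move=> r0 fz bnd.
pose V w := cmod (f w) * (r - nv (w - z)) ^+ n.
pose S := [set V w | w in pball z r].
have SV : S (V z) by exists z => //; exact: pball_center.
have Vz : 0 < V z.
  by rewrite /V mulr_gt0 ?cmod_gt0// exprn_gt0// subrr nv0 subr0.
have ubS : has_ubound S.
  exists (B * r ^+ n) => _ [w wr <-]; rewrite /V ler_pM ?cmod_ge0 ?exprn_ge0 ?bnd ?subr_ge0//.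
    exact: ltW.
  by apply: lerXn2r; rewrite ?nnegrE ?subr_ge0 ?(ltW wr) ?(ltW r0)// lerBlDr lerDl nv_ge0.
have supS : has_sup S by split => //; exists (V z).
have s0 : 0 < sup S by apply: lt_le_trans Vz _; exact: ub_le_sup.
have [_ [w wr <-] Hw] := @sup_adherent _ S (sup S / 2) ltac:(by rewrite divr_gt0) supS.
exists w => //.
have VS : sup S < 2 * V w by lra.
split.
  rewrite lt_def cmod_ge0 andbT; apply/eqP => f0.
  by move: VS; rewrite /V f0 mul0r mulr0; lra.
move=> w' w'r; rewrite -/(V w') -/(V w); apply: le_trans (ltW VS).
by apply: ub_le_sup => //; exists w'.
Qed.

Lemma cpt_box (z : Cn) : exists a : nat -> R, forall v (rho : R), 0 <= rho ->
  (forall i, (i < 2 * n)%N -> `|v i - a i| <= rho) -> nv (cpt n v - z) <= 2 * rho.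
Proof.
exists (fun i => if insub i./2 is Some j then
   (if odd i then complex.Im (z 0 j) else complex.Re (z 0 j)) else 0).
move=> v rho rho0 H; apply: nv_le => [|j]; first by rewrite mulr_ge0.
have j1 : (2 * j < 2 * n)%N by rewrite ltn_pmul2l.
have j2 : ((2 * j).+1 < 2 * n)%N.
  by have := ltn_ord j; rewrite !mul2n -doubleS leq_double.
have := H _ j1; have := H _ j2; rewrite mul2n /= odd_double uphalf_double doubleK /=.
rewrite valK => h1 h2; apply: (le_trans (cmod_le_ReIm _)).
rewrite !mxE ReB ImB /= mul2n; lra.
Qed.

(** Around the near maximum [w] the modulus stays above [cmod (f w) / 2] on a box whose side is a
    fixed fraction of the distance of [w] to the boundary. The weights then transfer the resulting
    bound from [w] to the centre [z]. *)
Lemma l2_sub_mean_value (O : set Cn) (f : Cn -> C) z (r I : R) :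
  holomorphic O f -> 0 < r -> cball z r `<=` O ->
  intC O (fun w => (complex.Re (f w * (f w)^*%C))%:E) = I%:E ->
  cmod (f z) ^+ 2 * (l2const * r ^+ (2 * n)) <= I.
Proof.
move=> hf r0 rO EI.
have I0 : 0 <= I.
  rewrite -lee_fin -EI; apply: iint_ge0 => v; case: ifP => // _.
  by rewrite lee_fin Re_mulJ exprn_ge0// cmod_ge0.
have [fz|fz] := eqVneq (f z) 0.
  by rewrite fz cmod0 expr0n mul0r.
have gO : ghol O f by move=> w /hf d v; exact: differentiable_gder.
have [N HN] : exists N, forall j, (N <= j)%N -> forall w, cball z r w -> cmod (f w) <= j%:R.
  apply: compact_uniform; first exact: compact_cball (ltW r0).
  move=> w /rO/hf/differentiable_locally_bounded[s s0 Hs]; exists s => //.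
  have [N HN] : exists N : nat, cmod (f w) + 1 <= N%:R.
    by exists (Num.bound (cmod (f w) + 1)); apply/ltW/archi_boundP; rewrite addr_ge0 ?cmod_ge0.
  exists N => w' j /Hs h Nj; apply: (le_trans h); apply: (le_trans HN); by rewrite ler_nat.
have pc : pball z r `<=` cball z r by move=> w /ltW.
have [w wr [fw Hw]] := @near_maximum f z r N%:R r0 fz (fun w h => HN N (leqnn N) w (pc w h)).
pose s := (r - nv (w - z)) / 2.
have s0 : 0 < s by rewrite divr_gt0// subr_gt0.
have sub : pball w s `<=` pball z r by apply: pball_tri; rewrite /s; move: wr; rewrite /pball /=; lra.
pose M := 2 ^+ n.+1 * cmod (f w).
have M0 : 0 <= M by rewrite mulr_ge0 ?exprn_ge0 ?cmod_ge0.
have bM w' : pball w s w' -> cmod (f w') <= M.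
  move=> w's; have := Hw w' (sub _ w's).
  have -> : r - nv (w - z) = 2 * s by rewrite /s; field.
  have : s <= r - nv (w' - z).
    have := nv_tri w' w z; move: w's; rewrite /pball /= /s; lra.
  move=> h1 h2; have : cmod (f w') * s ^+ n <= 2 * (cmod (f w) * (2 * s) ^+ n).
    apply: le_trans h2; rewrite ler_wpM2l ?cmod_ge0// lerXn2r ?nnegrE ?(ltW s0)//.
    exact: le_trans (ltW s0) h1.
  have -> : 2 * (cmod (f w) * (2 * s) ^+ n) = M * s ^+ n.
    by rewrite /M exprMn exprS; ring.
  by rewrite ler_pM2r// exprn_gt0.
(* Chosen so that the Lipschitz bound [32 * M / s] over a distance [2 * s * kap] equals
   [cmod (f w) / 2]. *)
pose kap : R := 1 / (128 * 2 ^+ n.+1).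
have p2 : 1 <= (2 : R) ^+ n.+1 by rewrite exprn_ege1// ler1n.
have kap0 : 0 < kap by rewrite divr_gt0// mulr_gt0// exprn_gt0.
have kap1 : kap <= 1 / 128.
  by rewrite /kap !div1r lef_pV2 ?posrE ?mulr_gt0 ?exprn_gt0//; lra.
have low w' : nv (w' - w) <= 2 * s * kap -> cmod (f w) / 2 <= cmod (f w').
  move=> h; have hs : nv (w' - w) < s / 2 by nra.
  have := lipschitz_ball s0 (ghol_sub (subset_trans sub (subset_trans pc rO)) gO) bM hs.
  rewrite (addrC w) subrK => K.
  have : 32 * M / s * nv (w' - w) <= 32 * M / s * (2 * s * kap).
    apply: ler_wpM2l => //; apply: divr_ge0 (ltW s0); exact: mulr_ge0.
  have -> : 32 * M / s * (2 * s * kap) = cmod (f w) / 2.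
    by rewrite /M /kap; field; rewrite gt_eqF //= gt_eqF ?exprn_gt0.
  by have := cmodBD (f w) (f w'); rewrite cmodB; lra.
have [a Ha] := cpt_box w.
pose rho := s * kap; have rho0 : 0 < rho by rewrite mulr_gt0.
have := @iint_box R (2 * n) (fun v => if cpt n v \in O then
   (complex.Re (f (cpt n v) * (f (cpt n v))^*%C))%:E else 0%E) a rho ((cmod (f w) / 2) ^+ 2).
rewrite -/(intC O (fun w => (complex.Re (f w * (f w)^*%C))%:E)) EI lee_fin.
move=> K; apply: le_trans (K _ _ _ _); first last.
- move=> v hv; have cw := Ha v rho (ltW rho0) hv.
  have bw : pball w s (cpt n v).
    by rewrite /pball /=; apply: le_lt_trans cw _; rewrite /rho; nra.
  rewrite mem_set; last by apply: rO; apply: pc; exact: sub.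
  rewrite lee_fin Re_mulJ lerXn2r ?nnegrE ?cmod_ge0 ?divr_ge0 ?cmod_ge0//.
  by apply: low; apply: le_trans cw _; rewrite /rho mulrA.
- by move=> v; case: ifP => // _; rewrite lee_fin Re_mulJ exprn_ge0// cmod_ge0.
- exact: ltW.
- by rewrite exprn_ge0// divr_ge0 ?cmod_ge0.
have := Hw z (pball_center z r0); rewrite subrr nv0 subr0 => H.
have -> : cmod (f z) ^+ 2 * (l2const * r ^+ (2 * n)) =
    (cmod (f z) * r ^+ n) ^+ 2 * (kap ^+ (2 * n) / 16).
  by rewrite /l2const -/kap (mulnC 2) !exprM exprMn; ring.
have -> : (cmod (f w) / 2) ^+ 2 * (2 * rho) ^+ (2 * n) =
    (2 * (cmod (f w) * (r - nv (w - z)) ^+ n)) ^+ 2 * (kap ^+ (2 * n) / 16).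
  have -> : r - nv (w - z) = 2 * s by rewrite /s; field.
  by rewrite /rho (mulnC 2) !exprM !exprMn; field.
rewrite ler_wpM2r ?divr_ge0 ?exprn_ge0 ?(ltW kap0)//.
by apply: lerXn2r H; rewrite nnegrE ?mulr_ge0 ?cmod_ge0 ?exprn_ge0 ?subr_ge0 ?(ltW wr) ?(ltW r0).
Qed.

End SubMeanValue.

(** * Real functions with bounded iterated directional derivatives *)

Section SmoothDirectional.
Variables (R : realType) (n : nat).
Local Notation C := R[i].
Local Notation Cn := 'rV[C]_n.
Implicit Types (v w z u : Cn) (Phi Psi : Cn -> R) (A : set Cn) (B M : R).

(** One constant bounds all orders up to [k]. The [rder] clause is what makes [rD] meaningful, since
    [derive1] is total. *)
Fixpoint Sm k A B Phi : Prop := (forall z, A z -> `|Phi z| <= B) /\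
  if k is k'.+1 then forall v, nv v <= 1 ->
    (forall z, A z -> rder (fun t : R => Phi (z + t%:C%C *: v)) 0 (rD Phi v z)) /\
    Sm k' A B (rD Phi v)
  else True.

Lemma rder_rD Phi v z l : rder (fun t : R => Phi (z + t%:C%C *: v)) 0 l -> rD Phi v z = l.
Proof. by move=> /rderP[_ <-]; rewrite /rD derive1E. Qed.

Lemma rder_local (f g : R -> R) x l (d : R) : 0 < d ->
  (forall t, `|t - x| < d -> f t = g t) -> rder f x l -> rder g x l.
Proof.
move=> d0 E H e e0; have [d1 d10 Hd] := H e e0.
exists (Num.min d d1); first by rewrite lt_min d0.
move=> h; rewrite lt_min => /andP[hd /Hd].
by rewrite (E (x + h)) ?(E x) ?subrr ?normr0// addrC addKr.
Qed.

Lemma open_line A z v : open A -> A z -> exists2 d : R, 0 < d & forall a : C, cmod a < d -> A (z + a *: v).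
Proof.
move=> oA Az; have [r r0 H] := open_nv oA Az; have [d d0 Hd] := small_step v r0.
by exists d => // a /Hd h; apply: H; rewrite addrC addKr.
Qed.

Lemma rder_line_local A Phi Psi v z l : open A -> A z -> (forall w, A w -> Phi w = Psi w) ->
  rder (fun t : R => Phi (z + t%:C%C *: v)) 0 l -> rder (fun t : R => Psi (z + t%:C%C *: v)) 0 l.
Proof.
move=> oA Az E; have [d d0 Hd] := open_line v oA Az.
apply: (rder_local d0) => t; rewrite subr0 => td; apply: E; apply: Hd.
by rewrite cmod_real.
Qed.

Lemma Sm_ext k A B Phi Psi : open A -> (forall z, A z -> Phi z = Psi z) ->
  Sm k A B Phi -> Sm k A B Psi.
Proof.
move=> oA; elim: k Phi Psi => [|k IH] Phi Psi E /= [b H]; split => //.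
- by move=> z Az; rewrite -E// b.
- by move=> z Az; rewrite -E// b.
move=> v v1; have [D S] := H v v1.
have E' z : A z -> rD Phi v z = rD Psi v z.
  by move=> Az; apply/esym/rder_rD; apply: (rder_line_local oA Az E); exact: D.
split; last exact: IH E' S.
by move=> z Az; rewrite -E'//; apply: (rder_line_local oA Az E); exact: D.
Qed.

Lemma Sm_le k A B B' Phi : B <= B' -> Sm k A B Phi -> Sm k A B' Phi.
Proof.
move=> BB; elim: k Phi => [|k IH] Phi /= [b H]; split => //.
- by move=> z /b h; exact: le_trans BB.
- by move=> z /b h; exact: le_trans BB.
by move=> v /H[D S]; split => //; exact: IH.
Qed.

(** Each derivative is again the diagonal of a sesquiholomorphic function, [TF v F], and costs [s]
    of the radius and a factor [32 / s]. The added 1 keeps the lower orders under the same bound. *)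
Lemma Sm_diag k z0 (r s M : R) (F : Cn -> Cn -> C) : 0 < s -> 0 <= M ->
  sesqui (pball z0 (r + k%:R * s)) M F ->
  Sm k (pball z0 r) (M * (1 + 32 / s) ^+ k) (fun z => complex.Re (F z z)).
Proof.
move=> s0; have s1 : 0 <= 32 / s by rewrite divr_ge0// ltW.
elim: k F M => [|k IH] F M M0 H /=.
  split => // z zr; rewrite expr0 mulr1; apply: le_trans (Re_le_cmod _) _.
  by case: H => b _ _; apply: b; rewrite mul0r addr0.
have sub : pball z0 r `<=` pball z0 (r + k.+1%:R * s).
  by apply: pball_sub; rewrite lerDl mulr_ge0// ltW.
have p1 : 1 <= (1 + 32 / s) ^+ k.+1 by rewrite exprn_ege1// lerDl.
split.
  move=> z /sub zr; apply: le_trans (Re_le_cmod _) _.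
  case: H => b _ _; apply: le_trans (b z z zr zr) _.
  by rewrite ler_peMr.
move=> v v1.
have D z : pball z0 r z -> rder (fun t : R => complex.Re (F (z + t%:C%C *: v) (z + t%:C%C *: v))) 0
    (complex.Re (TF v F z z)).
  by move=> /sub zr; exact: rder_diag H zr.
have E z : pball z0 r z -> complex.Re (TF v F z z) = rD (fun z => complex.Re (F z z)) v z.
  by move=> zr; apply/esym/rder_rD/D.
split; first by move=> z zr; rewrite -E//; exact: D.
refine (Sm_ext (@open_pball _ _ _ _) E _).
apply: (@Sm_le k _ (32 * M / s * (1 + 32 / s) ^+ k)).
  rewrite exprS mulrA ler_wpM2r ?exprn_ge0 ?addr_ge0// mulrDr mulr1 -mulrA [_ * (M / s)]mulrC.
  by rewrite mulrAC mulrA lerDr.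
apply: (IH (TF v F)); first by rewrite divr_ge0 ?mulr_ge0// ltW.
apply: sesqui_TF => //; apply: sesqui_sub H.
by apply: pball_sub; rewrite -addrA lerD2l -natr1 mulrDl mul1r.
Qed.

End SmoothDirectional.

(** * Bounds for the Bergman kernel independent of the domain *)

Section KernelBounds.
Variables (R : realType) (n : nat).
Local Notation C := R[i].
Local Notation Cn := 'rV[C]_n.
Implicit Types (v w z u : Cn) (O : set Cn).

Lemma iint0 k : @iint R k (fun=> 0%E) = 0%E.
Proof.
elim: k => [//|k IH] /=; rewrite (_ : (fun x => _) = cst 0%E) ?integral0//.
by apply/funext => x; exact: IH.
Qed.

(** Without a reproducing kernel the definition returns [0], so positivity at one point forces
    existence. *)
Lemma bergman_kernel_exists O z : 0 < bergman_kernel O z z ->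
  is_bergman_kernel O (bergman_kernel O).
Proof.
rewrite /bergman_kernel; case: pselect => [H _|_]; last by rewrite ltxx.
by case: cid.
Qed.

Lemma rintCN O (h : Cn -> R) : rintC O (fun z => - h z) = - rintC O h.
Proof.
rewrite /rintC opprB; congr (fine _ - _); congr (fine _).
by congr (intC _ _); apply/funext => z; rewrite opprK.
Qed.

Lemma l2inner_conj O (f g : Cn -> C) : l2inner O f g = conjc (l2inner O g f).
Proof.
rewrite /l2inner /=; congr (_ +i* _)%C.
  congr rintC; apply/funext => z; case: (f z) (g z) => a b [c d] /=; ring.
rewrite -rintCN; congr rintC; apply/funext => z; case: (f z) (g z) => a b [c d] /=; ring.
Qed.

Section Kernel.
Variables (O : set Cn) (k : Cn -> Cn -> C).
Hypotheses (oO : open O) (bk : is_bergman_kernel O k).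

Lemma kernel_herm z w : O z -> O w -> k z w = conjc (k w z).
Proof.
move=> Oz Ow; have [Az Hz] := bk Oz; have [Aw Hw] := bk Ow.
by rewrite (Hz _ Aw) (Hw _ Az) l2inner_conj.
Qed.

(** The reproducing property applied to the kernel function itself; finiteness of its norm lets
    [fine] be undone. *)
Lemma kernel_l2 w : O w ->
  intC O (fun z => (complex.Re (k z w * (k z w)^*%C))%:E) = (complex.Re (k w w))%:E.
Proof.
move=> Ow; have [Aw Hw] := bk Ow; have [_ fin] := Aw.
have h0 z : 0 <= complex.Re (k z w * (k z w)^*%C) by rewrite Re_mulJ exprn_ge0// cmod_ge0.
rewrite [X in complex.Re X](Hw _ Aw) /l2inner /rintC /=.
have -> : intC O (fun z => (Num.max (- complex.Re (k z w * (k z w)^*%C)) 0)%:E) = 0%E.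
  rewrite /intC -[RHS](iint0 (2 * n)); congr iint; apply/funext => v.
  by case: ifP => // _; rewrite max_r// oppr_le0.
have -> : (fun z => (Num.max (complex.Re (k z w * (k z w)^*%C)) 0)%:E) =
    (fun z => (complex.Re (k z w * (k z w)^*%C))%:E).
  by apply/funext => z; rewrite max_l.
rewrite subr0 fineK// ge0_fin_numE// /intC; apply: iint_ge0 => v.
by case: ifP => // _; rewrite lee_fin.
Qed.

Definition kbound (r : R) : R := 1 / (l2const R n * r ^+ (2 * n)).

Lemma kbound_gt0 r : 0 < r -> 0 < kbound r.
Proof. by move=> r0; rewrite divr_gt0// mulr_gt0 ?l2const_gt0// exprn_gt0. Qed.

Lemma kernel_sub_mean z w r : 0 < r -> cball z r `<=` O -> O w ->
  cmod (k z w) ^+ 2 <= kbound r * complex.Re (k w w).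
Proof.
move=> r0 sub Ow; have [[hw _] _] := bk Ow.
have := l2_sub_mean_value hw r0 sub (kernel_l2 Ow).
by rewrite -ler_pdivlMr ?mulr_gt0 ?l2const_gt0 ?exprn_gt0// mulrC /kbound div1r.
Qed.

(** On the diagonal the sub-mean value inequality bounds the square of [cmod (k w w)] by [kbound r]
    times itself. The constant depends on [r] and [n] alone, hence serves all domains of the
    sequence. *)
Lemma kernel_bound z w r : 0 < r -> cball z r `<=` O -> cball w r `<=` O ->
  cmod (k z w) <= kbound r.
Proof.
move=> r0 sz sw; have k0 := kbound_gt0 r0.
have Ow : O w by apply: sw; rewrite /cball /= subrr nv0 ltW.
have ww : cmod (k w w) <= kbound r.
  have [c0|/le_trans] := ltP 0 (cmod (k w w)); last by apply; exact: ltW.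
  rewrite -(ler_pM2r c0) -expr2; apply: le_trans (kernel_sub_mean r0 sw Ow) _.
  by rewrite ler_pM2l//; apply: le_trans (Re_le_cmod _); exact: ler_norm.
rewrite -(@ler_pXn2r _ 2) ?nnegrE ?cmod_ge0 ?(ltW k0)//.
apply: le_trans (kernel_sub_mean r0 sz Ow) _; rewrite expr2 ler_pM2l//.
by apply: le_trans ww; apply: le_trans (Re_le_cmod _); exact: ler_norm.
Qed.

Lemma cder_local (f g : C -> C) (c l : C) (d : R) : 0 < d ->
  (forall a, cmod (a - c) < d -> f a = g a) -> cder f c l -> cder g c l.
Proof.
move=> d0 E H e e0; have [d1 d10 Hd] := H e e0.
exists (Num.min d d1); first by rewrite lt_min d0.
move=> h; rewrite lt_min => /andP[hd /Hd].
by rewrite (E (c + h)) ?(E c) ?subrr ?cmod0// addrC addKr.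
Qed.

Lemma sesqui_kernel z0 r : 0 < r -> cball z0 (2 * r) `<=` O ->
  sesqui (pball z0 r) (kbound r) k.
Proof.
move=> r0 sub.
have sz z : pball z0 r z -> cball z r `<=` O.
  move=> zr w wr; apply: sub; rewrite /cball /=.
  by have := nv_tri w z z0; move: zr wr; rewrite /pball /cball /=; lra.
have Oz z : pball z0 r z -> O z.
  by move=> /sz; apply; rewrite /cball /= subrr nv0 ltW.
split=> [z w zr wr|w wr z zr v|z zr w wr v].
- by apply: kernel_bound => //; exact: sz.
- by have [[hw _] _] := bk (Oz w wr); apply: differentiable_gder; apply: hw; exact: Oz.
- have [[hz _] _] := bk (Oz z zr).
  have [l Hl] := differentiable_gder v (hz w (Oz w wr)).
  exists l; have [d d0 Hd] := open_line v oO (Oz w wr).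
  apply: cder_local d0 _ Hl => a; rewrite subr0 => /Hd Oa.
  by rewrite /= [k (w + _) z]kernel_herm//; exact: Oz.
Qed.

(** Three derivatives with loss [r] each start from radius [4 * r], and bounding the kernel there
    requires twice that radius. *)
Lemma Sm_kernel z0 r : 0 < r -> cball z0 (8 * r) `<=` O ->
  Sm 3 (pball z0 r) (kbound (4 * r) * (1 + 32 / r) ^+ 3) (fun z => complex.Re (k z z)).
Proof.
move=> r0 sub; have r4 : 0 < 4 * r by rewrite mulr_gt0.
apply: Sm_diag => //; first exact: ltW (kbound_gt0 r4).
have -> : r + 3%:R * r = 4 * r by ring.
apply: sesqui_kernel => //; by rewrite mulrA (_ : 2 * 4 = 8)//; ring.
Qed.

End Kernel.
End KernelBounds.

(** * Convergence of the second derivatives of a logarithm *)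

Section LogDerivatives.
Variables (R : realType) (n : nat).
Local Notation C := R[i].
Local Notation Cn := 'rV[C]_n.
Implicit Types (v w z u : Cn) (Phi Psi : Cn -> R) (A : set Cn) (B M : R).

Lemma rderM (f g : R -> R) x l k : rder f x l -> rder g x k ->
  rder (fun t => f t * g t) x (f x * k + g x * l).
Proof. by move=> /rderP H1 /rderP H2; apply/rderP; exact: is_deriveM. Qed.

Lemma rderV (f : R -> R) x l : f x != 0 -> rder f x l ->
  rder (fun t => (f t)^-1) x (- (f x) ^- 2 * l).
Proof. by move=> f0 /rderP[d <-]; apply/rderP; split; [exact: derivableV|exact: deriveV]. Qed.

Lemma rder_ln (f : R -> R) x l : 0 < f x -> rder f x l -> rder (fun t => ln (f t)) x (l / f x).
Proof.
move=> f0 /rderP Hf; apply/rderP.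
have := @is_derive1_comp R (@ln R) f x (f x)^-1 l (is_derive1_ln f0) Hf.
by rewrite mulrC.
Qed.

Section OnOpen.
Variables (A : set Cn) (B : R) (Phi : Cn -> R).
Hypotheses (oA : open A) (Phi_gt0 : forall z, A z -> 0 < Phi z).

Lemma rD_ln k v z : Sm k.+1 A B Phi -> nv v <= 1 -> A z ->
  rD (fun z => ln (Phi z)) v z = rD Phi v z / Phi z.
Proof.
move=> /= [_ H] v1 Az; have [D _] := H v v1; apply: rder_rD.
have := @rder_ln _ _ _ _ (D z Az).
by rewrite rmorph0 scale0r addr0; apply; exact: Phi_gt0.
Qed.

Lemma rD_rD_ln k u v z : Sm k.+2 A B Phi -> nv u <= 1 -> nv v <= 1 -> A z ->
  rD (rD (fun z => ln (Phi z)) v) u z =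
  rD (rD Phi v) u z / Phi z - rD Phi v z * rD Phi u z / (Phi z * Phi z).
Proof.
move=> S u1 v1 Az; have [_ H] := S.
have [Du _] := H u u1; have [_ [_ Hv]] := H v v1; have [Dvu _] := Hv u u1.
apply: rder_rD.
have E w : A w -> rD Phi v w * (Phi w)^-1 = rD (fun z => ln (Phi z)) v w.
  by move=> Aw; rewrite (rD_ln S v1 Aw).
apply: (rder_line_local oA Az E).
have P0 : Phi z != 0 by rewrite gt_eqF// Phi_gt0.
have K := rderV _ (Du z Az).
have := rderM (Dvu z Az) (K _); rewrite rmorph0 scale0r addr0 => /(_ P0).
set l := (X in rder _ _ X); set l' := (X in _ -> rder _ _ X).
suff -> : l = l' by [].
by rewrite /l /l'; field.
Qed.

End OnOpen.

Lemma rder_line_shift (f : Cn -> R) z v (s l : R) :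
  rder (fun t : R => f (z + s%:C%C *: v + t%:C%C *: v)) 0 l ->
  rder (fun t : R => f (z + t%:C%C *: v)) s l.
Proof.
have E (h : R) : z + s%:C%C *: v + h%:C%C *: v = z + (s + h)%:C%C *: v.
  by rewrite rmorphD scalerDl addrA.
move=> K e e0; have [d d0 Hd] := K e e0; exists d => // h /Hd.
by rewrite add0r rmorph0 scale0r addr0 E.
Qed.

Lemma rtaylor A B Phi z v (t : R) : Sm 2 A B Phi -> nv v <= 1 -> 0 <= t ->
  (forall s : R, 0 <= s <= t -> A (z + s%:C%C *: v)) ->
  `|Phi (z + t%:C%C *: v) - Phi z - t * rD Phi v z| <= B * t ^+ 2.
Proof.
move=> [_ H] v1 t0 inA; have [D [_ H2]] := H v v1; have [D2 [b2 _]] := H2 v v1.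
have L s : 0 <= s <= t -> `|rD Phi v (z + s%:C%C *: v) - rD Phi v z| <= B * t.
  move=> /andP[s0 st].
  have := @mean_value_bound R (fun x => rD Phi v (z + x%:C%C *: v)) 0 s B s0.
  rewrite rmorph0 scale0r addr0 subr0 => K.
  have : `|rD Phi v (z + s%:C%C *: v) - rD Phi v z| <= B * s.
    apply: K => x /andP[x0 xs].
    have Ax : A (z + x%:C%C *: v) by apply: inA; rewrite x0 (le_trans xs).
    by exists (rD (rD Phi v) v (z + x%:C%C *: v)); [apply: rder_line_shift; exact: D2|exact: b2].
  move=> h; apply: (le_trans h); rewrite ler_wpM2l//.
  have Az : A z by have := inA 0; rewrite rmorph0 scale0r addr0; apply; rewrite lexx.
  by apply: le_trans (b2 z Az); exact: normr_ge0.
have := @mean_value_bound R (fun x => Phi (z + x%:C%C *: v) - x * rD Phi v z) 0 t (B * t) t0.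
rewrite rmorph0 scale0r addr0 subr0 mul0r subr0 => K.
have -> : Phi (z + t%:C%C *: v) - Phi z - t * rD Phi v z =
  Phi (z + t%:C%C *: v) - t * rD Phi v z - Phi z by ring.
rewrite expr2 mulrA; apply: K => s st.
exists (rD Phi v (z + s%:C%C *: v) - rD Phi v z); last exact: L.
have {}K := rder_line_shift (D _ (inA s st)); move=> e e0.
have [d d0 Hd] := K e e0; exists d => // h /Hd; congr (`| _ | <= _); ring.
Qed.

(** By [rtaylor] the difference quotient with step [t] approximates the derivative up to [B * t],
    uniformly in [j]. So [t] is fixed first, and convergence at the two points [z] and [z + t v]
    suffices. *)
Lemma cvg_rD A B (Phi : nat -> Cn -> R) Psi (N : nat) z v : open A -> A z -> nv v <= 1 ->
  (forall j, (N <= j)%N -> Sm 2 A B (Phi j)) -> Sm 2 A B Psi ->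
  (forall w, A w -> (fun j => Phi j w) @ \oo --> Psi w) ->
  (fun j => rD (Phi j) v z) @ \oo --> rD Psi v z.
Proof.
move=> oA Az v1 S S' cvg; apply/cvgrPdist_le => e e0.
have [d d0 Hd] := open_line v oA Az.
have B1 : 0 < `|B| + 1 by rewrite ltr_wpDl.
(* Two Taylor remainders and two differences of values each get the share [t * (e / 4)]. *)
pose t := Num.min (d / 2) (e / 4 / (`|B| + 1)).
have t0 : 0 < t by rewrite lt_min !divr_gt0.
have td : t < d by rewrite gt_min; apply/orP; left; lra.
have tB : t * (`|B| + 1) <= e / 4 by rewrite -ler_pdivlMr// ge_min lexx orbT.
have inA s : 0 <= s <= t -> A (z + s%:C%C *: v).
  by move=> /andP[s0 st]; apply: Hd; rewrite cmod_real ger0_norm// (le_lt_trans st).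
have te : 0 < t * (e / 4) by rewrite mulr_gt0// divr_gt0.
have c1 := cvg _ (inA t ltac:(by rewrite lexx ltW)).
have c2 := cvg _ Az.
move/cvgrPdist_le : c1 => /(_ _ te) c1; move/cvgrPdist_le : c2 => /(_ _ te) c2.
near=> j.
have T' := rtaylor S' v1 (ltW t0) inA.
have T := @rtaylor _ _ _ z v t (S j _) v1 (ltW t0) inA.
rewrite -(ler_pM2l t0) -[t in t * `| _ |](gtr0_norm t0) -normrM.
have Nj : (N <= j)%N by near: j; exists N.
have h1 : `|Psi (z + t%:C%C *: v) - Phi j (z + t%:C%C *: v)| <= t * (e / 4) by near: j.
have h2 : `|Psi z - Phi j z| <= t * (e / 4) by near: j.
have {}T := T Nj.
have Bt : B * t ^+ 2 <= t * (e / 4).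
  rewrite expr2 mulrA mulrC ler_wpM2l ?(ltW t0)//; apply: le_trans tB.
  by rewrite mulrC ler_wpM2l ?(ltW t0)//; have := ler_norm B; lra.
move: T T' h1 h2; rewrite !ler_norml; move: Bt; set X := B * _; set Y := t * (e / 4).
have -> : t * e = 4 * Y by rewrite /Y; field.
move=> ? ? ? ? ?; lra.
Unshelve. all: by end_near. Qed.

Lemma Sm_lipschitz k z0 (r B : R) Phi z w : Sm k.+1 (pball z0 r) B Phi ->
  pball z0 r z -> pball z0 r w -> `|Phi w - Phi z| <= B * nv (w - z).
Proof.
move=> [_ H] zr wr.
have [->|wz] := eqVneq w z; first by rewrite !subrr normr0 nv0 mulr0.
have nw : 0 < nv (w - z) by rewrite lt_def nv_eq0 subr_eq0 wz nv_ge0.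
pose v : Cn := (nv (w - z))^-1%:C%C *: (w - z).
have v1 : nv v = 1 by rewrite nvZ cmod_real ger0_norm ?invr_ge0 ?nv_ge0// mulVf// gt_eqF.
have wE : w = z + (nv (w - z))%:C%C *: v.
  by rewrite scalerA -rmorphM divff ?gt_eqF// rmorph1 scale1r addrC subrK.
have [D S] := H v ltac:(by rewrite v1).
have b : forall z, pball z0 r z -> `|rD Phi v z| <= B by case: (k) S => [|k'] [].
have := @mean_value_bound R (fun x => Phi (z + x%:C%C *: v)) 0 (nv (w - z)) B (nv_ge0 _).
rewrite -wE rmorph0 scale0r addr0 subr0; apply.
move=> t /andP[t0 tn].
have inb : pball z0 r (z + t%:C%C *: v).
  have -> : z + t%:C%C *: v = (1 - t / nv (w - z))%:C%C *: z + (t / nv (w - z))%:C%C *: w.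
    rewrite /v scalerA -rmorphM scalerBr rmorphB rmorph1 scalerBl scale1r.
    by rewrite -!addrA; congr (_ + _); rewrite addrC.
  set a := t / _; have a0 : 0 <= a by rewrite divr_ge0// ltW.
  have a1 : a <= 1 by rewrite ler_pdivrMr// mul1r.
  rewrite /pball /=.
  have -> : (1 - a)%:C%C *: z + a%:C%C *: w - z0 =
      (1 - a)%:C%C *: (z - z0) + a%:C%C *: (w - z0).
    by rewrite !scalerBr addrACA -opprD -scalerDl -rmorphD subrK rmorph1 scale1r.
  apply: le_lt_trans (nvD _ _) _; rewrite !nvZ !cmod_real !ger0_norm ?subr_ge0//.
  move: zr wr; rewrite /pball /=; move: (nv (z - z0)) (nv (w - z0)) => x y xr yr.
  by have [xy|xy] := leP x y; [apply: le_lt_trans yr|apply: le_lt_trans xr]; nra.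
exists (rD Phi v (z + t%:C%C *: v)); last exact: b.
by apply: rder_line_shift; exact: D.
Qed.

(** A common Lipschitz constant upgrades convergence at the single point [z0] to joint convergence
    in the point and the index. *)
Lemma lipschitz_family_cvg k z0 (r B : R) (Phi : nat -> Cn -> R) (L : R) (N : nat) : 0 < r ->
  (forall j, (N <= j)%N -> Sm k.+1 (pball z0 r) B (Phi j)) ->
  (fun j => Phi j z0) @ \oo --> L ->
  (fun p : Cn * nat => Phi p.2 p.1) @ filter_prod (nbhs z0) \oo --> L.
Proof.
move=> r0 S /cvgrPdist_le cvg; apply/cvgrPdist_le => e e0.
have B1 : 0 < `|B| + 1 by rewrite ltr_wpDl.
have [N' _ HN] := cvg (e / 2) ltac:(by rewrite divr_gt0).
exists (pball z0 (Num.min r (e / 2 / (`|B| + 1))), [set j | (maxn N N' <= j)%N]) => /=.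
  split; last by exists (maxn N N').
  apply/nbhs_nvP; exists (Num.min r (e / 2 / (`|B| + 1))) => //.
  by rewrite lt_min r0 !divr_gt0.
move=> [w j] /= [wr]; rewrite geq_max => /andP[Nj N'j].
move: wr; rewrite /pball /= lt_min => /andP[wr]; rewrite ltr_pdivlMr// => we.
have := HN j N'j; have := Sm_lipschitz (S j Nj) (pball_center z0 r0) wr.
have : B * nv (w - z0) <= e / 2.
  by have := ler_norm B; have := nv_ge0 (w - z0); nra.
rewrite /= !ler_norml; lra.
Qed.

Lemma cvg_rD_rD_ln z0 (r B : R) (Phi : nat -> Cn -> R) Psi (N : nat) u v : 0 < r ->
  nv u <= 1 -> nv v <= 1 ->
  (forall j, (N <= j)%N -> Sm 3 (pball z0 r) B (Phi j)) -> Sm 3 (pball z0 r) B Psi ->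
  (forall j w, (N <= j)%N -> pball z0 r w -> 0 < Phi j w) ->
  (forall w, pball z0 r w -> 0 < Psi w) ->
  (forall w, pball z0 r w -> (fun j => Phi j w) @ \oo --> Psi w) ->
  (fun p : Cn * nat => rD (rD (fun z => ln (Phi p.2 z)) v) u p.1)
    @ filter_prod (nbhs z0) \oo --> rD (rD (fun z => ln (Psi z)) v) u z0.
Proof.
move=> r0 u1 v1 S S' p p' cvg.
have oA := @open_pball R n z0 r; have Az := pball_center z0 r0.
have S1 x (x1 : nv x <= 1) j (Nj : (N <= j)%N) : Sm 2 (pball z0 r) B (rD (Phi j) x) := ((S j Nj).2 x x1).2.
have S1' x (x1 : nv x <= 1) : Sm 2 (pball z0 r) B (rD Psi x) := (S'.2 x x1).2.
have S0 j (Nj : (N <= j)%N) : Sm 2 (pball z0 r) B (Phi j).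
  have /= [b H] := S j Nj; split => // x /H[D [b1 H1]]; split => //; split => // y /H1[D1 [b2 _]].
  by split.
have S0' : Sm 2 (pball z0 r) B Psi.
  have /= [b H] := S'; split => // x /H[D [b1 H1]]; split => //; split => // y /H1[D1 [b2 _]].
  by split.
have c1 x (x1 : nv x <= 1) w : pball z0 r w -> (fun j => rD (Phi j) x w) @ \oo --> rD Psi x w.
  by move=> wr; exact: (cvg_rD oA wr x1 S0 S0' cvg).
have c2 : (fun j => rD (rD (Phi j) v) u z0) @ \oo --> rD (rD Psi v) u z0.
  exact: (cvg_rD oA Az u1 (S1 v v1) (S1' v v1) (c1 v v1)).
have C0 := lipschitz_family_cvg r0 S (cvg _ Az).
have Cu := lipschitz_family_cvg r0 (S1 u u1) (c1 u u1 _ Az).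
have Cv := lipschitz_family_cvg r0 (S1 v v1) (c1 v v1 _ Az).
have C2 := @lipschitz_family_cvg 0 z0 r B (fun j => rD (rD (Phi j) v) u) _ N r0 (fun j Nj => ((S1 v v1 j Nj).2 u u1).2) c2.
have P0 : Psi z0 != 0 by rewrite gt_eqF// p'.
rewrite (rD_rD_ln oA p' S' u1 v1 Az).
apply: cvg_trans (cvgB (cvgM C2 (cvgV P0 C0))
  (cvgM (cvgM Cv Cu) (cvgV _ (cvgM C0 C0)))); last by rewrite mulf_neq0.
apply: near_eq_cvg.
exists (pball z0 r, [set j | (N <= j)%N]) => /=.
  split; last by exists N.
  by apply/nbhs_nvP; exists r.
move=> [w j] /= [wr Nj] /=; apply/esym.
exact: (rD_rD_ln oA (fun w => p j w Nj) (S j Nj) u1 v1 wr).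
Qed.

End LogDerivatives.

(** * Perturbation and lower bounds of sesquilinear forms *)

Section QuadraticForms.
Variables (R : realType) (n : nat).
Local Notation C := R[i].
Local Notation Cn := 'rV[C]_n.
Implicit Types (g h : 'I_n -> 'I_n -> C) (xi eta : Cn).

Definition sform g xi : C := \sum_(mu < n) \sum_(nu < n) g mu nu * xi 0 mu * conjc (xi 0 nu).

Lemma sum2_const (b : R) : \sum_(mu < n) \sum_(nu < n) b = n%:R ^+ 2 * b.
Proof. by rewrite !sumr_const !card_ord -mulrnA -[LHS]mulr_natl natrM expr2. Qed.

Lemma cmod_sform_sub g h xi (e : R) : (forall mu nu, cmod (g mu nu - h mu nu) <= e) ->
  cmod (sform g xi - sform h xi) <= n%:R ^+ 2 * (e * nv xi ^+ 2).
Proof.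
move=> H; rewrite /sform -sumrB -sum2_const.
apply: le_trans (cmod_sum _ _ _) _; apply: ler_sum => mu _.
rewrite -sumrB; apply: le_trans (cmod_sum _ _ _) _; apply: ler_sum => nu _.
rewrite -!mulrBl !cmodM cmodJ expr2 mulrA.
have e0 : 0 <= e by apply: le_trans (H mu nu); exact: cmod_ge0.
have := nv_coord xi mu; have := nv_coord xi nu; have := cmod_ge0 (xi 0 mu).
have := cmod_ge0 (xi 0 nu) => *.
by apply: ler_pM => //; [rewrite mulr_ge0 ?cmod_ge0|apply: ler_pM => //; exact: cmod_ge0].
Qed.

Lemma cmod_sform_subr g xi eta (G : R) : (forall mu nu, cmod (g mu nu) <= G) ->
  cmod (sform g xi - sform g eta) <= n%:R ^+ 2 * (G * ((nv xi + nv eta) * nv (xi - eta))).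
Proof.
move=> H; rewrite /sform -sumrB -sum2_const.
apply: le_trans (cmod_sum _ _ _) _; apply: ler_sum => mu _.
rewrite -sumrB; apply: le_trans (cmod_sum _ _ _) _; apply: ler_sum => nu _.
have -> : g mu nu * xi 0 mu * conjc (xi 0 nu) - g mu nu * eta 0 mu * conjc (eta 0 nu) =
  g mu nu * (xi 0 mu * conjc (xi 0 nu - eta 0 nu) + (xi 0 mu - eta 0 mu) * conjc (eta 0 nu)).
  by rewrite conjcB; ring.
rewrite cmodM; apply: ler_pM; rewrite ?cmod_ge0//.
apply: le_trans (cmodD _ _) _; rewrite !cmodM !cmodJ mulrDl.
have d j : cmod (xi 0 j - eta 0 j) <= nv (xi - eta).
  by have := nv_coord (xi - eta) j; rewrite !mxE.
apply: lerD; first by apply: ler_pM; rewrite ?cmod_ge0 ?nv_coord.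
by rewrite mulrC; apply: ler_pM; rewrite ?cmod_ge0 ?nv_coord.
Qed.

Lemma sformZ g (a : C) xi : sform g (a *: xi) = (cmod a ^+ 2)%:C%C * sform g xi.
Proof.
have aE : (cmod a ^+ 2)%:C%C = a * conjc a.
  by rewrite -Re_mulJ [RHS]complexE Im_mulJ rmorph0 mulr0 addr0.
rewrite /sform mulr_sumr; apply: eq_bigr => mu _; rewrite mulr_sumr; apply: eq_bigr => nu _.
by rewrite !mxE conjcM aE; ring.
Qed.

Lemma bounded_entries g : exists2 G : R, 0 <= G & forall mu nu, cmod (g mu nu) <= G.
Proof.
exists (\sum_(mu < n) \sum_(nu < n) cmod (g mu nu)).
  by apply: sumr_ge0 => *; apply: sumr_ge0 => *; exact: cmod_ge0.
move=> mu nu; rewrite (bigD1 mu)//= (bigD1 nu)//= -addrA lerDl addr_ge0//.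
  by apply: sumr_ge0 => *; exact: cmod_ge0.
by apply: sumr_ge0 => *; apply: sumr_ge0 => *; exact: cmod_ge0.
Qed.

(** Compactness of the unit sphere, treated inside the closed unit ball, followed by scaling. *)
Lemma sform_lower_bound g : (forall xi, xi != 0 -> 0 < complex.Re (sform g xi)) ->
  exists2 c : R, 0 < c & forall xi, c * nv xi ^+ 2 <= complex.Re (sform g xi).
Proof.
move=> pos.
have [G G0 GB] := bounded_entries g.
have [N HN] : exists N, forall j, (N <= j)%N -> forall xi, cball 0 1 xi ->
    nv xi = 1 -> (j.+1%:R)^-1 <= complex.Re (sform g xi).
  apply: compact_uniform; first exact: compact_cball.
  (* Near a point of norm less than 1 there are no unit vectors and the claim is void. *)
  move=> xi0; rewrite /cball /= subr0 le_eqVlt => /predU1P[x1|x1]; last first.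
    exists (1 - nv xi0); first by rewrite subr_gt0.
    exists 0%N => xi j; rewrite /pball /= => h _ e1.
    by have := nv_tri xi xi0 0; rewrite !subr0 e1; lra.
  have m0 : 0 < complex.Re (sform g xi0).
    by apply: pos; rewrite -nv_eq0 x1 oner_eq0.
  set m := complex.Re _ in m0.
  pose D := n%:R ^+ 2 * (G * 2) + 1.
  have D0 : 0 < D by rewrite /D ltr_wpDl// mulr_ge0 ?exprn_ge0// mulr_ge0.
  exists (m / 2 / D); first by rewrite !divr_gt0.
  have [N HN] : exists N : nat, (m / 2)^-1 <= N%:R.
    by exists (Num.bound (m / 2)^-1); apply/ltW/archi_boundP; rewrite invr_ge0 divr_ge0// ltW.
  exists N => xi j; rewrite /pball /= ltr_pdivlMr// => h Nj e1.
  have m2 : (j.+1%:R)^-1 <= m / 2.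
    rewrite -[leRHS]invrK lef_pV2 ?posrE ?invr_gt0 ?divr_gt0//.
    by apply: le_trans HN _; rewrite ler_nat ltnW.
  have := @cmod_sform_subr g xi xi0 G GB; rewrite e1 x1 => K.
  have : complex.Re (sform g xi0) - complex.Re (sform g xi) <= m / 2.
    rewrite -ReB; apply: le_trans (ler_norm _) _; apply: le_trans (Re_le_cmod _) _.
    rewrite cmodB; apply: le_trans K _; apply: le_trans (ltW h).
    by rewrite /D -(natrD _ 1 1) !mulrA [leRHS]mulrC ler_wpM2r ?nv_ge0// lerDl.
  rewrite -/m => hm; apply: le_trans m2 _; lra.
exists (N.+1%:R)^-1; first by rewrite invr_gt0.
move=> xi; have [->|x0] := eqVneq xi 0.
  rewrite nv0 expr0n mulr0 /sform big1 // => mu _; rewrite big1// => nu _.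
  by rewrite !mxE mulr0 mul0r.
have nx : 0 < nv xi by rewrite lt_def nv_eq0 x0 nv_ge0.
pose v : Cn := (nv xi)^-1%:C%C *: xi.
have v1 : nv v = 1 by rewrite nvZ cmod_real ger0_norm ?invr_ge0 ?nv_ge0// mulVf// gt_eqF.
have -> : xi = (nv xi)%:C%C *: v by rewrite scalerA -rmorphM divff ?gt_eqF// rmorph1 scale1r.
rewrite sformZ nvZ v1 mulr1 Re_Zr mulrC.
by rewrite ler_wpM2l ?exprn_ge0 ?cmod_ge0//; apply: HN; rewrite /cball /= ?subr0 ?v1.
Qed.

End QuadraticForms.

(** * Convergence of the Bergman metrics on compact sets *)

Section MetricConvergence.
Variables (R : realType) (n : nat).
Local Notation C := R[i].
Local Notation Cn := 'rV[C]_n.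

Lemma nv_delta mu : nv (delta_mx 0 mu : Cn) <= 1.
Proof.
apply: nv_le => // j; rewrite mxE eqxx /=; case: (_ == _); first by rewrite cmod1.
by rewrite cmod0.
Qed.

Lemma nv_evec mu : nv (@evec R n mu) <= 1. Proof. exact: nv_delta. Qed.

Lemma nv_ivec mu : nv (@ivec R n mu) <= 1.
Proof. by rewrite /ivec nvZ cmodi mul1r nv_delta. Qed.

Lemma open_cball (O : set Cn) z : open O -> O z -> exists2 r : R, 0 < r & cball z r `<=` O.
Proof.
move=> oO Oz; have [r r0 H] := open_nv oO Oz; exists (r / 2); first by rewrite divr_gt0.
by move=> w; rewrite /cball /= => h; apply: H; lra.
Qed.

Definition kernel_cvg (Om : nat -> set Cn) (Oinf : set Cn) :=
  [/\ forall j, open (Om j), open Oinf,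
    forall K : set Cn, compact K -> K `<=` Oinf -> \forall j \near \oo, K `<=` Om j,
    forall j z, Om j z -> 0 < bergman_kernel (Om j) z z &
    (forall z, Oinf z -> 0 < bergman_kernel Oinf z z) /\
    forall z, Oinf z -> (fun j => bergman_kernel (Om j) z z) @ \oo --> bergman_kernel Oinf z z].

(** Through the constant sequence, joint convergence in point and index also yields continuity of
    the metric of a single domain. *)
Lemma kernel_cvg_cst (O : set Cn) : open O -> (forall z, O z -> 0 < bergman_kernel O z z) ->
  kernel_cvg (fun=> O) O.
Proof.
move=> oO pos; split => //; first by move=> K _ KO; exact: nearW.
by split => // z _; exact: cvg_cst.
Qed.

Section Convergence.
Variables (Om : nat -> set Cn) (Oinf : set Cn).
Hypothesis KC : kernel_cvg Om Oinf.

Lemma cvg_logK_second z0 u v : Oinf z0 -> nv u <= 1 -> nv v <= 1 ->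
  (fun p : Cn * nat => rD (rD (logK (Om p.2)) v) u p.1) @ filter_prod (nbhs z0) \oo -->
    rD (rD (logK Oinf) v) u z0.
Proof.
case: KC => oOm oOinf incl pos [posinf cvg] Oz u1 v1.
have [r8 r80 sub8] := open_cball oOinf Oz.
pose r := r8 / 8; have r0 : 0 < r by rewrite divr_gt0.
have E8 : 8 * r = r8 by rewrite /r; field.
rewrite -E8 in sub8.
have [N _ HN] := incl _ (@compact_cball R n z0 _ (mulr_ge0 (ler0n _ 8) (ltW r0))) sub8.
have bsub : pball z0 r `<=` cball z0 (8 * r).
  by move=> w; rewrite /pball /cball /=; lra.
pose Phi (O : set Cn) z : R := complex.Re (bergman_kernel O z z).
have PhiE O : logK O = fun z => ln (Phi O z) by [].
have zz : pball z0 r z0 by exact: pball_center.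
have := @cvg_rD_rD_ln R n z0 r (kbound n (4 * r) * (1 + 32 / r) ^+ 3)
  (fun j => Phi (Om j)) (Phi Oinf) N u v r0 u1 v1; apply.
- move=> j Nj; have sj := HN j Nj.
  exact (Sm_kernel (oOm j) (bergman_kernel_exists (pos j z0 (sj z0 (bsub z0 zz)))) r0 sj).
- exact (Sm_kernel oOinf (bergman_kernel_exists (posinf z0 Oz)) r0 sub8).
- move=> j w Nj wr; have := pos j w (HN j Nj w (bsub w wr)).
  by rewrite ltcE => /andP[].
- by move=> w wr; have := posinf w (sub8 w (bsub w wr)); rewrite ltcE => /andP[].
- move=> w wr; have := cvg w (sub8 w (bsub w wr)) => /cvgrPdist_le H.
  apply/cvgrPdist_le => e e0; have := H e%:C%C; rewrite ltcR => /(_ e0) {}H.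
  near=> j; rewrite /Phi -ReB; apply: le_trans (Re_le_cmod _) _.
  by rewrite -lecR -normcmod; near: j.
Unshelve. all: by end_near. Qed.

Lemma wirtinger_close (x1 x2 x3 x4 y1 y2 y3 y4 e : R) :
  `|x1 - y1| <= e -> `|x2 - y2| <= e -> `|x3 - y3| <= e -> `|x4 - y4| <= e ->
  cmod ((4%:R)^-1 * ((y1 + y2)%:C%C + 'i%C * (y3 - y4)%:C%C) -
        (4%:R)^-1 * ((x1 + x2)%:C%C + 'i%C * (x3 - x4)%:C%C)) <= e.
Proof.
move=> b1 b2 b3 b4; rewrite -mulrBr cmodM.
have -> : cmod (4^-1 : C) = 4^-1.
  by rewrite cmodV -(rmorph_nat (real_complex R)) cmod_real ger0_norm.
rewrite mulrC ler_pdivrMr//.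
set Z := _ - _; have -> : Z = (y1 - x1 + (y2 - x2))%:C%C + 'i%C * (y3 - x3 - (y4 - x4))%:C%C.
  by rewrite /Z !(rmorphD, rmorphB); ring.
apply: le_trans (cmodD _ _) _; rewrite cmodM cmodi mul1r !cmod_real.
move: b1 b2 b3 b4; rewrite (distrC x1) (distrC x2) (distrC x3) (distrC x4).
have := ler_normD (y1 - x1) (y2 - x2); have := ler_normB (y3 - x3) (y4 - x4); lra.
Qed.

Lemma cvg_bergman_g z0 (e : R) : Oinf z0 -> 0 < e ->
  exists2 r : R, 0 < r & exists N, forall w j, pball z0 r w -> (N <= j)%N ->
    forall mu nu, cmod (bergman_g (Om j) mu nu w - bergman_g Oinf mu nu z0) <= e.
Proof.
move=> Oz e0.
have H (u v : 'I_n -> Cn) : (forall mu, nv (u mu) <= 1) -> (forall mu, nv (v mu) <= 1) ->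
    \forall p \near filter_prod (nbhs z0) \oo, forall mu nu,
    `|rD (rD (logK Oinf) (v nu)) (u mu) z0 - rD (rD (logK (Om p.2)) (v nu)) (u mu) p.1| <= e.
  move=> u1 v1; apply: filter_forall => mu; apply: filter_forall => nu.
  have := cvg_logK_second Oz (u1 mu) (v1 nu); move/cvgrPdist_le; exact.
have h1 := H _ _ nv_evec nv_evec; have h2 := H _ _ nv_ivec nv_ivec.
have h3 := H _ _ nv_evec nv_ivec; have h4 := H _ _ nv_ivec nv_evec.
have [[A B] [nA [N _ nB]] HAB] := filterI (filterI h1 h2) (filterI h3 h4).
have [r r0 Hr] := (nbhs_nvP _ _).1 nA.
exists r => //; exists N => w j wr Nj mu nu.
have [[a1 a2] [a3 a4]] := HAB (w, j) (conj (Hr w wr) (nB j Nj)).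
exact: (wirtinger_close (a1 mu nu) (a2 mu nu) (a3 mu nu) (a4 mu nu)).
Qed.

End Convergence.

Lemma bergman_formE (O : set Cn) z xi :
  bergman_form O z xi = sform (fun mu nu => bergman_g O mu nu z) xi.
Proof. by []. Qed.

Definition rform (O : set Cn) z xi : R := complex.Re (bergman_form O z xi).

Lemma cvg_rform Om Oinf z0 (e : R) : kernel_cvg Om Oinf -> Oinf z0 -> 0 < e ->
  exists2 r : R, 0 < r & exists N, forall w j, pball z0 r w -> (N <= j)%N ->
    forall xi, `|rform (Om j) w xi - rform Oinf z0 xi| <= e * nv xi ^+ 2.
Proof.
move=> KC Oz e0; have n1 : 0 < (n%:R : R) ^+ 2 + 1 by rewrite ltr_wpDl// exprn_ge0.
have [r r0 [N HN]] := cvg_bergman_g KC Oz (divr_gt0 e0 n1).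
exists r => //; exists N => w j wr Nj xi; rewrite /rform -ReB.
apply: le_trans (Re_le_cmod _) _; rewrite !bergman_formE.
apply: le_trans (cmod_sform_sub _ (HN w j wr Nj)) _.
rewrite mulrA ler_wpM2r ?exprn_ge0 ?nv_ge0// mulrCA -[leRHS]mulr1 ler_wpM2l ?(ltW e0)//.
by rewrite ler_pdivrMr// mul1r lerDl.
Qed.

Section Posdef.
Variable O : set Cn.
Hypotheses (oO : open O) (pos : forall z, O z -> 0 < bergman_kernel O z z) (pd : bergman_posdef O).

Lemma rform_lower z : O z -> exists2 c : R, 0 < c & forall xi, c * nv xi ^+ 2 <= rform O z xi.
Proof.
move=> Oz; apply: sform_lower_bound => xi x0.
by have := pd Oz x0; rewrite ltcE => /andP[].
Qed.

Lemma continuous_rform z xi (e : R) : O z -> 0 < e -> exists2 d : R, 0 < d &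
  forall w eta, nv (w - z) < d -> nv (eta - xi) < d -> `|rform O w eta - rform O z xi| <= e.
Proof.
move=> Oz e0; pose m := (nv xi + 1) ^+ 2.
have m0 : 0 < m by rewrite exprn_gt0// ltr_wpDl ?nv_ge0.
have [r r0 [N HN]] := cvg_rform (kernel_cvg_cst oO pos) Oz (divr_gt0 (divr_gt0 e0 (ltr0n _ 2)) m0).
have [g gE] : exists g, forall x, bergman_form O z x = sform g x.
  by exists (fun mu nu => bergman_g O mu nu z).
have [G G0 GB] := bounded_entries g.
pose D := n%:R ^+ 2 * (G * (2 * nv xi + 1)) + 1.
have D0 : 0 < D.
  by rewrite /D ltr_wpDl// mulr_ge0 ?exprn_ge0// mulr_ge0// addr_ge0// mulr_ge0 ?nv_ge0.
exists (Num.min r (Num.min 1 (e / 2 / D))); first by rewrite !lt_min r0 ltr01 !divr_gt0.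
move=> w eta; rewrite !lt_min => /and3P[wr _ _] /and3P[_ e1]; rewrite ltr_pdivlMr// => eD.
have h1 : `|rform O w eta - rform O z eta| <= e / 2 / m * nv eta ^+ 2 := HN w N wr (leqnn N) eta.
have ne : nv eta <= nv xi + 1.
  by have := nv_tri eta xi 0; rewrite !subr0; lra.
have h2 := @cmod_sform_subr _ _ g eta xi G GB.
have h3 : e / 2 / m * nv eta ^+ 2 <= e / 2.
  rewrite mulrAC ler_pdivrMr// ler_wpM2l ?divr_ge0 ?(ltW e0)//.
  by rewrite /m lerXn2r ?nnegrE ?addr_ge0 ?nv_ge0.
have h4 : n%:R ^+ 2 * (G * ((nv eta + nv xi) * nv (eta - xi))) <= e / 2.
  apply: le_trans (ltW eD); rewrite !mulrA [leRHS]mulrC ler_wpM2r ?nv_ge0//.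
  rewrite /D -mulrA ler_wpDr// ler_wpM2l ?exprn_ge0// ler_wpM2l//; lra.
have h5 : `|rform O z eta - rform O z xi| <= e / 2.
  rewrite /rform -ReB !gE; apply: le_trans (Re_le_cmod _) _; exact: le_trans h2 h4.
move: (le_trans h1 h3) h5; move: (rform O w eta) (rform O z eta) (rform O z xi) => a b c.
rewrite !ler_norml; lra.
Qed.

End Posdef.

Lemma bergman_metricE (O : set Cn) z xi : bergman_metric O z xi = Num.sqrt (rform O z xi).
Proof. by []. Qed.

(** Positive definiteness turns the additive error into a relative one: at a centre [z0] the form is
    at least [c * nv xi ^+ 2]. Both metrics at a nearby [w] are compared with the limit form at
    [z0]. *)
Lemma metric_compare Om Oinf (L : set Cn) (e : R) : kernel_cvg Om Oinf -> bergman_posdef Oinf ->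
  compact L -> L `<=` Oinf -> 0 < e < 1 ->
  exists N, forall j, (N <= j)%N -> forall z, L z -> forall xi,
    (1 - e) * bergman_metric Oinf z xi <= bergman_metric (Om j) z xi <=
    (1 + e) * bergman_metric Oinf z xi.
Proof.
move=> KC pd cL LO /andP[e0 e1].
have [_ oO _ _ [pos _]] := KC.
apply: compact_uniform => // z0 /LO Oz.
have [c c0 Hc] := rform_lower pd Oz.
have d0 : 0 < e / 4 * c by rewrite mulr_gt0// divr_gt0.
have [r1 r10 [N1 H1]] := cvg_rform KC Oz d0.
have [r2 r20 [N2 H2]] := cvg_rform (kernel_cvg_cst oO pos) Oz d0.
exists (Num.min r1 r2); first by rewrite lt_min r10.
exists N1 => w j; rewrite /pball /= lt_min => /andP[wr1 wr2] Nj xi.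
rewrite !bergman_metricE.
have b1 : `|rform (Om j) w xi - rform Oinf z0 xi| <= e / 4 * c * nv xi ^+ 2 := H1 w j wr1 Nj xi.
have b2 : `|rform Oinf w xi - rform Oinf z0 xi| <= e / 4 * c * nv xi ^+ 2 := H2 w N2 wr2 (leqnn _) xi.
move: (Hc xi) b2 b1; move: (rform Oinf z0 xi) (rform Oinf w xi) (rform (Om j) w xi) => q0 q qj.
rewrite -[e / 4 * c * _]mulrA; set t := c * _ => tq.
have t0 : 0 <= t by rewrite mulr_ge0 ?exprn_ge0 ?nv_ge0// ltW.
rewrite !ler_norml => /andP[b1 b2] /andP[b3 b4].
have e4 : e / 4 * t <= e / 4 * q0 by rewrite ler_wpM2l// divr_ge0// ltW.
have q00 : 0 <= q0 by exact: le_trans tq.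
have s1 : 0 <= 1 - e by rewrite subr_ge0 ltW.
have s2 : 0 <= 1 + e by rewrite addr_ge0// ltW.
have l1 : (1 - e / 4) * q0 <= q by lra.
have l2 : q <= (1 + e / 4) * q0 by lra.
have q_0 : 0 <= q by apply: le_trans l1; rewrite mulr_ge0//; lra.
rewrite -{1}[1 - e]ger0_norm// -{1}[1 + e]ger0_norm// -!sqrtr_sqr -!sqrtrM ?sqr_ge0//.
apply/andP; split; apply: ler_wsqrtr.
(* Under the square root the factors are squared, and the relative error [e / 4], incurred twice, is
   small enough to be absorbed by them. *)
- apply: (@le_trans _ _ ((1 - e) ^+ 2 * ((1 + e / 4) * q0))); first by rewrite ler_wpM2l ?sqr_ge0.
  apply: (@le_trans _ _ ((1 - e / 4) * q0)); last by lra.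
  rewrite mulrA ler_wpM2r//.
  have : 0 <= e * (1 - e) by rewrite mulr_ge0// ltW.
  have : 0 <= e * (e * (1 - e)) by rewrite !mulr_ge0// ltW.
  nra.
- apply: (@le_trans _ _ ((1 + e) ^+ 2 * ((1 - e / 4) * q0))); last by rewrite ler_wpM2l ?sqr_ge0.
  apply: (@le_trans _ _ ((1 + e / 4) * q0)); first by lra.
  rewrite mulrA ler_wpM2r//.
  have : 0 <= e * (1 - e) by rewrite mulr_ge0// ltW.
  have : 0 <= e * (e * (1 - e)) by rewrite !mulr_ge0// ltW.
  nra.
Qed.

Lemma metric_bounds (O : set Cn) (L : set Cn) : open O ->
  (forall z, O z -> 0 < bergman_kernel O z z) -> bergman_posdef O -> compact L -> L `<=` O ->
  exists c B : R, 0 < c /\ 0 < B /\ forall z, L z -> forall xi,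
    c * nv xi <= bergman_metric O z xi <= B * nv xi.
Proof.
move=> oO pos pd cL LO.
have [N HN] : exists N, forall j, (N <= j)%N -> forall z, L z -> forall xi,
    (j.+1%:R)^-1 * nv xi <= bergman_metric O z xi <= j.+1%:R * nv xi.
  apply: compact_uniform => // z0 /LO Oz.
  have [c c0 Hc] := rform_lower pd Oz.
  have [r r0 [N0 H]] := cvg_rform (kernel_cvg_cst oO pos) Oz (divr_gt0 c0 (ltr0n _ 2)).
  have [g gE] : exists g, forall x, bergman_form O z0 x = sform g x.
    by exists (fun mu nu => bergman_g O mu nu z0).
  have [G G0 GB] := bounded_entries g.
  pose D := n%:R ^+ 2 * G + c / 2.
  have c2 : 0 <= c / 2 by rewrite divr_ge0// ltW.
  have D0 : 0 <= D by apply: addr_ge0 => //; apply: mulr_ge0 => //; exact: exprn_ge0.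
  pose m := D + (c / 2)^-1.
  have ci : 0 <= (c / 2)^-1 by rewrite invr_ge0.
  exists r => //; exists (Num.bound m) => w j wr Nj xi.
  have mj : m <= j.+1%:R.
    apply: le_trans (ltW (archi_boundP _)) _; first by rewrite addr_ge0.
    by rewrite ler_nat ltnW.
  have j1 : 1 <= (j.+1%:R : R) by rewrite ler1n.
  have hq : `|rform O w xi - rform O z0 xi| <= c / 2 * nv xi ^+ 2 := H w N0 wr (leqnn _) xi.
  have hG : rform O z0 xi <= n%:R ^+ 2 * (G * nv xi ^+ 2).
    rewrite /rform gE; apply: le_trans (ler_norm _) _; apply: le_trans (Re_le_cmod _) _.
    have := @cmod_sform_sub R n g (fun _ _ => 0) xi G (fun mu nu => ltac:(by rewrite subr0)).
    have -> : sform (fun _ _ => 0) xi = 0.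
      by rewrite /sform big1// => mu _; rewrite big1// => nu _; rewrite !mul0r.
    by rewrite subr0.
  move: (Hc xi) hq hG; rewrite ler_norml bergman_metricE; set s := nv xi ^+ 2.
  move: (rform O w xi) (rform O z0 xi) => q q0 h1 /andP[h2 h3] hG.
  have s0 : 0 <= s by rewrite exprn_ge0 ?nv_ge0.
  have lo : c / 2 * s <= q by lra.
  have hi : q <= D * s by rewrite /D mulrDl -mulrA; lra.
  have sE (x : R) : 0 <= x -> x * nv xi = Num.sqrt (x ^+ 2 * s).
    by move=> x0; rewrite sqrtrM ?sqr_ge0// !sqrtr_sqr !ger0_norm ?nv_ge0.
  rewrite !sE ?invr_ge0 ?ler0n//; apply/andP; split; apply: ler_wsqrtr.
    apply: le_trans lo; rewrite ler_wpM2r// exprVn.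
    rewrite -[leRHS]invrK lef_pV2 ?posrE ?invr_gt0 ?divr_gt0 ?exprn_gt0//.
    apply: (@le_trans _ _ j.+1%:R); first by apply: le_trans mj; rewrite lerDr.
    by rewrite expr2 ler_peMr.
  apply: le_trans hi _; rewrite ler_wpM2r//.
  apply: (@le_trans _ _ j.+1%:R); first by apply: le_trans mj; rewrite lerDl.
  by rewrite expr2 ler_peMr.
exists (N.+1%:R)^-1, (N.+1%:R); rewrite invr_gt0 !ltr0n; do 2 split => //.
by move=> z Lz xi; exact: HN.
Qed.

End MetricConvergence.

(** * Continuity and differentiability of curves in [C^n] *)

Section VectorCurves.
Variables (R : realType) (n : nat).
Local Notation C := R[i].
Local Notation Cn := 'rV[C]_n.
Implicit Types (g h : R -> Cn) (a b c t : R) (F : R -> R).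

Definition contR F a b := forall t, a <= t <= b -> forall e : R, 0 < e ->
  exists2 d : R, 0 < d & forall s, a <= s <= b -> `|s - t| < d -> `|F s - F t| < e.

Definition contV g a b := forall t, a <= t <= b -> forall e : R, 0 < e ->
  exists2 d : R, 0 < d & forall s, a <= s <= b -> `|s - t| < d -> nv (g s - g t) < e.

Definition vder g t (v : Cn) := forall e : R, 0 < e -> exists2 d : R, 0 < d &
  forall h : R, `|h| < d -> nv (g (t + h) - g t - h%:C%C *: v) <= e * `|h|.

Lemma contR_within F a b : contR F a b <-> {within `[a, b], continuous F}.
Proof.
split=> [H|/subspace_continuousP H t tab e e0].
  apply/subspace_continuousP => t /=; rewrite in_itv /= => tab.
  apply/cvgrPdist_lt => e e0; have [d d0 Hd] := H t tab e e0.
  rewrite near_withinE; apply/nbhs_ballP; exists d => // s.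
  by rewrite -ball_normE /= => ts; rewrite in_itv /= distrC => sab; apply: Hd; rewrite // distrC.
have tab' : `[a, b]%classic t by rewrite /= in_itv.
have /cvgrPdist_lt/(_ e e0) := H t tab'.
rewrite near_withinE => /nbhs_ballP[d /= d0 Hd]; exists d => // s sab st.
by rewrite distrC; apply: Hd; [rewrite -ball_normE /= distrC|rewrite /= in_itv].
Qed.

Lemma contV_within g a b : contV g a b <-> {within `[a, b], continuous g}.
Proof.
split=> [H|/subspace_continuousP H t tab e e0].
  apply/subspace_continuousP => t /=; rewrite in_itv /= => tab.
  apply/cvgrPdist_lt => e /cgt0_real[-> e0]; have [d d0 Hd] := H t tab _ e0.
  rewrite near_withinE; apply/nbhs_ballP; exists d => // s.
  rewrite -ball_normE /= => ts; rewrite in_itv /= normr_nv ltcR nvB => sab.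
  by apply: Hd; rewrite // distrC.
have tab' : `[a, b]%classic t by rewrite /= in_itv.
have e0' : 0 < e%:C%C :> C by rewrite ltcR.
have /cvgrPdist_lt/(_ _ e0') := H t tab'.
rewrite near_withinE => /nbhs_ballP[d /= d0 Hd]; exists d => // s sab st.
have := Hd s; rewrite normr_nv ltcR nvB; apply; last by rewrite /= in_itv.
by rewrite -ball_normE /= distrC.
Qed.

Lemma contR_sub F a b a' b' : a <= a' -> b' <= b -> contR F a b -> contR F a' b'.
Proof.
move=> aa bb H t tab e e0; have [|d d0 Hd] := H t _ e e0; first by lra.
by exists d => // s sab; apply: Hd; lra.
Qed.

Lemma contV_sub g a b a' b' : a <= a' -> b' <= b -> contV g a b -> contV g a' b'.
Proof.
move=> aa bb H t tab e e0; have [|d d0 Hd] := H t _ e e0; first by lra.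
by exists d => // s sab; apply: Hd; lra.
Qed.

Lemma mono_of_rder F a b : a <= b -> contR F a b ->
  (forall t, a < t < b -> exists2 l, rder F t l & 0 <= l) -> F a <= F b.
Proof.
move=> ab /contR_within cF H.
have /choice[dF HdF] : forall t, exists l, a < t < b -> rder F t l /\ 0 <= l.
  move=> t; have [h|h] := boolP (a < t < b); last by exists 0.
  by have [l h1 h2] := H t h; exists l.
rewrite -subr_ge0.
have [/eqP|ab'] := boolP (a == b); first by move=> ->; rewrite subrr.
have {}ab : a < b by rewrite lt_neqAle ab'.
have [||c cab ->] := @MVT _ F dF a b ab.
- by move=> t; rewrite in_itv /= => tab; apply/rderP; apply (HdF t tab).
- exact: cF.
- rewrite mulr_ge0 ?subr_ge0 ?(ltW ab)//; move: cab; rewrite in_itv /= => /HdF[]//.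
Qed.

(** Both [F - phi] and [F + phi] are nondecreasing. This form compares lengths through their
    primitives, without integrals. *)
Lemma mean_value_ineq (phi F : R -> R) a b : a <= b -> contR phi a b -> contR F a b ->
  (forall t, a < t < b -> exists k l, [/\ rder phi t k, rder F t l & `|k| <= l]) ->
  `|phi b - phi a| <= F b - F a.
Proof.
move=> ab cphi cF H.
have H1 : F a - phi a <= F b - phi b.
  apply: (@mono_of_rder (fun t => F t - phi t)) => // [t tab e e0|t /H[k [l [Hk Hl kl]]]].
    have [d1 d10 H1] := cphi t tab (e / 2) ltac:(by rewrite divr_gt0).
    have [d2 d20 H2] := cF t tab (e / 2) ltac:(by rewrite divr_gt0).
    exists (Num.min d1 d2); first by rewrite lt_min d10.
    move=> s sab; rewrite lt_min => /andP[/(H1 s sab) h1 /(H2 s sab) h2].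
    by move: h1 h2; rewrite !ltr_norml; lra.
  exists (l - k); last by rewrite subr_ge0; apply: le_trans kl; exact: ler_norm.
  by move/rderP: Hk => Hk; move/rderP: Hl => Hl; apply/rderP; exact: is_deriveB.
have H2 : F a + phi a <= F b + phi b.
  apply: (@mono_of_rder (fun t => F t + phi t)) => // [t tab e e0|t /H[k [l [Hk Hl kl]]]].
    have [d1 d10 H1'] := cphi t tab (e / 2) ltac:(by rewrite divr_gt0).
    have [d2 d20 H2] := cF t tab (e / 2) ltac:(by rewrite divr_gt0).
    exists (Num.min d1 d2); first by rewrite lt_min d10.
    move=> s sab; rewrite lt_min => /andP[/(H1' s sab) h1 /(H2 s sab) h2].
    by move: h1 h2; rewrite !ltr_norml; lra.
  exists (l + k); last by move: kl; rewrite ler_norml; lra.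
  by move/rderP: Hk => Hk; move/rderP: Hl => Hl; apply/rderP; exact: is_deriveD.
by rewrite ler_norml; lra.
Qed.

Lemma finite_delta (P : 'I_n -> R -> Prop) :
  (forall i, exists2 d : R, 0 < d & forall x, `|x| < d -> P i x) ->
  exists2 d : R, 0 < d & forall x, `|x| < d -> forall i, P i x.
Proof.
move=> H; have /choice[d Hd] : forall i, exists d : R, 0 < d /\ forall x, `|x| < d -> P i x.
  by move=> i; have [d d0 Hd] := H i; exists d.
exists (\big[Num.min/1]_i d i).
  by apply: lt_bigmin => // i _; have [] := Hd i.
move=> x xd i; have [_] := Hd i; apply; apply: lt_le_trans xd _.
exact: bigmin_le_cond.
Qed.

Lemma vder_coord g t v : vder g t v <->
  forall j s, rder (ccoord g j s) t (if s then complex.Re (v 0 j) else complex.Im (v 0 j)).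
Proof.
split=> [H j s e e0|H e e0].
  have [d d0 Hd] := H e e0; exists d => // h /Hd K; apply: le_trans K.
  apply: le_trans (nv_coord _ j); rewrite !mxE /ccoord.
  have := Re_le_cmod (g (t + h) 0 j - g t 0 j - h%:C%C * v 0 j).
  have := Im_le_cmod (g (t + h) 0 j - g t 0 j - h%:C%C * v 0 j).
  rewrite !ReB !ImB Re_Zr Im_Zr; case: s => h1 h2.
    by rewrite [_ * h]mulrC.
  by rewrite [_ * h]mulrC.
have e2 : 0 < e / 2 by rewrite divr_gt0.
have [|d d0 Hd] := @finite_delta (fun j (x : R) => forall s, `|ccoord g j s (t + x) - ccoord g j s t -
    (if s then complex.Re (v 0 j) else complex.Im (v 0 j)) * x| <= e / 2 * `|x|).
  move=> j; have [d1 d10 H1] := H j true _ e2; have [d2 d20 H2] := H j false _ e2.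
  exists (Num.min d1 d2); first by rewrite lt_min d10.
  by move=> h; rewrite lt_min => /andP[/H1 h1 /H2 h2] [].
exists d => // h hd; apply: nv_le => [|j]; first by rewrite mulr_ge0// ltW.
have := Hd h hd j true; have := Hd h hd j false; rewrite /ccoord !mxE.
move=> h1 h2; apply: le_trans (cmod_le_ReIm _) _.
rewrite !ReB !ImB Re_Zr Im_Zr ![h * _]mulrC.
have -> : e * `|h| = e / 2 * `|h| + e / 2 * `|h| by field.
exact: lerD.
Qed.

Lemma vder_cvel g t v : vder g t v -> cvel g t = v.
Proof.
move=> /vder_coord H; apply/rowP => j; rewrite mxE.
have /rderP[_ h1] := H j true; have /rderP[_ h2] := H j false.
by rewrite !derive1E h1 h2; case: (v 0 j).
Qed.

Lemma contV_coord g a b : contV g a b <->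
  forall j s, contR (ccoord g j s) a b.
Proof.
split=> [H j s t tab e e0|H t tab e e0].
  have [d d0 Hd] := H t tab e e0; exists d => // x xab /(Hd x xab) K; apply: le_lt_trans K.
  apply: le_trans (nv_coord _ j); rewrite !mxE /ccoord.
  by case: s; rewrite -?ReB -?ImB; [exact: Re_le_cmod|exact: Im_le_cmod].
have e2 : 0 < e / 4 by rewrite divr_gt0.
have [|d d0 Hd] := @finite_delta (fun j x => a <= t + x <= b ->
    forall s, `|ccoord g j s (t + x) - ccoord g j s t| < e / 4).
  move=> j; have [d1 d10 H1] := H j true t tab _ e2; have [d2 d20 H2] := H j false t tab _ e2.
  exists (Num.min d1 d2); first by rewrite lt_min d10.
  move=> h; rewrite lt_min => /andP[h1 h2] hab [].
    by apply: H1 => //; rewrite addrC addKr.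
  by apply: H2 => //; rewrite addrC addKr.
exists d => // x xab xd.
have e2' : e / 2 < e by lra.
apply: le_lt_trans e2'; apply: nv_le => [|j]; first by rewrite divr_ge0// ltW.
have E : t + (x - t) = x by rewrite addrC subrK.
have := Hd (x - t) xd j; rewrite E => /(_ xab) K; have := K true; have := K false.
rewrite /ccoord !mxE => h1 h2; apply: le_trans (cmod_le_ReIm _) _.
rewrite ReB ImB; lra.
Qed.

Lemma C1_onP (u : R -> R) a b : C1_on u a b <->
  exists2 du, contR du a b & forall t, a < t < b -> rder u t (du t).
Proof.
split=> [[du [/contR_within cdu H]]|[du /contR_within cdu H]].
  exists du => // t /H[D E]; apply/rderP; split => //.
  by rewrite -E derive1E.
exists du; split => // t /H/rderP[D E]; split => //.
by rewrite derive1E.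
Qed.

Definition C1V g a b := exists2 dv, contV dv a b & forall t, a < t < b -> vder g t (dv t).

Lemma C1V_coord g a b : C1V g a b <-> forall j s, C1_on (ccoord g j s) a b.
Proof.
split=> [[dv /contV_coord cdv H] j s|H].
  apply/C1_onP; exists (ccoord dv j s); first exact: cdv.
  by move=> t /H/vder_coord; apply.
have /choice[du Hdu] : forall js : 'I_n * bool, exists du : R -> R,
    contR du a b /\ forall t, a < t < b -> rder (ccoord g js.1 js.2) t (du t).
  by move=> [j s]; have /C1_onP[du h1 h2] := H j s; exists du.
pose dv t : Cn := \row_j (du (j, true) t +i* du (j, false) t)%C.
exists dv.
  apply/contV_coord => j s; have [c _] := Hdu (j, s).
  rewrite (_ : ccoord dv j s = du (j, s))//; apply/funext => t.
  by rewrite /ccoord !mxE; case: s {c}.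
move=> t tab; apply/vder_coord => j s; have [_ D] := Hdu (j, s).
by rewrite !mxE /=; case: s D => D; exact: D.
Qed.

Lemma vder_local g h t v (d : R) : 0 < d -> (forall s, `|s - t| < d -> g s = h s) ->
  vder g t v -> vder h t v.
Proof.
move=> d0 E H e e0; have [d1 d10 Hd] := H e e0.
exists (Num.min d d1); first by rewrite lt_min d0.
move=> x; rewrite lt_min => /andP[xd /Hd].
by rewrite (E (t + x)) ?(E t) ?subrr ?normr0// addrC addKr.
Qed.

Lemma vder_eq_oo g h a b t v : a < t < b -> (forall s, a < s < b -> g s = h s) ->
  vder g t v -> vder h t v.
Proof.
move=> /andP[a1 b1] E; apply: (@vder_local _ _ _ _ (Num.min (t - a) (b - t))).
  by rewrite lt_min !subr_gt0 a1.
by move=> s; rewrite lt_min !ltr_norml => *; apply: E; lra.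
Qed.

Lemma vder_affine g (al be : R) t v : vder g (al * t + be) v ->
  vder (fun s => g (al * s + be)) t (al%:C%C *: v).
Proof.
move=> H e e0; have a1 : 0 < `|al| + 1 by rewrite ltr_wpDl.
have [d d0 Hd] := H _ (divr_gt0 e0 a1).
exists (d / (`|al| + 1)); first exact: divr_gt0.
move=> h; rewrite ltr_pdivlMr// => hd.
have ah : `|al * h| <= (`|al| + 1) * `|h| by rewrite normrM ler_wpM2r// lerDl.
have := Hd (al * h) ltac:(by apply: le_lt_trans ah _; rewrite mulrC).
rewrite scalerA -rmorphM [h * al]mulrC.
have -> : al * (t + h) + be = al * t + be + al * h by ring.
move=> K; apply: le_trans K _.
rewrite mulrAC ler_pdivrMr// -mulrA ler_wpM2l ?(ltW e0)//.
by rewrite [_ * (_ + 1)]mulrC.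
Qed.

Lemma rder_affine F (al be : R) t l : rder F (al * t + be) l ->
  rder (fun s => F (al * s + be)) t (al * l).
Proof.
move=> H e e0; have a1 : 0 < `|al| + 1 by rewrite ltr_wpDl.
have [d d0 Hd] := H _ (divr_gt0 e0 a1).
exists (d / (`|al| + 1)); first exact: divr_gt0.
move=> h; rewrite ltr_pdivlMr// => hd.
have ah : `|al * h| <= (`|al| + 1) * `|h| by rewrite normrM ler_wpM2r// lerDl.
have := Hd (al * h) ltac:(by apply: le_lt_trans ah _; rewrite mulrC).
have -> : al * (t + h) + be = al * t + be + al * h by ring.
have -> : al * l * h = l * (al * h) by ring.
move=> K; apply: le_trans K _.
rewrite mulrAC ler_pdivrMr// -mulrA ler_wpM2l ?(ltW e0)//.
by rewrite [_ * (_ + 1)]mulrC.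
Qed.

Lemma contV_comp g a b a' b' (al be : R) :
  (forall s, a' <= s <= b' -> a <= al * s + be <= b) -> contV g a b ->
  contV (fun s => g (al * s + be)) a' b'.
Proof.
move=> E H t tab e e0; have [d d0 Hd] := H _ (E t tab) e e0.
have a1 : 0 < `|al| + 1 by rewrite ltr_wpDl.
exists (d / (`|al| + 1)); first exact: divr_gt0.
move=> s sab; rewrite ltr_pdivlMr// => st; apply: Hd; first exact: E.
have -> : al * s + be - (al * t + be) = al * (s - t) by ring.
rewrite normrM; apply: le_lt_trans st; rewrite mulrC ler_wpM2l// lerDl//.
Qed.

Lemma contR_comp F a b a' b' (al be : R) :
  (forall s, a' <= s <= b' -> a <= al * s + be <= b) -> contR F a b ->
  contR (fun s => F (al * s + be)) a' b'.
Proof.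
move=> E H t tab e e0; have [d d0 Hd] := H _ (E t tab) e e0.
have a1 : 0 < `|al| + 1 by rewrite ltr_wpDl.
exists (d / (`|al| + 1)); first exact: divr_gt0.
move=> s sab; rewrite ltr_pdivlMr// => st; apply: Hd; first exact: E.
have -> : al * s + be - (al * t + be) = al * (s - t) by ring.
rewrite normrM; apply: le_lt_trans st; rewrite mulrC ler_wpM2l// lerDl//.
Qed.

Lemma contV_scale g a b (al : R) : contV g a b -> contV (fun s => al%:C%C *: g s) a b.
Proof.
move=> H t tab e e0; have a1 : 0 < `|al| + 1 by rewrite ltr_wpDl.
have [d d0 Hd] := H t tab _ (divr_gt0 e0 a1); exists d => // s sab /(Hd s sab).
rewrite ltr_pdivlMr// => K; rewrite -scalerBr nvZ cmod_real; apply: le_lt_trans K.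
by rewrite mulrC ler_wpM2l ?nv_ge0// lerDl.
Qed.

End VectorCurves.

(** * Primitives of continuous functions on a segment *)

Section Antiderivative.
Variable R : realType.
Implicit Types (F G : R -> R) (a b t : R).

(** Clamping the argument to the segment extends [G] to a continuous function on the whole line, to
    which the fundamental theorem applies. *)
Lemma antiderivative G a b : a < b -> contR G a b ->
  exists2 F, contR F a b & forall t, a < t < b -> rder F t (G t).
Proof.
move=> ab cG.
pose clamp (t : R) := Num.max a (Num.min b t).
have clamp_in t : a <= clamp t <= b.
  by rewrite /clamp le_max lexx /= ge_max ge_min lexx (ltW ab).
have clampE t : a <= t <= b -> clamp t = t.
  by move=> /andP[h1 h2]; rewrite /clamp min_r// max_r.
have clamp_lip s t : `|clamp s - clamp t| <= `|s - t|.
  have := ler_norm (s - t); have := ler_norm (t - s); rewrite (distrC t).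
  rewrite /clamp ler_norml.
  have [h1|h1] := leP b s; have [h2|h2] := leP b t;
    rewrite ?(max_r (ltW ab)); try (have [h3|h3] := leP a s); try (have [h4|h4] := leP a t);
    lra.
pose H t := G (clamp t).
have cH : continuous H.
  move=> t; apply/cvgrPdist_lt => e e0; have [d d0 Hd] := cG _ (clamp_in t) e e0.
  apply/nbhs_normP; exists d => // s /= ts.
  rewrite distrC; apply: Hd; first exact: clamp_in.
  by apply: le_lt_trans (clamp_lip s t) _; rewrite distrC.
(* Starting at [a - 1] makes [a] an interior point, so [F] is differentiable, hence continuous, up
   to both ends of the segment. *)
pose F x := (\int[@lebesgue_measure R]_(t in `[a - 1, x]) H t)%R.
have D t : a <= t <= b -> rder F t (H t).
  move=> tab; have [] := @continuous_FTC1_closed R H (a - 1) t (b + 1).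
  - by lra.
  - apply: continuous_compact_integrable; first exact: segment_compact.
    exact: continuous_subspaceT.
  - by lra.
  - exact: cH.
  by move=> DF EF; apply/rderP; split => //; rewrite -EF derive1E.
exists F; last by move=> t tab; rewrite -[t in G t]clampE; [apply: D|]; lra.
apply/contR_within; apply: derivable_within_continuous => t; rewrite in_itv /= => tab.
by have /rderP[] := D t tab.
Qed.

Lemma contR_FTC2 G F a b : a < b -> contR G a b -> contR F a b ->
  (forall t, a < t < b -> rder F t (G t)) ->
  (\int[@lebesgue_measure R]_(t in `[a, b]) (G t)%:E = (F b - F a)%:E)%E.
Proof.
move=> ab /contR_within cG /contR_within cF D.
rewrite (continuous_FTC2 ab cG (F := F)) ?EFinB//.
  have /(continuous_within_itvP _ ab)[_ h1 h2] := cF; split => // t.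
  by rewrite in_itv /= => /D/rderP[].
by move=> t; rewrite in_itv /= => /D/rderP[_ <-]; rewrite derive1E.
Qed.

End Antiderivative.

(** * Lengths of piecewise C^1 curves *)

Section ArcLength.
Variables (R : realType) (n : nat).
Local Notation C := R[i].
Local Notation Cn := 'rV[C]_n.
Variable (bm : Cn -> Cn -> R).
Hypothesis bm_ge0 : forall z v, 0 <= bm z v.
Hypothesis bmZ : forall z (x : R) v, bm z (x%:C%C *: v) = `|x| * bm z v.
Implicit Types (g h : R -> Cn) (a b c t l : R) (F : R -> R).

(* On each C^1 piece the length is the increment of a primitive [F] of the
   speed, so that reparametrizing and splitting curves needs no change of
   variables in the Lebesgue integral. *)
Definition piece g a b l := exists dv F, [/\ contV dv a b,
  forall t, a < t < b -> vder g t (dv t), contR F a b,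
  forall t, a < t < b -> rder F t (bm (g t) (dv t)) & l = F b - F a].

(** Length is a relation, so that proofs go by induction over the pieces; [PL_integral] identifies
    [l] with the Lebesgue integral of the speed. *)
Inductive PL g : R -> R -> R -> Prop :=
| PL0 a : PL g a a 0
| PLS a b c l1 l2 : a < b -> piece g a b l1 -> PL g b c l2 -> PL g a c (l1 + l2).

Lemma PL_le g a b l : PL g a b l -> a <= b.
Proof. by elim=> {a b l} // a b c l1 l2 ab _ _; apply: le_trans; exact: ltW. Qed.

Lemma piece_ge0 g a b l : a <= b -> piece g a b l -> 0 <= l.
Proof.
move=> ab [dv [F [_ _ cF D ->]]]; rewrite subr_ge0; apply: mono_of_rder => // t tab.
by exists (bm (g t) (dv t)); [exact: D|exact: bm_ge0].
Qed.

Lemma PL_ge0 g a b l : PL g a b l -> 0 <= l.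
Proof.
by elim=> {a b l} // a b c l1 l2 ab p _ h; rewrite addr_ge0//; exact: piece_ge0 (ltW ab) p.
Qed.

Lemma PL_one g a b l : a < b -> piece g a b l -> PL g a b l.
Proof. by move=> ab p; rewrite -[l]addr0; apply: (PLS ab p); exact: PL0. Qed.

Lemma PL_cat g a b c l1 l2 : PL g a b l1 -> PL g b c l2 -> PL g a c (l1 + l2).
Proof.
elim=> {a b l1} [a|a b b' l1 l1' ab p _ IH] H; first by rewrite add0r.
by rewrite -addrA; apply: (PLS ab p); exact: IH.
Qed.

Lemma piece_split g a b t l : a < t < b -> piece g a b l ->
  exists l1 l2, [/\ piece g a t l1, piece g t b l2 & l = l1 + l2].
Proof.
move=> /andP[at_ tb] [dv [F [cdv Dg cF DF ->]]].
exists (F t - F a), (F b - F t); split; last by ring.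
- exists dv, F; split => //.
  + exact: contV_sub (lexx _) (ltW tb) cdv.
  + by move=> s sab; apply: Dg; lra.
  + exact: contR_sub (lexx _) (ltW tb) cF.
  + by move=> s sab; apply: DF; lra.
- exists dv, F; split => //.
  + exact: contV_sub (ltW at_) (lexx _) cdv.
  + by move=> s sab; apply: Dg; lra.
  + exact: contR_sub (ltW at_) (lexx _) cF.
  + by move=> s sab; apply: DF; lra.
Qed.

Lemma PL_split g a b t l : a <= t <= b -> PL g a b l ->
  exists l1 l2, [/\ PL g a t l1, PL g t b l2 & l = l1 + l2].
Proof.
move=> tab H; elim: H t tab => {a b l} [a|a b c l1 l2 ab p H IH] t tab.
  by have -> : t = a by [lra]; exists 0, 0; split; rewrite ?addr0//; exact: PL0.
have [tb|bt] := ltP t b.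
  have [->|ta] := eqVneq t a.
    by exists 0, (l1 + l2); split; rewrite ?add0r//; [exact: PL0|exact: PLS ab p H].
  have att : a < t < b by rewrite tb andbT lt_neqAle eq_sym ta; lra.
  have [k1 [k2 [p1 p2 ->]]] := piece_split att p.
  case/andP: att => a1 _.
  exists k1, (k2 + l2); split; last by ring.
    exact: PL_one.
  exact: PLS tb p2 H.
have [k1 [k2 [p1 p2 ->]]] := IH t ltac:(lra).
by exists (l1 + k1), k2; split; [exact: PLS ab p p1|exact: p2|ring].
Qed.

Lemma piece_ext g h a b l : (forall t, a < t < b -> g t = h t) -> piece g a b l -> piece h a b l.
Proof.
move=> E [dv [F [cdv Dg cF DF lE]]]; exists dv, F; split => // t tab.
  by apply: (vder_eq_oo tab E); exact: Dg.
by rewrite -E//; exact: DF.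
Qed.

Lemma PL_ext g h a b l : (forall t, a < t < b -> g t = h t) -> PL g a b l -> PL h a b l.
Proof.
move=> E H; elim: H E => {a b l} [a|a b c l1 l2 ab p H IH] E; first exact: PL0.
have bc := PL_le H.
apply: (PLS ab); first by apply: piece_ext p => t tab; apply: E; lra.
by apply: IH => t tab; apply: E; lra.
Qed.

Lemma piece_affine g (al be a b : R) l : 0 < al -> piece g (al * a + be) (al * b + be) l ->
  piece (fun t => g (al * t + be)) a b l.
Proof.
move=> al0 [dv [F [cdv Dg cF DF lE]]].
have mono s : a <= s <= b -> al * a + be <= al * s + be <= al * b + be.
  by move=> sab; rewrite !lerD2r !ler_pM2l.
have monos s : a < s < b -> al * a + be < al * s + be < al * b + be.
  by move=> sab; rewrite !ltrD2r !ltr_pM2l.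
exists (fun t => al%:C%C *: dv (al * t + be)), (fun t => F (al * t + be)); split => //.
- by apply: contV_scale; exact: contV_comp mono cdv.
- by move=> t /monos/Dg; exact: vder_affine.
- exact: contR_comp mono cF.
- by move=> t /monos/DF/rder_affine; rewrite bmZ gtr0_norm.
Qed.

Lemma PL_affine g (al be a b : R) l : 0 < al -> PL g (al * a + be) (al * b + be) l ->
  PL (fun t => g (al * t + be)) a b l.
Proof.
move=> al0; move Ea : (al * a + be) => a'; move Eb : (al * b + be) => b' H.
elim: H a Ea b Eb => {a' b' l} [a'|a' b' c' l1 l2 ab p H IH] a Ea b Eb.
  have -> : b = a by move: Ea; rewrite -Eb => /addIr/(mulfI (lt0r_neq0 al0)).
  exact: PL0.
pose m := (b' - be) / al.
have Em : al * m + be = b' by rewrite /m; field; rewrite gt_eqF.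
have am : a < m by move: ab; rewrite -Ea -Em ltrD2r ltr_pM2l.
apply: (PLS am); last exact: (IH _ Em _ Eb).
by apply: piece_affine => //; rewrite Ea Em.
Qed.

Lemma piece_rev g c a b l : piece g a b l -> piece (fun t => g (c - t)) (c - b) (c - a) l.
Proof.
move=> [dv [F [cdv Dg cF DF lE]]].
have E t : c - t = -1 * t + c by ring.
have mono s : c - b <= s <= c - a -> a <= -1 * s + c <= b by lra.
have monos s : c - b < s < c - a -> a < -1 * s + c < b by lra.
have gE : (fun t => g (c - t)) = (fun t => g (-1 * t + c)) by apply/funext => t; rewrite E.
rewrite gE; exists (fun t => (-1)%:C%C *: dv (-1 * t + c)), (fun t => - F (-1 * t + c)); split.
- by apply: contV_scale; exact: contV_comp mono cdv.
- by move=> t /monos/Dg; exact: vder_affine.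
- have cc := contR_comp mono cF.
  move=> t tab e e0; have [d d0 Hd] := cc t tab e e0; exists d => // s sab /(Hd s sab).
  by rewrite -opprD normrN.
- move=> t /monos/DF/rder_affine/rderP H; apply/rderP.
  rewrite bmZ normrN normr1; set X := bm _ _ in H *.
  have -> : 1 * X = - (-1 * X) by ring.
  exact: is_deriveN.
- have -> : -1 * (c - a) + c = a by ring.
  have -> : -1 * (c - b) + c = b by ring.
  by rewrite lE; ring.
Qed.

Lemma PL_rev g c a b l : PL g a b l -> PL (fun t => g (c - t)) (c - b) (c - a) l.
Proof.
elim=> {a b l} [a|a b d l1 l2 ab p _ IH]; first exact: PL0.
rewrite (addrC l1); apply: (PL_cat IH); apply: PL_one; first by rewrite ltrD2l ltrN2.
exact: piece_rev.
Qed.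

Lemma PL_C1V g a b l : PL g a b l -> exists (k : nat) (p : nat -> R), [/\ p 0%N = a, p k = b,
  forall i, (i < k)%N -> p i < p i.+1 & forall i, (i < k)%N -> C1V g (p i) (p i.+1)].
Proof.
elim=> {a b l} [a|a b c l1 l2 ab [dv [F [cdv Dg _ _ _]]] _ [k [p [p0 pk pm pC]]]].
  by exists 0%N, (fun=> a); split.
exists k.+1, (fun i => if i is i'.+1 then p i' else a); split => //.
  by move=> [|i] ik; [rewrite p0|exact: pm].
move=> [|i] ik; last exact: pC.
by exists dv; rewrite /= ?p0.
Qed.

Section Continuous.
Variable O : set Cn.
Hypothesis bm_cont : forall z v, O z -> forall e : R, 0 < e -> exists2 d : R, 0 < d &
  forall w x, nv (w - z) < d -> nv (x - v) < d -> `|bm w x - bm z v| < e.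

Definition curve g a b := contV g a b /\ forall t, a <= t <= b -> O (g t).

Lemma curve_sub g a b a' b' : a <= a' -> b' <= b -> curve g a b -> curve g a' b'.
Proof.
move=> aa bb [c h]; split; first exact: contV_sub aa bb c.
by move=> t tab; apply: h; lra.
Qed.

Lemma contR_speed g dv a b : curve g a b -> contV dv a b -> contR (fun t => bm (g t) (dv t)) a b.
Proof.
move=> [cg gO] cdv t tab e e0; have [d d0 Hd] := bm_cont (dv t) (gO t tab) e0.
have [d1 d10 H1] := cg t tab d d0; have [d2 d20 H2] := cdv t tab d d0.
exists (Num.min d1 d2); first by rewrite lt_min d10.
by move=> s sab; rewrite lt_min => /andP[/(H1 s sab) h1 /(H2 s sab) h2]; exact: Hd.
Qed.

Lemma C1V_piece g a b : a < b -> curve g a b -> C1V g a b -> exists l, piece g a b l.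
Proof.
move=> ab cg [dv cdv Dg]; have [F cF DF] := antiderivative ab (contR_speed cg cdv).
by exists (F b - F a), dv, F.
Qed.

Lemma C1V_PL g a (k : nat) (p : nat -> R) : curve g a (p k) -> p 0%N = a ->
  (forall i, (i < k)%N -> p i < p i.+1) -> (forall i, (i < k)%N -> C1V g (p i) (p i.+1)) ->
  exists l, PL g a (p k) l.
Proof.
elim: k a p => [|k IH] a p cg p0 pm pC; first by exists 0; rewrite p0; exact: PL0.
have ple i : (i <= k)%N -> p 1%N <= p i.+1.
  elim: i => [//|i IHi] ik; apply: le_trans (IHi (ltnW ik)) _; apply: ltW; exact: pm.
have p01 : a < p 1%N by rewrite -p0; exact: pm.
have [l1 H1] := C1V_piece p01 (curve_sub (lexx _) (ple k (leqnn _)) cg) ltac:(rewrite -p0; exact: pC).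
have cg' := curve_sub (ltW p01) (lexx _) cg.
have [l2 H2] := IH (p 1%N) (fun i => p i.+1) cg' erefl (fun i ik => pm i.+1 ik) (fun i ik => pC i.+1 ik).
by exists (l1 + l2); exact: PLS p01 H1 H2.
Qed.

Definition speed g (t : R) : \bar R := (bm (g t) (cvel g t))%:E.

Lemma piece_integral g a b l : a < b -> curve g a b -> piece g a b l ->
  measurable_fun `[a, b] (speed g) /\
  (\int[@lebesgue_measure R]_(t in `[a, b]) speed g t = l%:E)%E.
Proof.
move=> ab cg [dv [F [cdv Dg cF DF ->]]].
have cG := contR_speed cg cdv; set G := fun t => bm (g t) (dv t) in cG DF.
have mG : measurable_fun `[a, b] (EFin \o G).
  apply/measurable_EFinP; apply: subspace_continuous_measurable_fun => //.
  exact/contR_within.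
(* At the break points [cvel] may differ from the continuous velocity [dv] of the piece; agreement
   on the open interval suffices for the integral. *)
have E t : `]a, b[%classic t -> speed g t = (EFin \o G) t.
  by rewrite /= in_itv /= => tab; rewrite /speed /G (vder_cvel (Dg t tab)).
have mo : measurable_fun `]a, b[ (speed g).
  apply: (@eq_measurable_fun _ _ _ _ _ (EFin \o G)) => [t|].
    by rewrite inE => /E.
  by apply: measurable_funS mG => //; exact: subset_itv_oo_cc.
split; first exact: emeasurable_fun_itv_cc mo.
rewrite integral_itv_bndoo// -(contR_FTC2 ab cG cF DF).
rewrite [RHS]integral_itv_bndoo; last by apply: measurable_funS mG => //; exact: subset_itv_oo_cc.
by apply: eq_integral => t; rewrite inE => /E.
Qed.

Lemma PL_integral g a b l : curve g a b -> PL g a b l ->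
  measurable_fun `[a, b] (speed g) /\
  (\int[@lebesgue_measure R]_(t in `[a, b]) speed g t = l%:E)%E.
Proof.
move=> cg H; elim: H cg => {a b l} [a|a b c l1 l2 ab p H IH] cg.
  by rewrite set_itv1 integral_set1; split => //; exact: measurable_fun_set1.
have bc := PL_le H.
have [m1 i1] := piece_integral ab (curve_sub (lexx _) bc cg) p.
have [m2 i2] := IH (curve_sub (ltW ab) (lexx _) cg).
have E : (`[a, c] = `[a, b[ `|` `[b, c])%classic.
  by apply: itv_bndbnd_setU; rewrite bnd_simp// ltW.
have m1' : measurable_fun `[a, b[ (speed g).
  by apply: measurable_funS m1 => //; apply: subset_itvl; rewrite bnd_simp.
have mU : measurable_fun (`[a, b[ `|` `[b, c])%classic (speed g).
  by apply/measurable_funU.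
split; first by rewrite E.
rewrite E ge0_integral_setU//=.
- by rewrite integral_itv_bndo_bndc// i1 i2 EFinD.
- by move=> t _; rewrite lee_fin.
- apply/disj_setPS => t [] /=; rewrite !in_itv /= => h1 h2; lra.
Qed.

End Continuous.
End ArcLength.

(** * Continuous induction along a segment *)

Section FirstExit.
Variable R : realType.

(** The time [T] is the supremum of the times up to which [P] has held throughout. [P] passes to the
    supremum, and before [b] it could be prolonged unless the exit condition [E] holds there. *)
Lemma first_exit (P E : R -> Prop) (a b : R) : a <= b -> P a ->
  (forall t, a < t <= b -> (forall s, a <= s < t -> P s) -> P t) ->
  (forall t, a <= t < b -> P t -> ~ E t ->
     exists2 d : R, 0 < d & forall s, t < s < t + d -> s <= b -> P s) ->
  exists T, [/\ a <= T <= b, forall s, a <= s <= T -> P s & T = b \/ E T].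
Proof.
move=> ab Pa cl op.
pose S := [set t | a <= t <= b /\ forall s, a <= s <= t -> P s].
have Sa : S a.
  split; first by rewrite lexx.
  by move=> s sa; have -> : s = a by [lra].
have ubS : has_ubound S by exists b => t [/andP[]].
pose T := sup S.
have aT : a <= T by exact: ub_le_sup.
have Tb : T <= b by apply: ge_sup; [exists a|move=> t [/andP[]]].
have below s : a <= s < T -> P s.
  move=> /andP[as_ sT]; have sT' : 0 < T - s by rewrite subr_gt0.
  have [t [_ Pt] st] := @sup_adherent _ S _ sT' (conj (ex_intro _ a Sa) ubS).
  by apply: Pt; rewrite as_ /=; move: st; rewrite -/T; lra.
have PT : P T.
  have [<-//|aT'] := eqVneq a T.
  by apply: cl => //; rewrite lt_neqAle aT' aT.
have ST s : a <= s <= T -> P s.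
  move=> /andP[as_]; rewrite le_eqVlt => /predU1P[->//|sT].
  by apply: below; rewrite as_.
exists T; split => //; first by rewrite aT.
apply: contrapT => /not_orP[/eqP Tb' nE].
have {}Tb' : T < b by rewrite lt_neqAle Tb' Tb.
have [|d d0 Hd] := op T _ PT nE; first by rewrite aT.
pose T' := Num.min (T + d / 2) b.
have TT' : T < T' by rewrite lt_min Tb' andbT ltrDl divr_gt0.
have T'b : T' <= b by rewrite ge_min lexx orbT.
have T'd : T' <= T + d / 2 by rewrite ge_min lexx.
have : T' <= T.
  apply: ub_le_sup => //; split; first by rewrite T'b (le_trans aT (ltW TT')).
  move=> s /andP[as_ sT']; have [sT|Ts] := leP s T; first by apply: ST; rewrite as_.
  by apply: Hd; lra.
by rewrite leNgt TT'.
Qed.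

End FirstExit.

(** * Estimates and comparison of lengths *)

Section CurvePieces.
Variables (R : realType) (n : nat).
Local Notation C := R[i].
Local Notation Cn := 'rV[C]_n.
Implicit Types (g h : R -> Cn) (a b c t l : R) (F : R -> R).

Lemma contV_ext g h a b : (forall t, a <= t <= b -> g t = h t) -> contV g a b -> contV h a b.
Proof.
move=> E H t tab e e0; have [d d0 Hd] := H t tab e e0; exists d => // s sab st.
by rewrite -!E//; exact: Hd.
Qed.

Lemma contV_cat g a b c : contV g a b -> contV g b c -> contV g a c.
Proof.
move=> H1 H2 t tac e e0; have [tb|bt|tb] := ltgtP t b.
- have [|d d0 Hd] := H1 t _ e e0; first by lra.
  exists (Num.min d (b - t)); first by rewrite lt_min d0 subr_gt0.
  move=> s sac; rewrite lt_min => /andP[sd]; rewrite ltr_norml => sb; apply: Hd => //; lra.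
- have [|d d0 Hd] := H2 t _ e e0; first by lra.
  exists (Num.min d (t - b)); first by rewrite lt_min d0 subr_gt0.
  move=> s sac; rewrite lt_min => /andP[sd]; rewrite ltr_norml => sb; apply: Hd => //; lra.
- have [|d1 d10 Hd1] := H1 t _ e e0; first by lra.
  have [|d2 d20 Hd2] := H2 t _ e e0; first by lra.
  exists (Num.min d1 d2); first by rewrite lt_min d10.
  move=> s sac; rewrite lt_min => /andP[sd1 sd2].
  have [sb|bs] := leP s b; [apply: Hd1|apply: Hd2] => //; lra.
Qed.

Lemma contV_cst (z : Cn) a b : contV (fun=> z) a b.
Proof. by move=> t _ e e0; exists 1 => // s _ _; rewrite subrr nv0. Qed.

Lemma contR_scale F a b c : contR F a b -> contR (fun t => c * F t) a b.
Proof.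
move=> H t tab e e0; have c1 : 0 < `|c| + 1 by rewrite ltr_wpDl.
have [d d0 Hd] := H t tab _ (divr_gt0 e0 c1); exists d => // s sab /(Hd s sab).
rewrite ltr_pdivlMr// => K; rewrite -mulrBr normrM; apply: le_lt_trans K.
by rewrite mulrC ler_wpM2l// lerDl.
Qed.

Lemma contR_id a b : contR id a b.
Proof. by move=> t _ e e0; exists e. Qed.

Lemma rder_scale F t l c : rder F t l -> rder (fun t => c * F t) t (c * l).
Proof. by move=> /rderP H; apply/rderP; exact: is_deriveZ. Qed.

Lemma rder_id t : rder id t 1.
Proof. by move=> e e0; exists 1 => // h _; rewrite /= (_ : t + h - t - 1 * h = 0) ?normr0 ?mulr_ge0 ?(ltW e0)//; ring. Qed.

Lemma contV_nv g z a b : contV g a b -> contR (fun t => nv (g t - z)) a b.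
Proof.
move=> H t tab e e0; have [d d0 Hd] := H t tab e e0; exists d => // s sab /(Hd s sab).
apply: le_lt_trans; rewrite ler_norml.
by have := nv_tri (g s) (g t) z; have := nv_tri (g t) (g s) z; rewrite (nvB (g t) (g s)); lra.
Qed.

Section Length.
Variable bm : Cn -> Cn -> R.
Hypothesis bm_ge0 : forall z v, 0 <= bm z v.

Lemma PL_le_speed g a b l (B : R) : PL bm g a b l ->
  (forall t, a < t < b -> bm (g t) (cvel g t) <= B) -> l <= B * (b - a).
Proof.
elim=> {a b l} [a|a b c l1 l2 ab [dv [F [cdv Dg cF DF ->]]] H IH] bnd.
  by rewrite subrr mulr0.
have bc := PL_le H.
have {}IH := IH (fun t tbc => bnd t ltac:(lra)).
have := @mean_value_ineq R F (fun t => B * t) a b (ltW ab) cF (contR_scale B (@contR_id a b)).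
have := ler_norm (F b - F a); set N := `| _ | => h K.
suff : N <= B * b - B * a by lra.
apply: K => t tab; exists (bm (g t) (dv t)), (B * 1); split; first exact: DF.
  by apply: rder_scale; exact: rder_id.
by rewrite ger0_norm// mulr1 -(vder_cvel (Dg t tab)); apply: bnd; lra.
Qed.

Lemma PL_ge_coord g a b l (c : R) : 0 <= c -> PL bm g a b l -> contV g a b ->
  (forall t v, a <= t <= b -> c * nv v <= bm (g t) v) ->
  forall j s, c * `|ccoord g j s b - ccoord g j s a| <= l.
Proof.
move=> c0; elim=> {a b l} [a|a b d l1 l2 ab [dv [F [cdv Dg cF DF ->]]] H IH] cg bnd j s.
  by rewrite subrr normr0 mulr0.
have bd := PL_le H.
have {}IH := IH (contV_sub (ltW ab) (lexx _) cg) (fun t v tbc => bnd t v ltac:(lra)) j s.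
have cg1 := contV_sub (lexx _) bd cg.
have := @mean_value_ineq R (fun t => c * ccoord g j s t) F a b (ltW ab).
rewrite -mulrBr normrM (ger0_norm c0) => K.
have : c * `|ccoord g j s b - ccoord g j s a| <= F b - F a.
  apply: K => //; first by apply: contR_scale; exact: (contV_coord g a b).1.
  move=> t tab; exists (c * (if s then complex.Re (dv t 0 j) else complex.Im (dv t 0 j))), (bm (g t) (dv t)).
  split; [by apply: rder_scale; exact: (vder_coord g t _).1 (Dg t tab) j s|exact: DF|].
  apply: le_trans (bnd t _ _); last by lra.
  rewrite normrM (ger0_norm c0) ler_wpM2l//; apply: le_trans (nv_coord _ j).
  by case: s {IH}; [exact: Re_le_cmod|exact: Im_le_cmod].
have -> : ccoord g j s d - ccoord g j s a = (ccoord g j s d - ccoord g j s b) +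
   (ccoord g j s b - ccoord g j s a) by ring.
have := ler_wpM2l c0 (ler_normD (ccoord g j s d - ccoord g j s b) (ccoord g j s b - ccoord g j s a)).
by rewrite mulrDr; lra.
Qed.

(** The norm of the displacement is the modulus of one coordinate, whose real and imaginary parts
    each move by at most [l / c]; hence the factor 2. *)
Lemma PL_ge g a b l (c : R) : 0 <= c -> PL bm g a b l -> contV g a b ->
  (forall t v, a <= t <= b -> c * nv v <= bm (g t) v) -> c / 2 * nv (g b - g a) <= l.
Proof.
move=> c0 H cg bnd; have l0 := PL_ge0 bm_ge0 H.
have [/nv_attained[j ->]|] := ltP 0 (nv (g b - g a)); last first.
  move=> h; have -> : nv (g b - g a) = 0 by apply/eqP; rewrite eq_le h nv_ge0.
  by rewrite mulr0.
have h1 := PL_ge_coord c0 H cg bnd j true; have h2 := PL_ge_coord c0 H cg bnd j false.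
have := ler_wpM2l c0 (cmod_le_ReIm ((g b - g a) 0 j)).
move: h1 h2; rewrite /ccoord !mxE ReB ImB; lra.
Qed.

End Length.

(** The curve is kept and its [bm']-length is produced piece by piece as a primitive of the
    continuous speed. *)
Lemma PL_compare (bm bm' : Cn -> Cn -> R) (O : set Cn) g a b l c :
  (forall z v, 0 <= bm' z v) ->
  (forall z v, O z -> forall e : R, 0 < e -> exists2 d : R, 0 < d &
     forall w x, nv (w - z) < d -> nv (x - v) < d -> `|bm' w x - bm' z v| < e) ->
  PL bm g a b l -> curve O g a b ->
  (forall t v, a <= t <= b -> bm' (g t) v <= c * bm (g t) v) ->
  exists2 l', PL bm' g a b l' & l' <= c * l.
Proof.
move=> bm0 cbm; elim=> {a b l} [a|a b d l1 l2 ab [dv [F [cdv Dg cF DF ->]]] H IH] cg bnd.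
  by exists 0; [exact: PL0|rewrite mulr0].
have bd := PL_le H.
have [l' H' l'l] := IH (curve_sub (ltW ab) (lexx _) cg) (fun t v tbc => bnd t v ltac:(lra)).
have cg1 := curve_sub (lexx _) bd cg.
have [G cG DG] := antiderivative ab (contR_speed cbm cg1 cdv).
exists (G b - G a + l'); first by apply: (PLS ab) H'; exists dv, G.
have := @mean_value_ineq R G (fun t => c * F t) a b (ltW ab) cG (contR_scale c cF).
have := ler_norm (G b - G a); set N := `| _ | => h K.
suff : N <= c * F b - c * F a by lra.
apply: K => t tab; exists (bm' (g t) (dv t)), (c * bm (g t) (dv t)); split; first exact: DG.
  by apply: rder_scale; exact: DF.
by rewrite ger0_norm//; apply: bnd; lra.
Qed.

End CurvePieces.

(** * The distance induced by a continuous metric *)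

Section LengthDistance.
Variables (R : realType) (n : nat).
Local Notation C := R[i].
Local Notation Cn := 'rV[C]_n.
Implicit Types (g h : R -> Cn) (a b c t l : R) (z w x y : Cn).

Record finsler (bm : Cn -> Cn -> R) (O : set Cn) : Prop := Finsler {
  fins_ge0 : forall z v, 0 <= bm z v;
  finsZ : forall z (x : R) v, bm z (x%:C%C *: v) = `|x| * bm z v;
  fins_cont : forall z v, O z -> forall e : R, 0 < e -> exists2 d : R, 0 < d &
    forall w x, nv (w - z) < d -> nv (x - v) < d -> `|bm w x - bm z v| < e;
  fins_bounds : forall L : set Cn, compact L -> L `<=` O -> exists c B : R,
    0 < c /\ 0 < B /\ forall z, L z -> forall v, c * nv v <= bm z v <= B * nv v }.

Definition joins (bm : Cn -> Cn -> R) (O : set Cn) z w l :=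
  exists g a b, [/\ curve O g a b, g a = z, g b = w & PL bm g a b l].

(** A real infimum, hence informative only for a nonempty set of lengths; [reach] provides that for
    points of a connected open set. *)
Definition ldist (bm : Cn -> Cn -> R) (O : set Cn) z w : R := inf [set l | joins bm O z w l].

Section Finsler.
Variables (bm : Cn -> Cn -> R) (O : set Cn).
Hypotheses (oO : open O) (cO : connected O) (fins : finsler bm O).
Local Notation joins := (joins bm O).
Local Notation D := (ldist bm O).

Lemma fins0 z : bm z 0 = 0.
Proof. by have := finsZ fins z 0 0; rewrite scaler0 normr0 mul0r. Qed.

Lemma joins_ge0 z w l : joins z w l -> 0 <= l.
Proof. move=> [g [a [b [_ _ _ H]]]]; exact (PL_ge0 (fins_ge0 fins) H). Qed.

Lemma joins_refl z : O z -> joins z z 0.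
Proof.
move=> Oz; exists (fun=> z), 0, 0; split => //; last exact: PL0.
by split => //; exact: contV_cst.
Qed.

Lemma joins_sym z w l : joins z w l -> joins w z l.
Proof.
move=> [g [a [b [[cg gO] ga gb H]]]].
have E t : 0 - t = -1 * t + 0 by ring.
exists (fun t => g (0 - t)), (0 - b), (0 - a); split.
- split; last by move=> t tab; apply: gO; lra.
  rewrite (_ : (fun t => _) = (fun t => g (-1 * t + 0))); last by apply/funext => t; rewrite E.
  by apply: contV_comp cg => s sab; lra.
- by rewrite opprB addrC subrK.
- by rewrite opprB addrC subrK.
- exact (PL_rev (finsZ fins) 0 H).
Qed.

Lemma joins_cat z w x l1 l2 : joins z w l1 -> joins w x l2 -> joins z x (l1 + l2).
Proof.
move=> [g [a [b [[cg gO] ga gb H1]]]] [h [c [d [[ch hO] hc hd H2]]]].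
have ab := PL_le H1; have cd := PL_le H2.
pose be := c - b; pose k t := if t <= b then g t else h (1 * t + be).
have kg t : t <= b -> g t = k t by rewrite /k => ->.
have kh t : b <= t -> h (1 * t + be) = k t.
  rewrite /k le_eqVlt => /predU1P[<-|]; last by rewrite ltNge => /negbTE ->.
  by rewrite lexx /be mul1r addrC subrK hc gb.
have E1 : 1 * b + be = c by rewrite /be; ring.
have E2 : 1 * (d - be) + be = d by ring.
have bd : b <= d - be by rewrite /be; lra.
exists k, a, (d - be); split.
- split.
    apply: (@contV_cat _ _ _ _ b).
      by apply: contV_ext cg => t /andP[_]; exact: kg.
    apply: (@contV_ext _ _ (fun t => h (1 * t + be))); first by move=> t /andP[+ _]; exact: kh.
    by apply: contV_comp ch => s; rewrite /be; lra.
  move=> t tab; have [tb|bt] := leP t b; first by rewrite -kg//; apply: gO; lra.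
  by rewrite -kh ?(ltW bt)//; apply: hO; move: tab; rewrite /be; lra.
- by rewrite -kg.
- by rewrite -kh// E2.
- apply: PL_cat.
    by apply: PL_ext H1 => t /andP[_ /ltW]; exact: kg.
  apply: (@PL_ext _ _ _ (fun t => h (1 * t + be))); first by move=> t /andP[/ltW + _]; exact: kh.
  by apply: PL_affine; rewrite ?E1 ?E2//; exact: finsZ fins.
Qed.

Lemma joins01 z w l : joins z w l -> exists g, [/\ curve O g 0 1, g 0 = z, g 1 = w & PL bm g 0 1 l].
Proof.
move=> [g [a [b [[cg gO] ga gb H]]]]; have := PL_le H.
rewrite le_eqVlt => /predU1P[ab|ab].
  (* A degenerate interval cannot be stretched to the unit one, so the curve is replaced by a
     constant. *)
  have Oz : O z by rewrite -ga; apply: gO; rewrite lexx ab /=.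
  have l0 : l = 0 by case: H ab => // a' b' c l1 l2 ab' _ /PL_le; lra.
  exists (fun=> z); split => //; first by split => //; exact: contV_cst.
    by rewrite -ga ab.
  rewrite l0; apply: PL_one; first exact: ltr01.
  have c0 : contR (fun=> 0 : R) 0 1 by move=> t _ e e0; exists 1 => // s _ _; rewrite subrr normr0.
  exists (fun=> 0), (fun=> 0); split => //; [exact: contV_cst| | |by rewrite subrr].
    by move=> t _ e e0; exists 1 => // k _; rewrite subrr scaler0 subr0 nv0 mulr_ge0 ?(ltW e0).
  by move=> t _ e e0; exists 1 => // k _; rewrite fins0 mul0r !subr0 normr0 mulr_ge0 ?(ltW e0).
have Ea : (b - a) * 0 + a = a by ring.
have Eb : (b - a) * 1 + a = b by ring.
have ba : 0 < b - a by rewrite subr_gt0.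
exists (fun t => g ((b - a) * t + a)); split; rewrite ?Ea ?Eb//.
  have m t : 0 <= t <= 1 -> a <= (b - a) * t + a <= b by move=> ?; nra.
  by split; [exact: contV_comp m cg|move=> t /m; exact: gO].
by apply: PL_affine; rewrite ?Ea ?Eb//; exact: finsZ fins.
Qed.

Lemma joins_in z w l : joins z w l -> O z /\ O w.
Proof. by move=> /joins01[g [[_ gO] <- <- _]]; split; apply: gO; rewrite lexx ler01. Qed.

Lemma segment_joins z w r (B : R) : (forall x, pball z r x -> O x) ->
  (forall x v, pball z r x -> bm x v <= B * nv v) -> pball z r w ->
  exists2 l, joins z w l & l <= B * nv (w - z).
Proof.
move=> sub bnd wr; have r0 : 0 < r by apply: le_lt_trans wr; exact: nv_ge0.
pose v := w - z; pose g t := z + t%:C%C *: v.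
have gd t s : g s - g t = (s - t)%:C%C *: v.
  by rewrite /g opprD addrACA subrr add0r -scalerBl -rmorphB.
have gz t : g t - z = t%:C%C *: v by rewrite /g addrC addKr.
have gin t : 0 <= t <= 1 -> pball z r (g t).
  move=> /andP[t0 t1]; rewrite /pball /= gz nvZ cmod_real ger0_norm//.
  by apply: le_lt_trans wr; rewrite ler_piMl ?nv_ge0.
have cg : curve O g 0 1.
  split; last by move=> t /gin/sub.
  move=> t _ e e0; have v1 : 0 < nv v + 1 by rewrite ltr_wpDl ?nv_ge0.
  exists (e / (nv v + 1)); first by rewrite divr_gt0.
  move=> s _; rewrite gd nvZ cmod_real ltr_pdivlMr//; apply: le_lt_trans.
  by rewrite ler_wpM2l// lerDl.
have Dg t : vder g t v.
  move=> e e0; exists 1 => // k _; rewrite gd addrAC subrr add0r subrr nv0.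
  by rewrite mulr_ge0 ?(ltW e0).
have [|l Hl] := C1V_piece (fins_cont fins) ltr01 cg.
  by exists (fun=> v); [exact: contV_cst|].
have PLl := PL_one ltr01 Hl.
exists l.
  exists g, 0, 1; split => //; rewrite /g ?rmorph0 ?rmorph1 ?scale0r ?addr0// scale1r.
  by rewrite /v addrC subrK.
have := @PL_le_speed _ _ bm (fins_ge0 fins) g 0 1 l (B * nv v) PLl; rewrite subr0 mulr1; apply.
by move=> t /andP[/ltW t0 /ltW t1]; rewrite (vder_cvel (Dg t)); apply: bnd; apply: gin; rewrite t0.
Qed.

Lemma local_upper z : O z -> exists r B : R, [/\ 0 < r, 0 < B, pball z r `<=` O &
  forall x w, pball z r x -> pball z r w -> exists2 l, joins x w l & l <= B * nv (w - x)].
Proof.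
move=> Oz; have [r r0 sub] := open_cball oO Oz.
have [c [B [_ [B0 bnd]]]] := fins_bounds fins (compact_cball (z:=z) (ltW r0)) sub.
(* Two points of the ball of radius [r / 3] are less than [2 * r / 3] apart, and the ball of that
   radius about the first stays within [r] of [z]. *)
have r30 : 0 < r / 3 by rewrite divr_gt0.
exists (r / 3), B; split => //.
  by move=> w; rewrite /pball /= => wr; apply: sub; rewrite /cball /=; lra.
move=> x w xr wr.
have inb y : pball x (2 * r / 3) y -> cball z r y.
  by move: xr; rewrite /pball /cball /=; have := nv_tri y x z; lra.
apply: (@segment_joins x w (2 * r / 3)).
- by move=> y /inb/sub.
- by move=> y v /inb/bnd/(_ v)/andP[].
- by move: xr wr; rewrite /pball /=; have := nv_tri w z x; rewrite (nvB z x); lra.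
Qed.

(** Connectedness: the set of points reachable from [z] is open and relatively closed in [O],
    because nearby points are joined by segments. *)
Lemma reach z w : O z -> O w -> exists l, joins z w l.
Proof.
move=> Oz Ow; pose A := [set x | exists l, joins z x l].
have AO : A `<=` O by move=> x [l /joins_in[]].
suff AE : A = O by suff : A w by []; rewrite AE.
apply: cO.
- by exists z, 0; exact: joins_refl.
- exists A; last by rewrite setIidr.
  rewrite openE => x [l zx]; have [_ Ox] := joins_in zx.
  have [r [B [r0 _ sub H]]] := local_upper Ox.
  apply/nbhs_nvP; exists r => // y yr; have [l' xy _] := H x y (pball_center x r0) yr.
  by exists (l + l'); exact: joins_cat zx xy.
- exists (closure A); first exact: closed_closure.
  apply/seteqP; split=> [x Ax|x [Ox cx]]; first by split; [exact: AO|exact: subset_closure].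
  have [r [B [r0 _ sub H]]] := local_upper Ox.
  have [y [[l zy] yr]] := cx (pball x r) ltac:(by apply/nbhs_nvP; exists r).
  have [l' yx _] := H y x yr (pball_center x r0).
  by exists (l + l'); exact: joins_cat zy yx.
Qed.

Lemma ldist_le z w l : joins z w l -> D z w <= l.
Proof. by move=> H; apply: ge_inf => //; exists 0 => k /joins_ge0. Qed.

Lemma ldist_approx z w e : O z -> O w -> 0 < e -> exists2 l, joins z w l & l < D z w + e.
Proof.
move=> Oz Ow e0; have [l0 H0] := reach Oz Ow.
have hi : has_inf [set l | joins z w l].
  by split; [exists l0|exists 0 => k /joins_ge0].
by have [l Hl le] := inf_adherent e0 hi; exists l.
Qed.

Lemma ldist_ge z w m : O z -> O w -> (forall l, joins z w l -> m <= l) -> m <= D z w.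
Proof.
move=> Oz Ow H; apply/ler_addgt0Pr => e e0; have [l /H ml le] := ldist_approx Oz Ow e0.
by apply: ltW; apply: le_lt_trans le.
Qed.

Lemma ldist_ge0 z w : O z -> O w -> 0 <= D z w.
Proof. by move=> Oz Ow; apply: ldist_ge => // l /joins_ge0. Qed.

Lemma ldist_refl z : O z -> D z z = 0.
Proof.
by move=> Oz; apply/eqP; rewrite eq_le ldist_ge0// andbT; apply: ldist_le; exact: joins_refl.
Qed.

Lemma ldist_sym z w : O z -> O w -> D z w = D w z.
Proof.
move=> Oz Ow; apply/eqP; rewrite eq_le; apply/andP; split; apply: ldist_ge => // l /joins_sym.
  exact: ldist_le.
exact: ldist_le.
Qed.

Lemma ldist_tri z w x : O z -> O w -> O x -> D z x <= D z w + D w x.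
Proof.
move=> Oz Ow Ox; apply/ler_addgt0Pr => e e0; have e2 : 0 < e / 2 by rewrite divr_gt0.
have [l1 H1 h1] := ldist_approx Oz Ow e2; have [l2 H2 h2] := ldist_approx Ow Ox e2.
have := ldist_le (joins_cat H1 H2); lra.
Qed.

Lemma ldist_continuous z x e : O z -> O x -> 0 < e -> exists2 d : R, 0 < d &
  forall y, pball x d y -> O y /\ D x y < e /\ `|D z y - D z x| < e.
Proof.
move=> Oz Ox e0; have [r [B [r0 B0 sub H]]] := local_upper Ox.
exists (Num.min r (e / B)); first by rewrite lt_min r0 divr_gt0.
move=> y; rewrite /pball /= lt_min ltr_pdivlMr// => /andP[yr ye].
have Oy := sub y yr.
have [l xy lB] := H x y (pball_center x r0) yr.
have Dxy : D x y < e by apply: le_lt_trans (ldist_le xy) _; apply: le_lt_trans lB _; rewrite mulrC.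
do 2 split => //.
have := ldist_tri Oz Ox Oy; have := ldist_tri Oz Oy Ox; rewrite (ldist_sym Oy Ox) ltr_norml; lra.
Qed.

(** A curve from [z] is followed until it ends or first reaches the sphere of radius [r]; up to then
    the metric dominates a multiple of the norm. *)
Lemma ldist_lower z r : 0 < r -> cball z r `<=` O -> exists2 c : R, 0 < c &
  forall w, O w -> c * Num.min r (nv (w - z)) <= D z w.
Proof.
move=> r0 sub; have [c [B [c0 [_ bnd]]]] := fins_bounds fins (compact_cball (z:=z) (ltW r0)) sub.
have Oz : O z by apply: sub; rewrite /cball /= subrr nv0 ltW.
exists (c / 2); first by rewrite divr_gt0.
move=> w Ow; apply: ldist_ge => // l /joins01[g [[cg gO] g0 g1 H]].
have cn := contV_nv z cg.
have [|||T [T01 PT TE]] := @first_exit R (fun t => nv (g t - z) <= r) (fun t => nv (g t - z) = r) 0 1 ler01.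
- by rewrite g0 subrr nv0 ltW.
- move=> t t01 Pt; rewrite leNgt; apply/negP => rt.
  have [d d0 Hd] := cn t ltac:(lra) (nv (g t - z) - r) ltac:(by rewrite subr_gt0).
  pose s := Num.max 0 (t - d / 2).
  have st : s < t by rewrite gt_max; apply/andP; split; lra.
  have s0 : 0 <= s by rewrite le_max lexx.
  have sd : t - d / 2 <= s by rewrite le_max lexx orbT.
  have := Hd s ltac:(lra) ltac:(rewrite ltr_norml; lra).
  have := Pt s ltac:(lra); rewrite ltr_norml; lra.
- move=> t t01 Pt /eqP nE; have lt : nv (g t - z) < r by rewrite lt_neqAle nE Pt.
  have [d d0 Hd] := cn t ltac:(lra) (r - nv (g t - z)) ltac:(by rewrite subr_gt0).
  exists d => // s sd s1; have := Hd s ltac:(lra) ltac:(rewrite ltr_norml; lra).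
  by rewrite ltr_norml; lra.
have [l1 [l2 [H1 H2 ->]]] := PL_split T01 H.
have /andP[T0 T1] := T01.
have := @PL_ge _ _ bm (fins_ge0 fins) g 0 T l1 c (ltW c0) H1 (contV_sub (lexx _) T1 cg).
move=> /(_ (fun t v tT => ltac:(by have /andP[] := bnd (g t) (PT t tT) v))).
have l20 := PL_ge0 (fins_ge0 fins) H2.
rewrite g0 => K; apply: (@le_trans _ _ (c / 2 * nv (g T - z))); last by lra.
rewrite ler_wpM2l ?divr_ge0 ?(ltW c0)//.
by case: TE => [->|->]; rewrite ge_min ?g1 ?lexx ?orbT.
Qed.

End Finsler.
End LengthDistance.

(** * Precompactness of balls in a complete domain *)

Section HopfRinow.
Variables (R : realType) (n : nat).
Local Notation C := R[i].
Local Notation Cn := 'rV[C]_n.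
Variables (bm : Cn -> Cn -> R) (O : set Cn).
Hypotheses (oO : open O) (cO : connected O) (fins : finsler bm O).
Local Notation joins := (joins bm O).
Local Notation D := (ldist bm O).
Implicit Types (x y z w p : Cn) (r s : R).

Definition precompact_ball x r :=
  exists L : set Cn, [/\ compact L, L `<=` O & forall y, O y -> D x y <= r -> L y].

Lemma precompact_ball_sub p x r s : O p -> O x -> D p x + r <= s ->
  precompact_ball p s -> precompact_ball x r.
Proof.
move=> Op Ox h [L [cL LO H]]; exists L; split => // y Oy xy; apply: H => //.
by have := ldist_tri oO cO fins Op Ox Oy; lra.
Qed.

Lemma precompact_ball_local p : O p -> exists2 r : R, 0 < r & precompact_ball p r.
Proof.
move=> Op; have [r r0 sub] := open_cball oO Op.
have [c c0 H] := ldist_lower oO cO fins r0 sub.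
exists (c * (r / 2)); first by rewrite mulr_gt0// divr_gt0.
exists (cball p r); split => //; first exact: compact_cball (ltW r0).
move=> y Oy Dy; have := le_trans (H y Oy) Dy; rewrite ler_pM2l// ge_min => /orP[|]; first by lra.
by rewrite /cball /=; lra.
Qed.

Lemma ldist_curve_continuous x g (a b : R) : O x -> curve O g a b -> contR (fun t => D x (g t)) a b.
Proof.
move=> Ox [cg gO] t tab e e0.
have [d d0 Hd] := ldist_continuous oO cO fins Ox (gO t tab) e0.
have [d' d'0 Hd'] := cg t tab d d0; exists d' => // s sab /(Hd' s sab) st.
by have [_ [_]] := Hd _ st.
Qed.

(** The intermediate value theorem for the distance to [x] along an almost shortest curve to [y]. *)
Lemma ldist_split x y r e : O x -> O y -> 0 <= r -> r <= D x y -> 0 < e ->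
  exists z, [/\ O z, D x z = r & D z y < D x y - r + e].
Proof.
move=> Ox Oy r0 rxy e0; have [l H le] := ldist_approx oO cO fins Ox Oy e0.
have [g [cg g0 g1 Hg]] := joins01 fins H.
have [|T] := @IVT R (fun t => D x (g t)) 0 1 r ler01 ((contR_within _ _ _).1 (ldist_curve_continuous Ox cg)).
  by rewrite g0 g1 (ldist_refl oO cO fins Ox) le_max ge_min r0 rxy orbT.
rewrite in_itv /= => T01 DT; have [l1 [l2 [H1 H2 lE]]] := PL_split T01 Hg.
have /andP[T0 T1] := T01.
exists (g T); split => //; first exact: cg.2.
have J1 : joins x (g T) l1.
  by exists g, 0, T; split => //; exact: curve_sub (lexx _) T1 cg.
have J2 : joins (g T) y l2.
  by exists g, T, 1; split => //; exact: curve_sub T0 (lexx _) cg.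
by have := ldist_le fins J1; have := ldist_le fins J2; rewrite DT; lra.
Qed.

(** A point of the larger ball lies near a point at distance exactly [r], by [ldist_split]. Finitely
    many of the compact sets around points of the smaller ball therefore cover everything. *)
Lemma precompact_ball_step x r s : O x -> 0 <= r -> 0 < s -> precompact_ball x r ->
  (forall p, O p -> D x p <= r -> precompact_ball p s) -> precompact_ball x (r + s / 2).
Proof.
move=> Ox r0 s0 [L [cL LO HL]] loc.
(* The filter of properties of all sufficiently large compact subsets of [O]; it turns the finite
   union of compact sets into a covering argument by filters. *)
pose F : set_system (set Cn) := [set Q | exists K0 : set Cn, [/\ compact K0, K0 `<=` O &
  forall K, K0 `<=` K -> Q K]].
have FF : Filter F.
  split.
  - by exists set0; split => //; exact: compact0.
  - move=> P Q [K1 [c1 O1 H1]] [K2 [c2 O2 H2]]; exists (K1 `|` K2); split.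
    + exact: compactU.
    + by move=> y []; [exact: O1|exact: O2].
    + by move=> K K12; split; [apply: H1|apply: H2] => y yK; apply: K12; [left|right].
  - by move=> P Q PQ [K1 [c1 O1 H1]]; exists K1; split => // K /H1/PQ.
(* The radius [3 / 4 * s] leaves [s / 4] for moving the centre from [p] to [q], and it covers the
   growth [s / 2] plus the error [s / 4] of [ldist_split]. *)
have /compact_near_coveringP/(_ _ F (fun K q => O q -> D x q <= r ->
    forall y, O y -> D q y <= 3 / 4 * s -> K y) FF) := cL.
case.
  move=> p Lp; have Op := LO p Lp.
  have [pr|rp] := leP (D x p) r.
    have [Lp' [cLp LpO Hp]] := loc p Op pr.
    have [d d0 Hd] := ldist_continuous oO cO fins Ox Op (divr_gt0 s0 (ltr0n _ 4)).
    exists (pball p d, [set K | Lp' `<=` K]) => /=.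
      by split; [apply/nbhs_nvP; exists d|exists Lp'].
    move=> [q K] /= [qd LK] Oq _ y Oy qy; apply: LK; apply: Hp => //.
    have [_ [pq _]] := Hd q qd.
    by have := ldist_tri oO cO fins Op Oq Oy; lra.
  have rp' : 0 < D x p - r by rewrite subr_gt0.
  have [d d0 Hd] := ldist_continuous oO cO fins Ox Op rp'.
  exists (pball p d, setT) => /=.
    by split; [apply/nbhs_nvP; exists d|exact: filterT].
  move=> [q K] /= [qd _] Oq xq; have [_ [_]] := Hd q qd.
  by rewrite ltr_norml; lra.
move=> K0 [cK0 K0O HK0]; exists K0; split => // y Oy xy.
have [yr|ry] := leP (D x y) r.
  by apply: (HK0 K0 _ y) => //; [exact: HL|rewrite (ldist_refl oO cO fins Oy); lra].
have [z [Oz xz zy]] := ldist_split Ox Oy r0 (ltW ry) (divr_gt0 s0 (ltr0n _ 4)).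
by apply: (HK0 K0 _ z) => //; [apply: HL; rewrite ?xz|rewrite xz|lra].
Qed.

(** If all balls of radius [r / 2] centred in the ball were precompact, two steps of size [r / 4]
    from radius [r / 2] would reach [r]. *)
Lemma precompact_ball_half x r : O x -> 0 < r -> ~ precompact_ball x r ->
  exists y, [/\ O y, D x y <= r & ~ precompact_ball y (r / 2)].
Proof.
move=> Ox r0 bad; apply: contrapT => H.
have good y : O y -> D x y <= r -> precompact_ball y (r / 2).
  by move=> Oy xy; apply: contrapT => h; apply: H; exists y.
have g1 : precompact_ball x (r / 2).
  by apply: good => //; rewrite (ldist_refl oO cO fins Ox) ltW.
have r2 : 0 < r / 2 by rewrite divr_gt0.
have g2 : precompact_ball x (r / 2 + r / 2 / 2).
  by apply: precompact_ball_step => //; [exact: ltW|move=> p Op xp; apply: good => //; lra].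
apply: bad.
have -> : r = r / 2 + r / 2 / 2 + r / 2 / 2 by field.
by apply: precompact_ball_step => //; [lra|move=> p Op xp; apply: good => //; lra].
Qed.

(* Hopf-Rinow: a non-precompact ball would contain the centre of a
   non-precompact ball of half the radius, and iterating yields a Cauchy
   sequence contradicting the local compactness at its limit. *)
Lemma hopf_rinow :
  (forall u : nat -> Cn, (forall k, O (u k)) ->
     (forall e : R, 0 < e -> exists N, forall m k, (N <= m)%N -> (N <= k)%N -> D (u m) (u k) < e) ->
     exists2 p, O p & forall e : R, 0 < e -> exists N, forall k, (N <= k)%N -> D (u k) p < e) ->
  forall x r, O x -> 0 < r -> precompact_ball x r.
Proof.
move=> complete x r Ox r0; apply: contrapT => bad.
have /choice[f Hf] : forall q : Cn * R, exists y, O q.1 -> 0 < q.2 -> ~ precompact_ball q.1 q.2 ->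
    [/\ O y, D q.1 y <= q.2 & ~ precompact_ball y (q.2 / 2)].
  move=> [z s]; have [h|h] := pselect (O z /\ 0 < s /\ ~ precompact_ball z s); last first.
    by exists z => /= Oz sz bz; case: h.
  by case: h => Oz [sz bz]; have [y Hy] := precompact_ball_half Oz sz bz; exists y.
pose rk k : R := r * (2^-1) ^+ k.
have rk0 k : 0 < rk k by rewrite mulr_gt0// exprn_gt0// invr_gt0.
have rkS k : rk k.+1 = rk k / 2 by rewrite /rk exprSr mulrA.
pose u := fix u k := if k is k'.+1 then f (u k', rk k') else x.
have Hu k : O (u k) /\ ~ precompact_ball (u k) (rk k).
  elim: k => [|k [Ok bk]]; first by rewrite /rk expr0 mulr1.
  by rewrite rkS; have [] := Hf (u k, rk k) Ok (rk0 k) bk.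
have Ou k : O (u k) by case: (Hu k).
have Du k : D (u k) (u k.+1) <= rk k.
  by have [Ok bk] := Hu k; have [] := Hf (u k, rk k) Ok (rk0 k) bk.
(* Telescoping, as [rk k] is twice [rk k - rk k.+1]. *)
have Dj N j : D (u N) (u (N + j)%N) <= 2 * (rk N - rk (N + j)%N).
  elim: j => [|j IH]; first by rewrite addn0 (ldist_refl oO cO fins (Ou N)) subrr mulr0.
  have := ldist_tri oO cO fins (Ou N) (Ou (N + j)%N) (Ou (N + j).+1).
  by have := Du (N + j)%N; rewrite addnS rkS; lra.
have [|p Op cvp] := complete u Ou.
  move=> e e0; have [N HN] := @exists_pow2_lt R (e / (4 * r)) ltac:(by rewrite divr_gt0// mulr_gt0).
  have rN : 4 * rk N < e by move: HN; rewrite ltr_pdivlMr ?mulr_gt0// /rk; lra.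
  exists N => m k /subnKC <- /subnKC <-.
  have := Dj N (m - N)%N; have := Dj N (k - N)%N.
  have := ldist_tri oO cO fins (Ou (N + (m - N))%N) (Ou N) (Ou (N + (k - N))%N).
  rewrite (ldist_sym oO cO fins (Ou (N + (m - N))%N) (Ou N)).
  by have := rk0 (N + (m - N))%N; have := rk0 (N + (k - N))%N; lra.
have [s s0 gs] := precompact_ball_local Op.
have s2 : 0 < s / 2 by rewrite divr_gt0.
have [N1 HN1] := cvp _ s2.
have [N2 HN2] := @exists_pow2_lt R (s / 2 / r) ltac:(by rewrite divr_gt0).
pose k := maxn N1 N2.
have [_] := Hu k; apply.
apply: (precompact_ball_sub Op (Ou k) _ gs).
rewrite (ldist_sym oO cO fins Op (Ou k)).
have := HN1 k (leq_maxl _ _).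
have : rk k <= rk N2.
  rewrite ler_pM2l// ler_wiXn2l ?invr_ge0 ?leq_maxr// invf_le1//; lra.
by move: HN2; rewrite ltr_pdivlMr// /rk => h1 h2 h3; lra.
Qed.

End HopfRinow.

(** * The Bergman distance as an induced length distance *)

Section BergmanDistance.
Variables (R : realType) (n : nat).
Local Notation C := R[i].
Local Notation Cn := 'rV[C]_n.
Variable O : set Cn.
Hypotheses (oO : open O) (cO : connected O).
Hypotheses (pos : forall z, O z -> 0 < bergman_kernel O z z) (pd : bergman_posdef O).

Lemma finsler_bergman : finsler (bergman_metric O) O.
Proof.
split.
- by move=> z v; exact: sqrtr_ge0.
- move=> z x v; rewrite !bergman_metricE /rform !bergman_formE sformZ Re_Zr cmod_real.
  by rewrite sqrtrM ?sqr_ge0// sqrtr_sqr normr_id.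
- move=> z v Oz e e0; rewrite bergman_metricE.
  have /cvgrPdist_lt/(_ e e0)/nbhs_normP[d /= d0 Hd] := @sqrt_continuous R (rform O z v).
  have d2 : 0 < d / 2 by rewrite divr_gt0.
  have [d' d'0 Hd'] := continuous_rform oO pos v Oz d2.
  exists d' => // w x wz xv; rewrite bergman_metricE distrC; apply: Hd.
  rewrite /= distrC; apply: le_lt_trans (Hd' w x wz xv) _.
  by rewrite ltr_pdivrMr// mulr_natr mulr2n ltrDl.
- by move=> L; exact: metric_bounds.
Qed.

(** Both infima run over the same curves on the unit interval, and [PL_integral] equates the two
    notions of length; finiteness makes [fine] harmless. *)
Lemma bergman_dist_ldist z w : O z -> O w ->
  bergman_dist O z w = ldist (bergman_metric O) O z w.
Proof.
move=> Oz Ow; have fins := finsler_bergman.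
have lenE g l : curve O g 0 1 -> PL (bergman_metric O) g 0 1 l -> bergman_length O g = l%:E.
  by move=> cg Hg; have [_] := PL_integral (fins_ge0 fins) (fins_cont fins) cg Hg.
rewrite /bergman_dist; set S := [set _ | _ in _].
suff -> : ereal_inf S = (ldist (bergman_metric O) O z w)%:E by [].
apply/eqP; rewrite eq_le; apply/andP; split.
- apply/lee_addgt0Pr => e e0; have [l Hl le] := ldist_approx oO cO fins Oz Ow e0.
  have [g [cg g0 g1 Hg]] := joins01 fins Hl.
  apply: (@le_trans _ _ l%:E); last by rewrite -EFinD lee_fin ltW.
  rewrite -(lenE _ _ cg Hg); apply: ereal_inf_lbound; exists g => //.
  do 3 split => //; first exact: cg.2.
  split; first exact/contV_within/cg.1.
  have [k [p [p0 pk pm pC]]] := PL_C1V Hg; exists k, p; do 3 split => //.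
  by move=> i ik j b; exact: ((C1V_coord g (p i) (p i.+1)).1 (pC i ik)).
- apply: le_ereal_inf_tmp => _ [g [g0 [g1 [gO [cg [k [p [p0 [pk [pm pC]]]]]]]]] <-].
  have Cg : curve O g 0 1 by split => //; exact/contV_within.
  have [l] := @C1V_PL _ _ _ O (fins_cont fins) g 0 k p ltac:(by rewrite pk) p0 pm
    (fun i ik => (C1V_coord g (p i) (p i.+1)).2 (pC i ik)).
  rewrite pk => Hg; rewrite (lenE _ _ Cg Hg) lee_fin; apply: ldist_le => //.
  by exists g, 0, 1.
Qed.

End BergmanDistance.

(** * Convergence of distances from comparison of metrics on compact sets *)

Section DistanceConvergence.
Variables (R : realType) (n : nat).
Local Notation C := R[i].
Local Notation Cn := 'rV[C]_n.
Variables (bmj : nat -> Cn -> Cn -> R) (bm : Cn -> Cn -> R) (Om : nat -> set Cn) (O : set Cn).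
Hypotheses (oOm : forall j, open (Om j)) (cOm : forall j, connected (Om j)).
Hypothesis finsj : forall j, finsler (bmj j) (Om j).
Hypotheses (oO : open O) (cO : connected O) (fins : finsler bm O).
Hypothesis compare : forall (L : set Cn) (eps : R), compact L -> L `<=` O -> 0 < eps < 1 ->
  exists N, forall j, (N <= j)%N -> L `<=` Om j /\ forall z, L z -> forall v,
    (1 - eps) * bm z v <= bmj j z v <= (1 + eps) * bm z v.
Hypothesis precompact : forall x (r : R), O x -> 0 < r -> precompact_ball bm O x r.
Local Notation D := (ldist bm O).

Lemma ldist_bounded z0 (K : set Cn) : O z0 -> compact K -> K `<=` O ->
  exists2 M : R, 0 < M & forall z, K z -> D z0 z <= M.
Proof.
move=> Oz0 cK KO.
have [N HN] : exists N, forall j, (N <= j)%N -> forall z, K z -> D z0 z <= j.+1%:R.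
  apply: compact_uniform => // z /KO Oz.
  have [d d0 Hd] := ldist_continuous oO cO fins Oz0 Oz ltr01.
  exists d => //; exists (Num.bound (D z0 z)) => w j wd Nj.
  have [_ [_]] := Hd w wd; rewrite ltr_norml => /andP[_ h].
  have := archi_boundP (ldist_ge0 oO cO fins Oz0 Oz).
  have : ((Num.bound (D z0 z))%:R : R) <= j%:R by rewrite ler_nat.
  by rewrite -natr1; lra.
by exists N.+1%:R; [rewrite ltr0n|exact: HN].
Qed.

(** Every initial part of a curve of length at most [M] bounds the distance to [z0], so the curve
    stays in [L] and is admissible in [Om j]. *)
Lemma ldist_upper j z0 z (M eps l : R) (L : set Cn) :
  (forall y, O y -> D z0 y <= M -> L y) -> L `<=` Om j ->
  (forall y, L y -> forall v, bmj j y v <= (1 + eps) * bm y v) ->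
  O z0 -> joins bm O z0 z l -> l <= M -> ldist (bmj j) (Om j) z0 z <= (1 + eps) * l.
Proof.
move=> HL LOm bnd Oz0 [g [a [b [cg ga gb H]]]] lM.
have gL t : a <= t <= b -> L (g t).
  move=> tab; apply: HL; first exact: cg.2.
  have [l1 [l2 [H1 H2 lE]]] := PL_split tab H.
  have l20 := PL_ge0 (fins_ge0 fins) H2; have /andP[ta tb] := tab.
  have : joins bm O z0 (g t) l1 by exists g, a, t; split => //; exact: curve_sub (lexx _) tb cg.
  by move=> /(ldist_le fins); lra.
have cgj : curve (Om j) g a b by split; [exact: cg.1|move=> t /gL/LOm].
have [l' H' l'l] := PL_compare (fins_ge0 (finsj j)) (fins_cont (finsj j)) H cgj
  (fun t v tab => bnd (g t) (gL t tab) v).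
apply: le_trans l'l; apply: (ldist_le (finsj j)).
by exists g, a, b.
Qed.

(* Up to its first exit from the ball of radius [M] the curve runs in the
   compact set [L], where the two metrics are comparable; if it does leave that
   ball, its length already exceeds the distance to [z]. *)
Lemma ldist_lower_bound j z0 z (M eps l : R) (L : set Cn) : compact L -> L `<=` O ->
  (forall y, O y -> D z0 y <= M -> L y) -> eps < 1 ->
  (forall y, L y -> forall v, (1 - eps) * bm y v <= bmj j y v) ->
  O z0 -> 0 <= M -> D z0 z <= M -> joins (bmj j) (Om j) z0 z l -> (1 - eps) * D z0 z <= l.
Proof.
move=> cL LO HL eps1 bnd Oz0 M0 zM [g [a [b [[cg gO] ga gb H]]]].
have ab := PL_le H.
have Lclosed : closed L by apply: compact_closed => //; exact: norm_hausdorff.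
have [|t tab Pt|t tab [Ot tM] nE|T [Tab PT TE]] := @first_exit R
  (fun t => O (g t) /\ D z0 (g t) <= M) (fun t => D z0 (g t) = M) a b ab.
- by rewrite ga (ldist_refl oO cO fins Oz0).
- have near_t (d : R) : 0 < d -> exists s, [/\ O (g s), D z0 (g s) <= M & pball (g t) d (g s)].
    move=> d0; have [d' d'0 Hd] := cg t ltac:(lra) d d0.
    pose s := Num.max a (t - d' / 2).
    have st : s < t by rewrite gt_max; apply/andP; split; lra.
    have s0 : a <= s by rewrite le_max lexx.
    have sd : t - d' / 2 <= s by rewrite le_max lexx orbT.
    have [Os sM] := Pt s ltac:(lra).
    by exists s; split => //; apply: Hd; [lra|rewrite ltr_norml; lra].
  have Lt : L (g t).
    apply: Lclosed => A /nbhs_nvP[d d0 Hd].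
    have [s [Os sM sd]] := near_t d d0.
    by exists (g s); split; [exact: HL|exact: Hd].
  have Ot := LO _ Lt; split => //; rewrite leNgt; apply/negP => Mt.
  have Mt' : 0 < D z0 (g t) - M by rewrite subr_gt0.
  have [d d0 Hd] := ldist_continuous oO cO fins Oz0 Ot Mt'.
  have [s [Os sM /Hd[_ [_]]]] := near_t d d0.
  by rewrite ltr_norml; lra.
- have Mt : 0 < M - D z0 (g t) by rewrite subr_gt0 lt_neqAle tM andbT; exact/eqP.
  have [d d0 Hd] := ldist_continuous oO cO fins Oz0 Ot Mt.
  have [d' d'0 Hd'] := cg t ltac:(lra) d d0.
  exists d' => // s st sb; have /Hd[Os [_ h]] := Hd' s ltac:(lra) ltac:(rewrite ltr_norml; lra).
  by split => //; move: h; rewrite ltr_norml; lra.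
- have [l1 [l2 [H1 H2 ->]]] := PL_split Tab H.
  have l20 := PL_ge0 (fins_ge0 (finsj j)) H2; have /andP[aT Tb] := Tab.
  have cgT : curve O g a T by split; [exact: contV_sub (lexx _) Tb cg|move=> t /PT[]].
  have e1 : 0 < 1 - eps by rewrite subr_gt0.
  have [|l' H' l'l] := @PL_compare _ _ _ bm O g a T l1 (1 - eps)^-1 (fins_ge0 fins)
    (fins_cont fins) H1 cgT.
    move=> t v tab; rewrite mulrC ler_pdivlMr// mulrC; apply: bnd.
    by have [Ot tM] := PT t tab; exact: HL.
  have : D z0 (g T) <= l'.
    by apply: (ldist_le fins); exists g, a, T.
  have : D z0 z <= D z0 (g T) by case: TE => [->|->//]; rewrite gb.
  move=> h1 h2; have : D z0 z <= (1 - eps)^-1 * l1 by lra.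
  by rewrite mulrC ler_pdivlMr// mulrC; lra.
Qed.

Lemma ldist_cvg z0 (K : set Cn) (e : R) : O z0 -> compact K -> K `<=` O -> 0 < e ->
  exists N, forall j, (N <= j)%N -> forall z, K z ->
    `|ldist (bmj j) (Om j) z0 z - D z0 z| < e.
Proof.
move=> Oz0 cK KO e0; have [M M0 HM] := ldist_bounded Oz0 cK KO.
(* The extra 1 leaves room for a curve that exceeds the distance by [eta <= 1]. *)
have M1 : 0 < M + 1 by rewrite addr_gt0.
have [L [cL LO HL]] := precompact Oz0 M1.
(* The upper error is [eps * D z0 z + eta + eps * eta], at most [e / 4 + e / 4 + e / 8]; the lower
   error is its first term alone. *)
pose eps := Num.min (1 / 2) (e / 4 / (M + 1)).
have ep0 : 0 < eps by rewrite lt_min !divr_gt0.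
have ep2 : eps <= 1 / 2 by rewrite ge_min lexx.
have epM : eps * (M + 1) <= e / 4 by rewrite -ler_pdivlMr// ge_min lexx orbT.
have eps01 : 0 < eps < 1 by lra.
have [N HN] := compare cL LO eps01.
exists N => j Nj z Kz; have [LOm bnd] := HN j Nj.
have Oz := KO z Kz; have zM := HM z Kz.
have Lz : L z by apply: HL => //; lra.
have Lz0 : L z0 by apply: HL => //; rewrite (ldist_refl oO cO fins Oz0) ltW.
have D0 := ldist_ge0 oO cO fins Oz0 Oz.
have epD : eps * D z0 z <= e / 4.
  by apply: le_trans epM; rewrite ler_wpM2l ?(ltW ep0)//; lra.
have lo : (1 - eps) * D z0 z <= ldist (bmj j) (Om j) z0 z.
  apply: (ldist_ge (@oOm j) (@cOm j) (finsj j) (LOm _ Lz0) (LOm _ Lz)) => l.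
  apply: (@ldist_lower_bound j z0 z (M + 1) eps l L) => //; [lra| |exact: ltW|lra].
  by move=> y Ly v; have /andP[] := bnd y Ly v.
pose eta := Num.min 1 (e / 4).
have eta0 : 0 < eta by rewrite lt_min ltr01 divr_gt0.
have eta1 : eta <= 1 by rewrite ge_min lexx.
have etae : eta <= e / 4 by rewrite ge_min lexx orbT.
have [l Hl le] := ldist_approx oO cO fins Oz0 Oz eta0.
have up : ldist (bmj j) (Om j) z0 z <= (1 + eps) * l.
  apply: (ldist_upper HL LOm) Hl _ => //; last by lra.
  by move=> y Ly v; have /andP[] := bnd y Ly v.
have : eps * eta <= 1 / 2 * eta by rewrite ler_wpM2r ?(ltW eta0).
have : (1 + eps) * l <= (1 + eps) * (D z0 z + eta) by rewrite ler_wpM2l ?(ltW le)//; lra.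
rewrite ltr_norml; move: lo up epD; move: (ldist _ _ z0 z) (D z0 z) => x y; nra.
Qed.

End DistanceConvergence.

Theorem theorem4p1 (R : realType) (n : nat)
    (Om : nat -> set 'rV[R[i]]_n) (Oinf : set 'rV[R[i]]_n) :
  (forall j, domain (Om j)) -> domain Oinf ->
  local_hausdorff_cvg Om Oinf ->
  (* (a) *)
  (forall z, Oinf z -> 0 < bergman_kernel Oinf z z) ->
  bergman_posdef Oinf ->
  (* (b) *)
  (forall j, bergman_complete (Om j)) -> bergman_complete Oinf ->
  (* (c) *)
  (forall z, Oinf z ->
     (fun j => bergman_kernel (Om j) z z) @ \oo --> bergman_kernel Oinf z z) ->
  forall z0, Oinf z0 ->
  forall Kc : set 'rV[R[i]]_n, compact Kc -> Kc `<=` Oinf ->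
  forall e : R, 0 < e ->
  \forall j \near \oo, forall z, Kc z ->
    `|bergman_dist (Om j) z0 z - bergman_dist Oinf z0 z| < e.
Proof.
move=> dOm [oO [cO _]] [incl _] posO pdO compj [_ [_ complete]] cvgK z0 Oz0 K cK KO e e0.
have oOm j : open (Om j) by case: (dOm j).
have cOm j : connected (Om j) by case: (dOm j) => _ [].
have posj j : forall z, Om j z -> 0 < bergman_kernel (Om j) z z by case: (compj j).
have pdj j : bergman_posdef (Om j) by case: (compj j) => _ [].
have KC : kernel_cvg Om Oinf by split.
have fins := finsler_bergman oO posO pdO.
have finsj j := finsler_bergman (oOm j) (@posj j) (pdj j).
have distE := bergman_dist_ldist oO cO posO pdO.
have distjE j := bergman_dist_ldist (oOm j) (cOm j) (@posj j) (pdj j).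
have precompact := hopf_rinow oO cO fins.
have [||N1 H1] := @ldist_cvg R n (fun j => bergman_metric (Om j)) (bergman_metric Oinf) Om Oinf
  oOm cOm finsj oO cO fins _ _ z0 K e Oz0 cK KO e0.
- move=> L eps cL LO eps01; have [N HN] := metric_compare KC pdO cL LO eps01.
  have [N' _ HN'] := incl L cL LO.
  exists (maxn N N') => j; rewrite geq_max => /andP[Nj N'j]; split; first exact: HN'.
  exact: HN.
(* Completeness is stated for [bergman_dist] and is carried over to [ldist] before applying
   Hopf-Rinow. *)
- apply: precompact => u Ou cu.
  have [|p Op /cvgrPdist_lt cv] := complete u Ou.
    move=> d d0; have [N HN] := cu d d0; exists N => m k Nm Nk.
    by rewrite distE//; exact: HN.
  exists p => // d d0; have [N _ HN] := cv d d0; exists N => k Nk.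
  have := HN k Nk; rewrite /= sub0r normrN distE//; apply: le_lt_trans; exact: ler_norm.
(* The two distances agree only between points of the domain, so both [K] and the singleton of [z0]
   must lie in [Om j]. *)
have [N2 _ H2] := incl K cK KO.
have [N3 _ H3] := incl _ (@compact_set1 _ z0) (fun y yz => ltac:(by rewrite yz)).
exists (maxn N1 (maxn N2 N3)) => // j /=; rewrite !geq_max => /and3P[h1 h2 h3] z Kz.
rewrite distE ?distjE//; [exact: H1|exact: (H3 j h3)|exact: H2 h2 z Kz|exact: KO].
Qed.
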